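(* Let $T,\gamma>0$ and let $\mathcal{G}$ be the operator mapping a forcing $u\in L^2([0,T])$ to the solution $v=(v_1,v_2)$ on $[0,T]$ of the gravity pendulum system $$\frac{dv_1}{dt}=v_2,\qquad \frac{dv_2}{dt}=-\gamma\sin(v_1)+u(t),\qquad v(0)=0 .$$ Let the forcing be distributed according to the probability measure $\mu$ on $L^2([0,T])$ given as the law of $$u(t;Y)=\sum_{k\in\mathbb{Z}}Y_k\,\alpha_k\,\mathbf{e}_k\!\left(\tfrac{2\pi t}{T}\right),\qquad t\in[0,T],$$ where $Y_k$ are iid random variables with values in $[-1,1]$ and $0\le\alpha_k\le C_\alpha\exp(-|k|\ell)$ for all $k\in\mathbb{Z}$, for some constants $C_\alpha,\ell>0$. Then for any $k,r\in\mathbb{N}$ there exist a constant $C=C(k,r)>0$ and a constant $c>0$, both independent of $m$ and $p$, such that for any $m,p\in\mathbb{N}$ there exists a DeepONet with $m$ sensors, trunk net $\tau$ and branch net $\beta$ (with $p$ branch outputs) such that $$\mathrm{size}(\tau)\le C(1+p^3),\qquad \mathrm{depth}(\tau)\le C(1+p\log(p)),$$ $$\mathrm{size}(\beta)\le C(1+pm\log(m)\log\log(m)),\qquad \mathrm{depth}(\beta)\le C(1+\log(m)\log\log(m)),$$ and such that the DeepONet approximation error is bounded by $$\widehat{\mathscr{E}}\le C e^{-c\ell m}+C m^{-k}+C p^{-r}.$$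
   Context: $\mathbf{e}_k$, $k\in\mathbb{Z}$, is the real Fourier basis on $[0,2\pi]$, normalized in $L^2([0,2\pi])$: $\mathbf{e}_k(x)=C_k\cos(kx)$ for $k\ge0$ and $\mathbf{e}_k(x)=C_k\sin(kx)$ for $k<0$, with $C_k>0$ such that $\|\mathbf{e}_k\|_{L^2}=1$. Neural network: a ReLU network $C_K\circ\sigma\circ\cdots\circ\sigma\circ C_1$ ($C_k$ affine, $\sigma(z)=\max(z,0)$ componentwise); size = number of nonzero weights and biases, depth = $K-1$ = number of hidden layers. DeepONet with $m$ sensors: $\mathcal{N}(u)(t)=\tau_0(t)+\sum_{k=1}^p\beta_k(u)\tau_k(t)$, where $\beta(u)=\mathcal{A}(u(t_1),\dots,u(t_m))$ for sensor points $t_1,\dots,t_m\in[0,T]$ and a neural network $\mathcal{A}:\mathbb{R}^m\to\mathbb{R}^p$ ($\mathrm{size}(\beta):=\mathrm{size}(\mathcal{A})$, $\mathrm{depth}(\beta):=\mathrm{depth}(\mathcal{A})$), and the trunk net $\tau=(\tau_0,\dots,\tau_p)$ is a neural network with each $\tau_k:[0,T]\to\mathbb{R}^2$. Error: $\widehat{\mathscr{E}}=\left(\int\|\mathcal{G}(u)-\mathcal{N}(u)\|_{L^2([0,T])}^2\,d\mu(u)\right)^{1/2}$. Convention: for $m\in\{1,2\}$ the expression $\log(m)\log\log(m)$ is read as $1$. The constants $C$, $c$ may depend on $T,\gamma,\mu$. *)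

(* Defs.v *)
From HB Require Import structures.
From mathcomp Require Import all_boot all_order all_algebra.
From mathcomp Require Import all_classical all_reals all_analysis.

Set Implicit Arguments.
Unset Strict Implicit.
Unset Printing Implicit Defensive.

Import Order.TTheory GRing.Theory Num.Theory.
Import numFieldNormedType.Exports.

Local Open Scope classical_set_scope.
Local Open Scope ring_scope.

(** * ReLU networks *)

(* [Affine W b] is the last affine map x |-> x *m W + b; [Hidden W b f] is f
   applied to sigma (x *m W + b).  Vectors are rows. *)
Inductive relu_net (R : realType) : nat -> nat -> Type :=
| Affine m n : 'M[R]_(m, n) -> 'rV[R]_n -> relu_net R m n
| Hidden m h n : 'M[R]_(m, h) -> 'rV[R]_h -> relu_net R h n -> relu_net R m n.

Definition relu (R : realType) n (x : 'rV[R]_n) : 'rV[R]_n :=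
  map_mx (fun z => Num.max z 0) x.

Fixpoint net_eval (R : realType) m n (f : relu_net R m n) :
    'rV[R]_m -> 'rV[R]_n :=
  match f with
  | Affine _ _ W b => fun x => x *m W + b
  | Hidden _ _ _ W b g => fun x => net_eval g (relu (x *m W + b))
  end.

Definition nonzero_entries (R : realType) m n (W : 'M[R]_(m, n)) : nat :=
  #|[pred ij : 'I_m * 'I_n | W ij.1 ij.2 != 0]|.

Fixpoint net_size (R : realType) m n (f : relu_net R m n) : nat :=
  match f with
  | Affine _ _ W b => (nonzero_entries W + nonzero_entries b)%N
  | Hidden _ _ _ W b g =>
      (nonzero_entries W + nonzero_entries b + net_size g)%N
  end.

Fixpoint net_depth (R : realType) m n (f : relu_net R m n) : nat :=
  match f with
  | Affine _ _ _ _ => 0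
  | Hidden _ _ _ _ _ g => (net_depth g).+1
  end.

(** * The space L^2([0,T]) and its Borel sigma-algebra *)

Definition leb0T (R : realType) (T : R) :
    {measure set (measurableTypeR R) -> \bar R} :=
  mrestr (@lebesgue_measure R) (measurable_itv `[0%R, T]).

(* Elements are classes modulo almost everywhere equality on [0,T]; the coercion
   to functions picks an arbitrary representative. *)
Definition L2 (R : realType) (T : R) : Type := LspaceType2 (leb0T T).

Definition L2_dist (R : realType) (T : R) (u v : L2 T) : \bar R :=
  Lnorm (leb0T T) 2%:E (fun t => (u t - v t)%:E).

Definition L2_open (R : realType) (T : R) : set (set (L2 T)) :=
  [set O | forall u, O u ->
    exists2 e : R, 0 < e & forall v, (L2_dist u v < e%:E)%E -> O v].

(* [g_sigma_algebraType] needs a pointed type: zero is the base point. *)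
Section L2_pointed.
Context (R : realType) (T : R).

Let mT : measurableType _ := measurableTypeR R.

Definition L2_zero_class : {mfun_ leb0T T, mT >-> mT} :=
  (\pi_({mfun_ leb0T T, mT >-> mT}) (cst 0 : {mfun mT >-> mT}))%qT.

Lemma L2_zero_finite : finite_norm (leb0T T) 2%:E L2_zero_class.
Proof.
have /eqmodP/asboolP ae0 :
    repr L2_zero_class = cst 0 %[mod {mfun_ leb0T T, mT >-> mT}]%qT.
  by rewrite reprK.
rewrite /finite_norm unlock /Lnorm poweR_lty// (ae_eq_integral (cst 0%E)).
- by rewrite integral0 ltry.
- by [].
- apply/measurable_realfun.measurable_EFinP/(@measurableT_comp _ _ _ _ _ _ (fun x : R => x `^ 2)%R) => //.
  by apply: measurableT_comp => //; exact: measurable_funP.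
- by [].
- apply: filterS ae0 => t /(_ I) /= ht _.
  by rewrite /aqEqMfun_to_fun ht normr0 powR0.
Qed.

Let zero_mixin :=
  isFinLebesgue.Build _ _ _ (leb0T T) 2%:E (lee1n 2) L2_zero_class L2_zero_finite.
HB.instance Definition _ := zero_mixin.

Definition L2_zero : L2 T := [the LspaceType2 (leb0T T) of L2_zero_class].

HB.instance Definition _ := gen_eqMixin (L2 T).
HB.instance Definition _ := gen_choiceMixin (L2 T).
HB.instance Definition _ := isPointed.Build (L2 T) L2_zero.

End L2_pointed.

Definition L2_borel (R : realType) (T : R) := g_sigma_algebraType (@L2_open R T).

(** * The random forcing *)

Definition iid (d : measure_display) (Omega : measurableType d) (R : realType)
    (P : probability Omega R) (Y : int -> {RV P >-> R}) : Prop :=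
  (forall (s : seq int) (B : int -> set R), uniq s ->
     (forall k, measurable (B k)) ->
     (P (\bigcap_(k in [set` s]) (Y k @^-1` B k)) =
      \prod_(k <- s) P (Y k @^-1` B k))%E) /\
  (forall (j k : int) (B : set R), measurable B ->
     distribution P (Y j) B = distribution P (Y k) B).

Definition fourier_wave (R : realType) (k : int) (x : R) : R :=
  if 0 <= k then cos (k%:~R * x) else sin (k%:~R * x).

Definition fourier_const (R : realType) (k : int) : R :=
  (Num.sqrt (\int[@lebesgue_measure R]_(x in `[0%R, 2 * pi])
               (fourier_wave k x ^+ 2)))^-1.

Definition fourier_basis (R : realType) (k : int) (x : R) : R :=
  fourier_const R k * fourier_wave k x.

(* Limit of the symmetric partial sums over -n <= k <= n. *)
Definition forcing (R : realType) (T : R) (alpha y : int -> R) (t : R) : R :=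
  limn (fun n : nat => \sum_(i < n.*2.+1)
    (let k := i%:Z - n%:Z in
     y k * alpha k * fourier_basis k (2 * pi * t / T))).

(** * The pendulum operator *)

Definition abs_continuous (R : realType) (T : R) (f : R -> R) : Prop :=
  forall e : R, 0 < e -> exists2 delta : R, 0 < delta &
    forall (n : nat) (a b : 'I_n -> R),
      (forall i, [/\ 0 <= a i, a i <= b i & b i <= T]) ->
      trivIset [set: 'I_n] (fun i => `]a i, b i[%classic) ->
      \sum_i (b i - a i) < delta ->
      \sum_i `|f (b i) - f (a i)| < e.

(* Solution in the sense of Caratheodory, as is needed for u in L^2: both
   components are absolutely continuous on [0,T], and the equations hold almost
   everywhere. *)
Definition pendulum_solution (R : realType) (gamma T : R) (u : R -> R)
    (v : R -> 'rV[R]_2) : Prop :=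
  [/\ abs_continuous T (fun t => v t 0 0),
      abs_continuous T (fun t => v t 0 1),
      {ae @lebesgue_measure R, forall t : R, t \in `]0, T[ ->
         is_derive t (1 : R) (fun s => v s 0 0) (v t 0 1)},
      {ae @lebesgue_measure R, forall t : R, t \in `]0, T[ ->
         is_derive t (1 : R) (fun s => v s 0 1)
           (- gamma * sin (v t 0 0) + u t)} &
      v 0 = 0].

(** * DeepONets *)

(* Point values of a class u in L^2 are those of its continuous representative;
   it is unique on [0,T] when it exists.  Classes without one (a null set for
   the law of the forcing) get an arbitrary value. *)
Definition L2_eval (R : realType) (T : R) (u : L2 T) (t : R) : R :=
  xget (u : R -> R) [set f : R -> R | {within `[0, T], continuous f} /\
    {ae leb0T T, forall s, u s = f s}] t.

Record deeponet (R : realType) (T : R) (m p : nat) := DeepONet {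
  sensor : 'I_m -> R;
  sensor_itv : forall j, 0 <= sensor j <= T;
  branch : relu_net R m p;
  (* tau_0, ..., tau_p with values in R^2, listed row by row *)
  trunk : relu_net R 1 (p.+1 * 2)%N
}.

Definition branch_eval (R : realType) (T : R) (m p : nat) (N : deeponet T m p)
    (u : L2 T) : 'rV[R]_p :=
  net_eval (branch N) (\row_j L2_eval u (sensor N j)).

Definition trunk_eval (R : realType) (T : R) (m p : nat) (N : deeponet T m p)
    (k : 'I_p.+1) (t : R) : 'rV[R]_2 :=
  row k (vec_mx (net_eval (trunk N) (const_mx t))).

Definition deeponet_eval (R : realType) (T : R) (m p : nat)
    (N : deeponet T m p) (u : L2 T) (t : R) : 'rV[R]_2 :=
  trunk_eval N ord0 t +
  \sum_(k < p) branch_eval N u 0 k *: trunk_eval N (lift ord0 k) t.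

Definition deeponet_error (R : realType) (T : R) (m p : nat)
    (mu : probability (L2_borel T) R) (G : L2 T -> R -> 'rV[R]_2)
    (N : deeponet T m p) : \bar R :=
  ((\int[mu]_u \int[@lebesgue_measure R]_(t in `[0%R, T])
      (\sum_(i < 2) (G u t 0 i - deeponet_eval N u t 0 i) ^+ 2)%:E) `^ 2^-1)%E.

Definition log_loglog (R : realType) (m : nat) : R :=
  if (m <= 2)%N then 1 else ln m%:R * ln (ln m%:R).

(* Main.v *)
(* The forcing is smooth in time, uniformly in the realisation, so the solution
   [v] and the right hand side [g = v'] are well approximated on [n] blocks of
   length [T / n] by polynomials: [v] is within [n^-K] of [S g], where [S]
   integrates the polynomial interpolating [g] at the nodes of each block.  The
   trunk net realises the fixed functions occurring in [S]; the branch net outputs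
   the values of [g] at the nodes.  These solve a fixed point equation up to
   [n^-K], and [O(log n)] Picard iterations, each of bounded depth, suffice
   because the Picard map contracts in an exponentially weighted maximum norm.
   The only nonlinearities are products and the sine; ReLU nets of constant depth
   and width [O(w)] reproduce [x^2] up to [w^-K] for every [K], hence polynomials,
   hence, through [S], the sine.  Taking [n] to be a small power of [min(m, p)],
   even dense weight matrices fit in the size bounds, and [n^-K] is a power of
   [m^-1] or of [p^-1] as high as desired. *)

Require Import Defs.
From mathcomp Require Import all_boot all_order all_algebra.
From mathcomp Require Import all_classical all_reals all_analysis.
From mathcomp Require Import ring lra zify.

Set Implicit Arguments.
Unset Strict Implicit.
Unset Printing Implicit Defensive.

Import Order.TTheory GRing.Theory Num.Theory.
Import numFieldNormedType.Exports.

Local Open Scope classical_set_scope.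
Local Open Scope ring_scope.

(** * ReLU networks as layers of functions *)

(** The dense size of the branch net limits the number of blocks: at each of the [n * Q] nodes it
    runs a sine net of width [O(n^2)], so its layers have width [O(n^3)] and [O(n^6)] weights, and
    [O(log n)] of them stay within [O(n^7)]. Hence [n^8 <= min(m, p)], and an order [8 * (k + r)] in
    [n] is requested. In the plain maximum norm the Picard map contracts only for short times.
    Weighting block [b] by [(1 + lam * H)^b] makes one integration a factor [O(1 / lam)], uniformly
    in [n], while the weight never exceeds [e^(lam * T)] and so costs a constant once. All constants
    must be uniform over the realisations, so the analysis is done for families indexed by the
    sample space. The equations hold a priori only almost everywhere; absolute continuity and the
    continuity of the right hand side make them classical on the open interval, and all quadrature
    nodes are kept inside it. *)

Section Reach.
Context (R : realType).

(** What one affine map can produce from the family [F], stated for functions on an arbitrary domain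
    rather than for matrices: subnetworks can then be fed with any inputs, and consecutive affine
    maps merge without a new layer. *)
Definition affspan (X : Type) (I : finType) (F : I -> X -> R) (g : X -> R) :=
  exists (c : I -> R) (b : R), forall x, g x = \sum_i c i * F i x + b.

Lemma affspan_gen X (I : finType) (F : I -> X -> R) i : affspan F (F i).
Proof.
exists (fun j => (j == i)%:R), 0 => x.
rewrite addr0 (bigD1 i)//= eqxx mul1r big1 ?addr0// => j /negPf ->.
by rewrite mul0r.
Qed.

Lemma affspan_cst X (I : finType) (F : I -> X -> R) c : affspan F (fun=> c).
Proof. by exists (fun=> 0), c => x; rewrite big1 ?add0r// => i _; rewrite mul0r. Qed.

Lemma affspanD X (I : finType) (F : I -> X -> R) g h :
  affspan F g -> affspan F h -> affspan F (fun x => g x + h x).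
Proof.
move=> [c [b gE]] [d [e hE]]; exists (fun i => c i + d i), (b + e) => x.
rewrite gE hE addrACA -big_split/=; congr (_ + _).
by apply: eq_bigr => i _; rewrite mulrDl.
Qed.

Lemma affspanZ X (I : finType) (F : I -> X -> R) a g :
  affspan F g -> affspan F (fun x => a * g x).
Proof.
move=> [c [b gE]]; exists (fun i => a * c i), (a * b) => x.
rewrite gE mulrDr mulr_sumr; congr (_ + _).
by apply: eq_bigr => i _; rewrite mulrA.
Qed.

Lemma affspan_ext X (I : finType) (F : I -> X -> R) g h :
  affspan F g -> g =1 h -> affspan F h.
Proof. by move=> [c [b gE]] gh; exists c, b => x; rewrite -gh. Qed.

Lemma affspan_sum X (I J : finType) (F : I -> X -> R) (g : J -> X -> R) :
  (forall j, affspan F (g j)) -> affspan F (fun x => \sum_j g j x).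
Proof.
move=> gF; suff : forall s : seq J, affspan F (fun x => \sum_(j <- s) g j x) by exact.
elim=> [|j s IH].
  by apply: affspan_ext (affspan_cst F 0) _ => x; rewrite big_nil.
by apply: affspan_ext (affspanD (gF j) IH) _ => x; rewrite big_cons.
Qed.

Lemma affspan_trans X (I J : finType) (F : I -> X -> R) (G : J -> X -> R) g :
  (forall j, affspan F (G j)) -> affspan G g -> affspan F g.
Proof.
move=> FG [c [b gE]].
have := affspanD (affspan_sum (fun j => affspanZ (c j) (FG j))) (affspan_cst F b).
by move/affspan_ext; apply => x; rewrite gE.
Qed.

Lemma affspan_pre X Z (phi : Z -> X) (I : finType) (F : I -> X -> R) g :
  affspan F g -> affspan (fun i z => F i (phi z)) (fun z => g (phi z)).
Proof. by move=> [c [b gE]]; exists c, b => z; rewrite gE. Qed.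

(* [reach W L F G]: the functions [G] are outputs of a ReLU network with [L]
   hidden layers of [W] units each, fed with the functions [F]. *)
Fixpoint reach (X : Type) (W L : nat) (I : finType) (F : I -> X -> R)
    (J : finType) (G : J -> X -> R) : Prop :=
  match L with
  | 0 => forall j, affspan F (G j)
  | L'.+1 => exists2 K : 'I_W -> X -> R, forall h, affspan F (K h) &
      reach W L' (fun h x => Num.max (K h x) 0) G
  end.

Lemma reach_affl X W L (I I' J : finType) (F : I -> X -> R) (F' : I' -> X -> R)
    (G : J -> X -> R) :
  (forall i, affspan F' (F i)) -> reach W L F G -> reach W L F' G.
Proof.
case: L => [|L] /= FF'.
  by move=> h j; apply: affspan_trans (h j).
by move=> [K hK rK]; exists K => // h; apply: affspan_trans (hK h).
Qed.

Lemma reach_affr X W L (I J J' : finType) (F : I -> X -> R)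
    (G : J -> X -> R) (G' : J' -> X -> R) :
  reach W L F G -> (forall k, affspan G (G' k)) -> reach W L F G'.
Proof.
elim: L I F => [|L IH] I F /=.
  by move=> h hk k; apply: affspan_trans (hk k).
by move=> [K hK rK] h; exists K => //; apply: IH.
Qed.

(** Units beyond [#|H|] are filled with the zero function, so a layer may be indexed by any finite
    type with at most [W] elements. *)
Lemma reachS X W L (I H J : finType) (F : I -> X -> R) (K : H -> X -> R)
    (G : J -> X -> R) : (#|H| <= W)%N -> (forall h, affspan F (K h)) ->
  reach W L (fun h x => Num.max (K h x) 0) G -> reach W L.+1 F G.
Proof.
move=> HW hK rK; pose K' (i : 'I_W) x :=
  if insub (i : nat) is Some j then K (@enum_val H H j) x else 0.
exists K' => [i|].
  rewrite /K'; case: insubP => [j _ _|_]; [exact: hK|exact: affspan_cst].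
apply: reach_affl rK => h.
have hW : (enum_rank h < W)%N by apply: leq_trans HW; exact: ltn_ord.
apply: affspan_ext (affspan_gen _ (Ordinal hW)) _ => x /=.
by rewrite /K' /= valK enum_rankK.
Qed.

Lemma reach_comp X W L L' (I J H : finType) (F : I -> X -> R) (G : J -> X -> R)
    (K : H -> X -> R) : reach W L F G -> reach W L' G K -> reach W (L + L') F K.
Proof.
elim: L I F => [|L IH] I F /=.
  by move=> FG; apply: reach_affl.
by move=> [M hM rM] GK; exists M => //; exact: IH.
Qed.

Lemma reach_mono X W W' L (I J : finType) (F : I -> X -> R) (G : J -> X -> R) :
  (W <= W')%N -> reach W L F G -> reach W' L F G.
Proof.
move=> WW'; elim: L I F => [//|L IH] I F [K hK rK].
by apply: (reachS _ hK); [rewrite card_ord|exact: IH].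
Qed.

Lemma reach_family X W L (A I J : finType) (F : I -> X -> R) (G : A -> J -> X -> R) :
  (forall a, reach W L F (G a)) ->
  reach (#|A| * W) L F (fun aj : A * J => G aj.1 aj.2).
Proof.
(* Generalised to separate inputs for each member: after one layer the copies no longer share
   theirs. *)
suff : forall (I' : finType) (F' : A -> I' -> X -> R), (forall a, reach W L (F' a) (G a)) ->
    reach (#|A| * W) L (fun ai : A * I' => F' ai.1 ai.2)
      (fun aj : A * J => G aj.1 aj.2).
  move=> h FG; have := h I (fun=> F) FG.
  by apply: reach_affl => -[a i]; exact: affspan_gen.
elim: L => [|L IH] I' F' /=.
  move=> FG [a j] /=; apply: affspan_trans (FG a j) => i.
  exact: (affspan_gen _ (a, i)).
move=> h.
have /choice[K hK] : forall a, exists K : 'I_W -> X -> R,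
    (forall i, affspan (F' a) (K i)) /\
    reach W L (fun i x => Num.max (K i x) 0) (G a).
  by move=> a; have [K hK rK] := h a; exists K.
apply: (@reachS _ _ _ _ _ _ _ (fun ai : A * 'I_W => K ai.1 ai.2)).
- by rewrite card_prod card_ord.
- move=> [a i] /=; apply: affspan_trans (proj1 (hK a) i) => i'.
  exact: (affspan_gen _ (a, i')).
- exact: (IH _ (fun a i x => Num.max (K a i x) 0) (fun a => proj2 (hK a))).
Qed.

Lemma reach_par X W1 W2 L (I J1 J2 : finType) (F : I -> X -> R)
    (G1 : J1 -> X -> R) (G2 : J2 -> X -> R) :
  reach W1 L F G1 -> reach W2 L F G2 ->
  reach (W1 + W2) L F (fun j => match j with inl j => G1 j | inr j => G2 j end).
Proof.
suff : forall (I1 I2 : finType) (F1 : I1 -> X -> R) (F2 : I2 -> X -> R),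
    reach W1 L F1 G1 -> reach W2 L F2 G2 ->
    reach (W1 + W2) L (fun i => match i with inl j => F1 j | inr j => F2 j end)
      (fun j => match j with inl j => G1 j | inr j => G2 j end).
  move=> h r1 r2; have := h _ _ _ _ r1 r2.
  by apply: reach_affl => -[i|i]; exact: affspan_gen.
elim: L => [|L IH] I1 I2 F1 F2 /=.
  move=> h1 h2 [j|j]; [apply: affspan_trans (h1 j)|apply: affspan_trans (h2 j)] => i.
    exact: (affspan_gen _ (inl i)).
  exact: (affspan_gen _ (inr i)).
move=> [K1 h1 r1] [K2 h2 r2].
apply: (@reachS _ _ _ _ _ _ _ (fun i => match i with inl j => K1 j | inr j => K2 j end)).
- by rewrite card_sum !card_ord.
- move=> [j|j]; [apply: affspan_trans (h1 j)|apply: affspan_trans (h2 j)] => i.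
    exact: (affspan_gen _ (inl i)).
  exact: (affspan_gen _ (inr i)).
- by apply: reach_affl (IH _ _ _ _ r1 r2) => -[i|i];
    [exact: (affspan_gen _ (inl i))|exact: (affspan_gen _ (inr i))].
Qed.

Lemma reach_pre X Z (phi : Z -> X) W L (I J : finType) (F : I -> X -> R)
    (G : J -> X -> R) : reach W L F G ->
  reach W L (fun i z => F i (phi z)) (fun j z => G j (phi z)).
Proof.
elim: L I F => [|L IH] I F /=.
  by move=> h j; exact: (affspan_pre phi (h j)).
move=> [K hK rK]; exists (fun i z => K i (phi z)).
  by move=> h; exact: (affspan_pre phi (hK h)).
exact: IH rK.
Qed.

Lemma reach_ext X W L (I J : finType) (F : I -> X -> R) (G G' : J -> X -> R) :
  reach W L F G -> (forall j, G j =1 G' j) -> reach W L F G'.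
Proof.
by move=> /reach_affr h GG'; apply: h => j; apply: affspan_ext (affspan_gen _ j) _.
Qed.

(* [x = max x 0 - max (-x) 0] *)
Lemma reach_id X W L (I : finType) (F : I -> X -> R) :
  (#|I| + #|I| <= W)%N -> reach W L F F.
Proof.
move=> IW; elim: L => [|L IH] /=; first by move=> i; exact: affspan_gen.
apply: (@reachS _ _ _ _ (I + I)%type _ _
  (fun i => match i with inl j => F j | inr j => fun x => -1 * F j x end)).
- by rewrite card_sum.
- by move=> [j|j]; [exact: affspan_gen|apply/affspanZ/affspan_gen].
- apply: reach_affl IH => i.
  apply: affspan_ext (affspanD (affspan_gen _ (inl i))
    (affspanZ (-1) (affspan_gen _ (inr i)))) _ => x.
  by rewrite /Num.max; do 2 case: ifPn; rewrite -?leNgt; lra.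
Qed.

Lemma reach_pad X W L L' (I J : finType) (F : I -> X -> R) (G : J -> X -> R) :
  (#|J| + #|J| <= W)%N -> (L <= L')%N -> reach W L F G -> reach W L' F G.
Proof.
move=> JW /subnKC <- r; apply: (reach_comp r); exact: reach_id.
Qed.

Fixpoint dense_size (m n W L : nat) : nat :=
  if L is L'.+1 then (m * W + W + dense_size W n W L')%N else (m * n + n)%N.

Lemma nonzero_entries_le m n (M : 'M[R]_(m, n)) : (nonzero_entries M <= m * n)%N.
Proof.
by rewrite /nonzero_entries (leq_trans (max_card _))// card_prod !card_ord.
Qed.

Lemma affspan_mx X (I : finType) n (F : I -> X -> R) (G : 'I_n -> X -> R) :
  (forall j, affspan F (G j)) -> forall m (e : 'I_m -> I), bijective e ->
  exists (M : 'M[R]_(m, n)) (b : 'rV[R]_n), forall x,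
    (\row_j G j x) = (\row_i F (e i) x) *m M + b.
Proof.
move=> h m e be.
have /choice[c hc] : forall j, exists cb : (I -> R) * R,
    forall x, G j x = \sum_i cb.1 i * F i x + cb.2.
  by move=> j; have [c [b H]] := h j; exists (c, b).
exists (\matrix_(i, j) (c j).1 (e i)), (\row_j (c j).2) => x.
apply/rowP => j; rewrite !mxE hc; congr (_ + _).
rewrite (reindex e) /=; last exact: onW_bij.
by apply: eq_bigr => i _; rewrite !mxE mulrC.
Qed.

Lemma reach_net X W L m n (F : 'I_m -> X -> R) (G : 'I_n -> X -> R) :
  reach W L F G -> exists N : relu_net R m n,
    [/\ forall x, net_eval N (\row_i F i x) = \row_j G j x,
        net_depth N = L & (net_size N <= dense_size m n W L)%N].
Proof.
have bid k : bijective (id : 'I_k -> 'I_k) by exists id.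
elim: L m F => [|L IH] m F.
  move=> /= /affspan_mx/(_ _ id (bid m))[M [b h]].
  exists (Affine M b); split => //=.
    by rewrite leq_add// (leq_trans (nonzero_entries_le _))// mul1n.
move=> /= [K /affspan_mx/(_ _ id (bid m))[M [b h]] /IH[N [Ne Nd Ns]]].
exists (Hidden M b N); split => /=.
- move=> x; rewrite -h -Ne; congr net_eval.
  by apply/rowP => i; rewrite !mxE.
- by rewrite Nd.
- rewrite leq_add// leq_add// (leq_trans (nonzero_entries_le _))//.
  by rewrite mul1n.
Qed.

Lemma dense_sizeS m n W L :
  dense_size m n W L.+1 = (m * W + W + L * (W * W + W) + (W * n + n))%N.
Proof.
rewrite /=; suff -> : dense_size W n W L = (L * (W * W + W) + (W * n + n))%N.
  by rewrite addnA.
by elim: L => [|L IH] //=; rewrite IH mulSn addnA.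
Qed.

End Reach.

(** * Approximation of polynomials *)

Section Square.
Context (R : realType).
Implicit Types (x y z : R) (n w b L : nat).

(** The projection onto [0,1], made of two ReLU units. Being 1-Lipschitz, it brings inexact inputs
    back to where approximations are controlled without increasing their error. *)
Definition clip01 x : R := Num.max x 0 - Num.max (x - 1) 0.

Lemma clip01_le0 x : x <= 0 -> clip01 x = 0.
Proof. by move=> x0; rewrite /clip01 /Num.max; do 2 case: ifPn; rewrite -?leNgt; lra. Qed.

Lemma clip01_ge1 x : 1 <= x -> clip01 x = 1.
Proof. by move=> x0; rewrite /clip01 /Num.max; do 2 case: ifPn; rewrite -?leNgt; lra. Qed.

Lemma clip01_id x : 0 <= x <= 1 -> clip01 x = x.
Proof. by move=> x0; rewrite /clip01 /Num.max; do 2 case: ifPn; rewrite -?leNgt; lra. Qed.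

Lemma clip01_itv x : 0 <= clip01 x <= 1.
Proof. by rewrite /clip01 /Num.max; do 2 case: ifPn; rewrite -?leNgt; lra. Qed.

Lemma clip01_lip x y : `|clip01 x - clip01 y| <= `|x - y|.
Proof.
by rewrite /clip01 /Num.max ler_norml; do 4 case: ifPn; rewrite -?leNgt;
  case: (ger0P (x - y)); lra.
Qed.

Definition blk b z : R := clip01 (z - b%:R).

(** [blk b] is the local coordinate of block [b], at rest at 0 before it and at 1 after it. Blocks
    already passed give their full increment, the current one a partial increment, later ones
    nothing. *)
Lemma telescope_blk (f : R -> R) n z : 0 <= z <= n%:R ->
  f z - f 0 = \sum_(b < n) (f (b%:R + blk b z) - f b%:R).
Proof.
move=> /andP[z0 zn].
suff -> : \sum_(b < n) (f (b%:R + blk b z) - f b%:R) = f (Num.min z n%:R) - f 0.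
  by rewrite min_l.
elim: n {zn} => [|n IH]; first by rewrite big_ord0 min_r ?subrr.
rewrite big_ord_recr/= IH /blk -natr1.
have [zn|zn] := leP z n%:R.
  by rewrite min_l; [rewrite clip01_le0 ?addr0 ?subrr ?addr0//|]; lra.
have [zn1|zn1] := leP z (n%:R + 1).
  by rewrite clip01_id; [rewrite [n%:R + _]addrC subrK; ring|lra].
by rewrite clip01_ge1; [ring|lra].
Qed.

(* [g(x) = x - x^2] vanishes at 0 and 1; on each of [w] equal pieces it differs
   from its linear interpolant by a copy of [g] scaled by [w^-2], so it
   reproduces itself under the triangle wave with [w] teeth. *)
Let g x := x - x ^+ 2.

Definition tri w x : R := \sum_(b < w) (-1) ^+ b * blk b (w%:R * x).

Definition lin w x : R :=
  \sum_(b < w) (g (b.+1%:R / w%:R) - g (b%:R / w%:R)) * blk b (w%:R * x).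

Lemma tri_sum n z : 0 <= z ->
  let h := \sum_(b < n) (-1) ^+ b * blk b z in
  0 <= h <= 1 /\ \sum_(b < n) g (blk b z) = g h.
Proof.
move=> z0 h.
(* Invariant in [n]: either [z] lies beyond all [n] blocks, where the wave equals the parity of [n]
   and every [g] vanishes, or [z] lies within them and only its own block counts; falling teeth use
   [g (1 - y) = g y]. *)
suff : (n%:R <= z /\ h = (odd n)%:R /\ \sum_(b < n) g (blk b z) = 0) \/
    (z <= n%:R /\ 0 <= h <= 1 /\ \sum_(b < n) g (blk b z) = g h).
  move=> [[_ [-> ->]]|[_ //]].
  by rewrite /g; case: (odd n) => /=; split => //; ring || lra.
rewrite {}/h; elim: n => [|n IH].
  by left; rewrite !big_ord0.
rewrite !big_ord_recr/=.
have key : blk n z = if z <= n%:R then 0 else if z <= n.+1%:R then z - n%:R else 1.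
  rewrite /blk -natr1; case: ifPn => zn; first by rewrite clip01_le0//; lra.
  rewrite -ltNge in zn.
  case: ifPn => zn1; first by rewrite clip01_id//; lra.
  by rewrite -ltNge in zn1; rewrite clip01_ge1//; lra.
case: IH => -[zn [h1 h2]]; last first.
  right; split; first by rewrite -natr1; lra.
  by rewrite key zn mulr0 addr0; split => //; rewrite h2 /g; ring.
rewrite h1 h2 add0r; have [z1|z1] := leP z n.+1%:R; last first.
  left; split; first exact: ltW.
  rewrite key leNgt (lt_trans _ z1) ?ltr_nat//= leNgt z1/= mulr1 -signr_odd.
  by case: (odd n) => /=; rewrite /g ?expr0 ?expr1; split; ring.
right; split => //.
have bz : blk n z = z - n%:R.
  by rewrite key z1; case: ifPn => // zn'; lra.
have bz01 : 0 <= blk n z <= 1 by exact: clip01_itv.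
rewrite -signr_odd; case: (odd n) => /=; rewrite /g ?expr0 ?expr1; split.
- by lra.
- by ring.
- by lra.
- by ring.
Qed.

Lemma tri_itv w x : 0 <= x -> 0 <= tri w x <= 1.
Proof. by move=> x0; have [|] := @tri_sum w (w%:R * x) _; rewrite ?mulr_ge0. Qed.

Lemma square_selfsimilar w x : (0 < w)%N -> 0 <= x <= 1 ->
  g x = lin w x + w%:R ^- 2 * g (tri w x).
Proof.
move=> w0 x01; have wx : 0 <= w%:R * x by rewrite mulr_ge0 //; lra.
have w0' : w%:R != 0 :> R by rewrite pnatr_eq0 -lt0n.
have [_ <-] := tri_sum w wx.
have := @telescope_blk (fun z => g (z / w%:R)) w (w%:R * x).
rewrite mul0r mulrAC mulfV// mul1r {2}/g expr2 mulr0 !subr0 => ->; last first.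
  by rewrite wx/= ler_piMr//; lra.
rewrite /lin mulr_sumr -big_split/=; apply: eq_bigr => b _.
by rewrite /g -natr1; field.
Qed.

(** The self-similarity unrolled [L] times, with the last remainder dropped. Each level gains
    [w^-2]: the depth fixes the order and the width supplies the accuracy. *)
Fixpoint sqdef w L x : R :=
  if L is L'.+1 then lin w x + w%:R ^- 2 * sqdef w L' (tri w x) else 0.

Lemma sqdef_err w L x : (0 < w)%N -> 0 <= x <= 1 ->
  `|g x - sqdef w L x| <= w%:R ^- (2 * L).
Proof.
move=> w0; elim: L x => [|L IH] x x01 /=.
  rewrite muln0 expr0 invr1 subr0 /g ler_norml; nra.
rewrite (square_selfsimilar w0 x01) opprD addrACA subrr add0r -mulrBr normrM.
rewrite ger0_norm ?invr_ge0 ?exprn_ge0// mulnS exprD [leRHS]invfM.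
apply: ler_wpM2l; first by rewrite invr_ge0 exprn_ge0.
by apply: IH; apply: tri_itv; lra.
Qed.

Lemma reach_blk X (I : finType) (F : I -> X -> R) (y : X -> R) n W :
  affspan F y -> (n + n <= W)%N ->
  reach W 1 F (fun b : 'I_n => fun t => blk b (y t)).
Proof.
move=> Fy nW.
apply: (@reachS _ _ _ _ _ ('I_n + 'I_n)%type _ _ (fun i => match i with
   inl b => fun t => y t + - b%:R | inr b => fun t => y t + (- b%:R - 1) end)).
- by rewrite card_sum !card_ord.
- by move=> [b|b]; apply: (affspanD Fy); exact: affspan_cst.
- move=> b /=; apply: affspan_ext (affspanD (affspan_gen _ (inl b))
    (affspanZ (-1) (affspan_gen _ (inr b)))) _ => x /=.
  by rewrite /blk /clip01 mulN1r addrA.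
Qed.

(** For the induction on levels, [a] accumulates the partial sum and [k] is the scale of the current
    level. The width counts [2 * w] units for the blocks and 2 for passing [a] through a ReLU
    layer. *)
Lemma reach_sqdef X w L k (y a : X -> R) :
  reach (w + w + 2) L (fun b : bool => if b then y else a)
    (fun _ : unit => fun t => a t + k * sqdef w L (y t)).
Proof.
elim: L k y a => [|L IH] k y a.
  move=> _ /=; apply: affspan_ext (affspan_gen _ false) _ => x /=; ring.
have r1 : reach (w + w + 2) 1 (fun b : bool => if b then y else a)
    (fun j : 'I_w + unit => match j with inl b => fun t => blk b (w%:R * y t)
       | inr _ => a end).
  apply: reach_ext (reach_par (reach_blk (y := fun t => w%:R * y t) _ (leqnn _)) _) _.
  - exact: (affspanZ _ (affspan_gen _ true)).
  - apply: (@reach_affl _ _ _ _ _ _ _ (fun _ : unit => a)).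
      by move=> _; exact: (affspan_gen _ false).
    by apply: reach_id; rewrite card_unit.
  - by case.
apply: (reach_comp (L := 1) (L' := L) r1).
apply: reach_ext; first apply: reach_affl
  (IH (k * w%:R ^- 2) (fun t => tri w (y t)) (fun t => a t + k * lin w (y t))).
- case.
    apply: affspan_ext; first exact: (affspan_sum (fun b : 'I_w =>
      affspanZ ((-1) ^+ b) (affspan_gen _ (inl b)))).
    by move=> x.
  apply: affspanD; first exact: (affspan_gen _ (inr tt)).
  apply: affspanZ; apply: affspan_ext; first exact: (affspan_sum (fun b : 'I_w =>
      affspanZ (g (b.+1%:R / w%:R) - g (b%:R / w%:R)) (affspan_gen _ (inl b)))).
  by move=> x.
- by move=> _ x /=; ring.
Qed.

(** From [x^2 = x - g x], with [sqdef] in place of [g]; clipping makes the error bound valid for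
    arbitrary real inputs. *)
Definition sqapp w L x := clip01 x + -1 * sqdef w L (clip01 x).

Lemma reach_sqapp w L :
  reach (w + w + 2) L.+1 (fun _ : unit => id) (fun _ : unit => sqapp w L).
Proof.
have r1 : reach (w + w + 2) 1 (fun _ : unit => id) (fun _ : unit => clip01).
  apply: reach_affr (reach_blk (y := id) (n := 1) (affspan_gen _ tt) _) _.
    by rewrite leq_addl.
  by move=> _; apply: affspan_ext (affspan_gen _ ord0) _ => x; rewrite /blk subr0.
apply: (reach_comp (L := 1) r1).
apply: reach_affl (reach_sqdef w L (-1) clip01 clip01).
by case; exact: (affspan_gen _ tt).
Qed.

Lemma sqapp_err w L x y : (0 < w)%N -> 0 <= y <= 1 ->
  `|sqapp w L x - y ^+ 2| <= w%:R ^- (2 * L) + 2 * `|x - y|.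
Proof.
move=> w0 y01; have cx := clip01_itv x.
have := sqdef_err L w0 cx; rewrite /g /sqapp => h.
have := clip01_lip x y; rewrite (clip01_id y01) => h2.
set s := sqdef _ _ _ in h *; set c := clip01 x in cx h h2 *.
have -> : c + -1 * s - y ^+ 2 = (c - c ^+ 2 - s) + (c - y) * (c + y) by ring.
rewrite (le_trans (ler_normD _ _))// lerD// normrM mulrC.
by rewrite ler_pM// ger0_norm; lra.
Qed.

(** Every algebraic order in [w], at width [O(w)] and a depth independent of [w]. Depth and constant
    may grow with the order [K]. *)
Definition Napprox (f : R -> R) := forall K : nat, exists L C : nat,
  forall w, (0 < w)%N -> exists2 h : R -> R,
    reach (C * w) L (fun _ : unit => id) (fun _ : unit => h) &
    forall x, 0 <= x <= 1 -> `|h x - f x| <= C%:R * w%:R ^- K.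

Lemma Napprox_affine a c : Napprox (fun x => a * x + c).
Proof.
move=> K; exists 0, 0 => w w0; exists (fun x => a * x + c).
  move=> _; apply: affspanD; last exact: affspan_cst.
  exact/affspanZ/(affspan_gen _ tt).
by move=> x x01; rewrite subrr normr0 mul0r.
Qed.

Lemma Napprox_ext f h : Napprox f -> (forall x, 0 <= x <= 1 -> f x = h x) -> Napprox h.
Proof.
move=> hf fh K; have [L [C H]] := hf K; exists L, C => w w0.
have [q rq eq] := H w w0; exists q => // x x01; rewrite -fh//; exact: eq.
Qed.

Lemma Napprox_lin a c f h : Napprox f -> Napprox h ->
  Napprox (fun x => a * f x + c * h x).
Proof.
move=> hf hh K; have [L1 [C1 H1]] := hf K; have [L2 [C2 H2]] := hh K.
have [M aM cM] : exists2 M : nat, `|a| <= M%:R & `|c| <= M%:R.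
  exists (Num.truncn (`|a| + `|c|)).+1; rewrite (le_trans _ (ltW (truncnS_gt _)))//.
    by rewrite lerDl.
  by rewrite lerDr.
exists (maxn L1 L2), ((C1 + 2) + (C2 + 2) + M * C1 + M * C2)%N => w w0.
have [q1 r1 e1] := H1 w w0; have [q2 r2 e2] := H2 w w0.
exists (fun x => a * q1 x + c * q2 x).
  have p1 : reach ((C1 + 2) * w) (maxn L1 L2) (fun _ : unit => id) (fun _ : unit => q1).
    apply: (reach_pad (L := L1)); rewrite ?card_unit ?leq_maxl//; first by rewrite mulnDl; lia.
    apply: reach_mono r1; rewrite mulnDl; lia.
  have p2 : reach ((C2 + 2) * w) (maxn L1 L2) (fun _ : unit => id) (fun _ : unit => q2).
    apply: (reach_pad (L := L2)); rewrite ?card_unit ?leq_maxr//; first by rewrite mulnDl; lia.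
    apply: reach_mono r2; rewrite mulnDl; lia.
  have := reach_par p1 p2; move/(@reach_affr _ _ _ _ _ _ unit).
  move/(_ (fun _ x => a * q1 x + c * q2 x)) => h'.
  apply: reach_mono (h' _); first by rewrite mulnDl; lia.
  by move=> _; apply: affspanD; apply: affspanZ;
    [exact: (affspan_gen _ (inl tt))|exact: (affspan_gen _ (inr tt))].
move=> x x01; have {}e1 := e1 x x01; have {}e2 := e2 x x01.
have -> : a * q1 x + c * q2 x - (a * f x + c * h x) =
  a * (q1 x - f x) + c * (q2 x - h x) by ring.
rewrite (le_trans (ler_normD _ _))// !normrM !natrD !natrM.
have v0 : 0 <= w%:R ^- K :> R by rewrite invr_ge0 exprn_ge0.
have u1 := ler_pM (normr_ge0 _) (normr_ge0 _) aM e1.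
have u2 := ler_pM (normr_ge0 _) (normr_ge0 _) cM e2.
apply: (le_trans (lerD u1 u2)).
rewrite !mulrA -mulrDl; apply: ler_wpM2r => //.
have := ler0n R C1; have := ler0n R C2; lra.
Qed.

Lemma Napprox_sq f : Napprox f -> (forall x, 0 <= x <= 1 -> 0 <= f x <= 1) ->
  Napprox (fun x => f x ^+ 2).
Proof.
move=> hf f01 K; have [L [C H]] := hf K.
exists (L + K.+1)%N, (C + C + 4)%N => w w0; have [q rq eq] := H w w0.
exists (fun x => sqapp w K (q x)).
  apply: (reach_comp (G := fun _ : unit => q)).
    apply: reach_mono rq; nia.
  apply: reach_mono (reach_pre q (reach_sqapp w K)); nia.
move=> x x01; rewrite (le_trans (sqapp_err K (q x) w0 (f01 x x01)))//.
have := eq x x01 => e1.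
have w1 : w%:R ^- (2 * K) <= w%:R ^- K :> R.
  rewrite lef_pV2 ?posrE ?exprn_gt0 ?ltr0n//.
  by apply: ler_weXn2l; [rewrite ler1n|lia].
have v0 : 0 <= w%:R ^- K :> R by rewrite invr_ge0 exprn_ge0.
by rewrite !natrD !mulrDl; lra.
Qed.

(** Polarisation, written with the mean of [f] and [h] so that the squared function stays in
    [0,1]. *)
Lemma Napprox_mul f h : Napprox f -> Napprox h ->
  (forall x, 0 <= x <= 1 -> 0 <= f x <= 1) ->
  (forall x, 0 <= x <= 1 -> 0 <= h x <= 1) -> Napprox (fun x => f x * h x).
Proof.
move=> hf hh f01 h01.
have s1 := Napprox_sq hf f01; have s2 := Napprox_sq hh h01.
have s3 : Napprox (fun x => (2^-1 * f x + 2^-1 * h x) ^+ 2).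
  apply: Napprox_sq; first exact: Napprox_lin.
  by move=> x x01; have := f01 x x01; have := h01 x x01; lra.
apply: Napprox_ext (Napprox_lin 2 1 s3
  (Napprox_lin (- 2^-1) (- 2^-1) s1 s2)) _ => x _.
by field.
Qed.

Lemma Napprox_poly (p : {poly R}) : Napprox (horner p).
Proof.
have hX k : Napprox (fun x => x ^+ k).
  elim: k => [|k IH].
    by apply: Napprox_ext (Napprox_affine 0 1) _ => x _; rewrite mul0r add0r expr0.
  have hid : Napprox id.
    by apply: Napprox_ext (Napprox_affine 1 0) _ => x _; rewrite mul1r addr0.
  apply: Napprox_ext (Napprox_mul hid IH _ _) _ => //.
    by move=> x /andP[x0 x1]; rewrite exprn_ge0//= exprn_ile1.
  by move=> x _; rewrite exprS.
suff : forall k, Napprox (fun x => \sum_(i < k) p`_i * x ^+ i).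
  by move=> /(_ (size p)) /Napprox_ext; apply => x _; rewrite horner_coef.
elim=> [|k IH].
  by apply: Napprox_ext (Napprox_affine 0 0) _ => x _; rewrite big_ord0 mul0r addr0.
apply: Napprox_ext (Napprox_lin 1 p`_k IH (hX k)) _ => x _.
by rewrite big_ord_recr/= mul1r.
Qed.

End Square.

(** * Smooth families and Taylor expansions *)

Section Smooth.
Context (R : realType).
Implicit Types (T a b t M : R).

Lemma increment_bound (h dh : R -> R) a b M : a <= b ->
  {within `[a, b], continuous h} ->
  (forall x, a < x < b -> is_derive x 1 h (dh x)) ->
  (forall x, a < x < b -> `|dh x| <= M) -> `|h b - h a| <= M * (b - a).
Proof.
move=> ab ch dhE hM; have [->|nab] := eqVneq a b; first by rewrite !subrr normr0 mulr0.
have {nab}ab : a < b by rewrite lt_neqAle nab.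
have d x : x \in `]a, b[ -> is_derive x 1 h (dh x) by rewrite in_itv/=; exact: dhE.
have [c + ->] := MVT ab d ch.
rewrite in_itv/= => /hM hc; rewrite normrM (gtr0_norm (_ : 0 < b - a)) ?subr_gt0//.
by apply: ler_wpM2r => //; rewrite subr_ge0 ltW.
Qed.

(** The coefficient at [i = 0] is a division by zero, hence 0: this is the antiderivative vanishing
    at the origin. *)
Definition antideriv (p : {poly R}) : {poly R} :=
  \poly_(i < (size p).+1) (p`_i.-1 / i%:R).

Lemma antideriv_coef p i : (antideriv p)`_i = p`_i.-1 / i%:R.
Proof.
rewrite coef_poly; case: ifPn => //; rewrite -leqNgt; case: i => [//|i].
by rewrite ltnS => sp; rewrite nth_default// mul0r.
Qed.

Lemma size_antideriv p : (size (antideriv p) <= (size p).+1)%N.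
Proof. exact: size_poly. Qed.

Lemma antideriv0 p : (antideriv p).[0] = 0.
Proof. by rewrite horner_coef0 antideriv_coef invr0 mulr0. Qed.

Lemma antiderivK p : (antideriv p)^`() = p.
Proof.
apply/polyP => i; rewrite coef_deriv antideriv_coef /= -[LHS]mulr_natr divfK//.
Qed.

Lemma derivK p : antideriv p^`() = p - (p.[0])%:P.
Proof.
apply/polyP => -[|i]; rewrite antideriv_coef !coefE.
  by rewrite invr0 mulr0 horner_coef0 subrr.
by rewrite /= -[_ *+ _]mulr_natr mulfK ?pnatr_eq0// subr0.
Qed.

(** The [A l] integrate the Lagrange basis polynomials from 0: [p'] has degree below [Q], so it
    equals its interpolant at the [Q] nodes. *)
Lemma quadrature_exists (Q : nat) (x : nat -> R) : (0 < Q)%N -> injective x ->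
  exists A : 'I_Q -> {poly R}, (forall l, (A l).[0] = 0) /\
    forall p : {poly R}, (size p <= Q.+1)%N -> forall z,
      p.[z] - p.[0] = \sum_(l < Q) p^`().[x l] * (A l).[z].
Proof.
move=> Q0 xinj.
exists (fun l => antideriv (tnth (qpoly.lagrange Q x) l)); split.
  by move=> l; exact: antideriv0.
move=> p sp z; have sd : (size p^`() <= Q)%N.
  by have [->|p0] := eqVneq p 0; rewrite ?deriv0 ?size_poly0// -ltnS (leq_trans (lt_size_deriv p0)).
have -> : p.[z] - p.[0] = (antideriv p^`()).[z] by rewrite derivK !hornerE.
rewrite {1}(qpoly.lagrange_gen Q0 xinj sd).
have aD : forall p q, antideriv (p + q) = antideriv p + antideriv q.
  by move=> u v; apply/polyP => i; rewrite !(coefE, antideriv_coef) mulrDl.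
have a0 : antideriv 0 = 0.
  by apply/polyP => i; rewrite antideriv_coef coef0 mul0r coef0.
rewrite (big_morph antideriv aD a0) horner_sum; apply: eq_bigr => l _.
have -> : forall (c : R) q, antideriv (c%:P * q) = c *: antideriv q.
  move=> c q; apply/polyP => i.
  by rewrite coefZ !antideriv_coef coefCM mulrA.
by rewrite hornerZ.
Qed.

(** All bounds are uniform in the index, which will be the realisation. Derivatives are asked for on
    the open interval only, where the pendulum equations hold pointwise. *)
Fixpoint smooth (T : R) (I : Type) (n : nat) (f : I -> R -> R) : Prop :=
  (exists C, forall i t, 0 < t < T -> `|f i t| <= C) /\
  match n with
  | 0 => True
  | n'.+1 => exists2 f' : I -> R -> R,
      (forall i t, 0 < t < T -> is_derive t 1 (f i) (f' i t)) & smooth T n' f'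
  end.

Lemma smooth_bounded T I n (f : I -> R -> R) : smooth T n f ->
  exists C, forall i t, 0 < t < T -> `|f i t| <= C.
Proof. by case: n => [|n] []. Qed.

Lemma smoothW T I n (f : I -> R -> R) : smooth T n.+1 f -> smooth T n f.
Proof.
elim: n f => [|n IH] f; first by move=> [? _].
move=> [b [f' df' sf']]; split => //; exists f' => //; exact: IH.
Qed.

Lemma smoothD T I n (f g : I -> R -> R) : smooth T n f -> smooth T n g ->
  smooth T n (fun i t => f i t + g i t).
Proof.
elim: n f g => [|n IH] f g [[C hC] hf] [[D hD] hg].
  split => //; exists (C + D) => i t tT.
  by rewrite (le_trans (ler_normD _ _))// lerD ?hC ?hD.
split; first exists (C + D) => i t tT.
  by rewrite (le_trans (ler_normD _ _))// lerD ?hC ?hD.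
case: hf hg => [f' df sf] [g' dg sg]; exists (fun i t => f' i t + g' i t).
  by move=> i t tT; have := df i t tT; have := dg i t tT => ? ?; exact: is_deriveD.
exact: IH.
Qed.

Lemma smoothM T I n (f g : I -> R -> R) : smooth T n f -> smooth T n g ->
  smooth T n (fun i t => f i t * g i t).
Proof.
have bM (f1 f2 : I -> R -> R) : (exists C, forall i t, 0 < t < T -> `|f1 i t| <= C) ->
    (exists C, forall i t, 0 < t < T -> `|f2 i t| <= C) ->
    exists C, forall i t, 0 < t < T -> `|f1 i t * f2 i t| <= C.
  move=> [C hC] [D hD]; exists (C * D) => i t tT.
  by rewrite normrM ler_pM ?hC ?hD.
elim: n f g => [|n IH] f g hf hg.
  by split => //; apply: bM; [have [] := hf|have [] := hg].
split; first by apply: bM; [have [] := hf|have [] := hg].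
have [_ [f' df sf]] := hf; have [_ [g' dg sg]] := hg.
exists (fun i t => f i t * g' i t + g i t * f' i t).
  by move=> i t tT; have := df i t tT; have := dg i t tT => ? ?; exact: is_deriveM.
by apply: smoothD; apply: IH => //; exact: smoothW.
Qed.

Lemma smooth_cst T I n (c : R) : smooth T n (fun (_ : I) => fun=> c).
Proof.
elim: n c => [|n IH] c; first by split => //; exists `|c|.
split; first by exists `|c|.
exists (fun=> fun=> 0) => // i t _; exact: is_derive_cst.
Qed.

(** Proved together because each function occurs in the derivative of the other. *)
Lemma smooth_sincos T I n (f : I -> R -> R) : smooth T n f ->
  smooth T n (fun i t => sin (f i t)) /\ smooth T n (fun i t => cos (f i t)).
Proof.
have bs (h : R -> R) : (forall x, -1 <= h x <= 1) ->
    exists C, forall (i : I) t, 0 < t < T -> `|h (f i t)| <= C.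
  by move=> h1; exists 1 => i t _; rewrite ler_norml.
have hs : forall x : R, -1 <= sin x <= 1 by move=> x; rewrite sin_geN1 sin_le1.
have hc : forall x : R, -1 <= cos x <= 1 by move=> x; rewrite cos_geN1 cos_le1.
elim: n => [|n IH] hf; first by split; split => //; exact: bs.
have [s c] := IH (smoothW hf); have [_ [f' df sf]] := hf.
split; (split; first exact: bs).
  exists (fun i t => f' i t * cos (f i t)); last exact: smoothM.
  move=> i t tT; have dfi := df i t tT.
  by have := @is_derive1_comp _ sin (f i) t _ _ (is_derive_sin _) dfi; rewrite mulrC.
exists (fun i t => f' i t * (-1 * sin (f i t))); last first.
  by apply: smoothM => //; apply: smoothM => //; exact: smooth_cst.
move=> i t tT; have dfi := df i t tT.
by have := @is_derive1_comp _ cos (f i) t _ _ (is_derive_cos _) dfi; rewrite mulN1r mulrC.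
Qed.

(** Integrating the expansion of [f'] gains one order, by the mean value inequality for the
    difference. The endpoints of [0,T] are allowed for [t], as continuity of [f] suffices there. *)
Lemma taylor_step (f f' : R -> R) (p : {poly R}) T t0 (C : R) n : 0 < t0 < T ->
  (forall t, 0 < t < T -> is_derive t 1 f (f' t)) ->
  (forall t, 0 < t < T -> `|f' t - p.[t - t0]| <= C * `|t - t0| ^+ n) ->
  0 <= C ->
  let P := (f t0)%:P + antideriv p in forall t, 0 <= t <= T ->
  {within `[Num.min t t0, Num.max t t0], continuous f} ->
  `|f t - P.[t - t0]| <= C * `|t - t0| ^+ n.+1.
Proof.
move=> t0T df fp C0 P t tT cf.
pose h s := f s - P.[s - t0].
have h0 : h t0 = 0 by rewrite /h subrr /P !hornerE antideriv0 addr0 subrr.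
pose dh s := f' s - p.[s - t0].
have dP (s : R) : is_derive s (1 : R) (fun s => P.[s - t0]) (p.[s - t0]).
  have e : P^`() = p by rewrite /P derivD derivC add0r antiderivK.
  have := is_derive_poly P (s - t0); rewrite e => d1.
  have d2 : is_derive s (1 : R) (fun s => s - t0) 1.
    have := is_deriveB (is_derive_id s (1 : R)) (is_derive_cst t0 s (1 : R)).
    by rewrite subr0.
  by have := @is_derive1_comp _ (horner P) (fun s => s - t0) s _ _ d1 d2; rewrite mulr1.
have dhE (s : R) : 0 < s < T -> is_derive s 1 h (dh s).
  by move=> sT; have := df s sT; have := dP s => ? ?; exact: is_deriveB.
have ch A : {within A, continuous f} -> {within A, continuous h}.
  move=> cA x; apply: (@continuousB _ _ (subspace A) f (fun s => P.[s - t0])); first exact: cA.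
  apply: continuous_subspaceT => y; apply: differentiable_continuous.
  by apply/derivable1_diffP; have [] := dP y.
suff : `|h t - h t0| <= C * `|t - t0| ^+ n * `|t - t0|.
  by rewrite h0 subr0 exprSr mulrA.
have [tt0|tt0] := leP t t0.
  rewrite distrC -(distrC t0 t) (ger0_norm (_ : 0 <= t0 - t)) ?subr_ge0//.
  apply: (@increment_bound h dh) => //.
  - by apply: ch; move: cf; rewrite min_l// max_r.
  - by move=> x xt; apply: dhE; lra.
  - move=> x xt; have xT : 0 < x < T by lra.
    apply: (le_trans (fp x xT)); apply: ler_wpM2l => //.
    apply: lerXn2r; rewrite ?nnegrE ?subr_ge0//.
    by rewrite ler_norml; lra.
rewrite (ger0_norm (_ : 0 <= t - t0)) ?subr_ge0; last exact: ltW.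
apply: (@increment_bound h dh) => //; first exact: ltW.
- by apply: ch; move: cf; rewrite min_r ?max_l// ltW.
- by move=> x xt; apply: dhE; lra.
- move=> x xt; have xT : 0 < x < T by lra.
  apply: (le_trans (fp x xT)); apply: ler_wpM2l => //.
  apply: lerXn2r; rewrite ?nnegrE ?subr_ge0// ?(ltW tt0)//.
  by rewrite ler_norml; lra.
Qed.

Lemma smooth_taylor T I n (f : I -> R -> R) : smooth T n f ->
  exists2 C, 0 <= C & forall i t0, 0 < t0 < T -> exists2 p : {poly R},
    (size p <= n)%N &
    forall t, 0 < t < T -> `|f i t - p.[t - t0]| <= C * `|t - t0| ^+ n.
Proof.
elim: n f => [|n IH] f.
  move=> [[C hC] _]; exists `|C| => // i t0 _; exists 0; first by rewrite size_poly0.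
  by move=> t tT; rewrite horner0 subr0 expr0 mulr1 (le_trans (hC i t tT))// ler_norm.
move=> [_ [f' df sf]]; have [C C0 hC] := IH _ sf; exists C => // i t0 t0T.
have [p sp hp] := hC i t0 t0T; exists ((f i t0)%:P + antideriv p).
  rewrite (leq_trans (size_polyD _ _))// geq_max (leq_trans (size_polyC_leq1 _))//=.
  by rewrite (leq_trans (size_antideriv p)).
move=> t tT; apply: (taylor_step t0T (df i)) => //; first by lra.
apply: derivable_within_continuous => x; rewrite in_itv/= => xt.
have xT : 0 < x < T; last by have := df i x xT => dx; exact: ex_derive.
by move: xt; case: (leP t t0) => ?; lra.
Qed.

End Smooth.

(** * Blockwise quadrature *)

Section Blocks.
Context (R : realType).
Implicit Types (n Q : nat) (H T C : R).

(** Equally spaced strictly inside the unit interval, so that every node of every block lies in the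
    open interval where the differential equations hold. *)
Definition qnode (Q l : nat) : R := l.+1%:R / Q.+1%:R.

Lemma qnode_itv Q l : (l < Q)%N -> 0 < qnode Q l < 1.
Proof.
move=> lQ; rewrite /qnode divr_gt0 ?ltr0n//= ltr_pdivrMr ?ltr0n// mul1r ltr_nat.
by rewrite ltnS.
Qed.

Lemma qnode_inj Q : injective (qnode Q).
Proof.
move=> i j /(congr1 (fun x => x * Q.+1%:R)); rewrite /qnode !divfK ?pnatr_eq0//.
by move/eqP; rewrite eqr_nat => /eqP [].
Qed.

(* Quadrature for the integral up to time [z * H], with blocks of length [H]. *)
Definition blkint n Q H (A : 'I_Q -> R -> R) (g : 'I_n -> 'I_Q -> R) (z : R) : R :=
  \sum_(b < n) \sum_(l < Q) H * g b l * A l (blk b z).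

Lemma poly_bounded Q (A : 'I_Q -> {poly R}) :
  exists2 C, 0 <= C & forall l x, 0 <= x <= 1 -> `|(A l).[x]| <= C.
Proof.
exists (\sum_l \sum_(i < size (A l)) `|(A l)`_i|).
  by apply: sumr_ge0 => l _; apply: sumr_ge0.
move=> l x /andP[x0 x1]; rewrite (bigD1 l)//=.
rewrite ler_wpDr ?sumr_ge0// => [j _|]; first by apply: sumr_ge0.
rewrite horner_coef (le_trans (ler_norm_sum _ _ _))// ler_sum// => i _.
by rewrite normrM ler_piMr// normrX exprn_ile1// ger0_norm.
Qed.

Definition exact_quad Q (A : 'I_Q -> {poly R}) :=
  (forall l, (A l).[0] = 0) /\
    forall p : {poly R}, (size p <= Q.+1)%N -> forall z,
      p.[z] - p.[0] = \sum_(l < Q) p^`().[qnode Q l] * (A l).[z].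

(** The rule is exact for the Taylor polynomial on each block, which leaves an error [O(H^(Q+1))]
    per block and [O(n^-Q)] over the [n = T / H] blocks. *)
Lemma blkint_consistent T (I : Type) Q (A : 'I_Q -> {poly R}) (V V' : I -> R -> R) :
  0 < T -> exact_quad A ->
  (forall i, {within `[0, T], continuous (V i)}) -> (forall i, V i 0 = 0) ->
  (forall i t, 0 < t < T -> is_derive t 1 (V i) (V' i t)) -> smooth T Q V' ->
  exists2 C, 0 <= C & forall n, (0 < n)%N -> forall i t, 0 <= t <= T ->
    `|V i t - blkint (T / n%:R) (fun l => horner (A l))
        (fun (b : 'I_n) l => V' i ((b%:R + qnode Q l) * (T / n%:R))) (t / (T / n%:R))|
    <= C * (n%:R^-1) ^+ Q.
Proof.
move=> T0 [A0 Aex] cV V0 dV sV'.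
have [C C0 hC] := smooth_taylor sV'.
have [CA CA0 hCA] := poly_bounded A.
(* Per block: 2 for the Taylor errors of [V] at the two ends of the increment, [Q * CA] for those of
   [V'] at the nodes. *)
exists (C * (2 + Q%:R * CA) * T ^+ Q.+1).
  by rewrite !mulr_ge0// ?addr_ge0// ?mulr_ge0// exprn_ge0// ltW.
move=> n n0 i t tT; set H := T / n%:R.
have nR : 0 < n%:R :> R by rewrite ltr0n.
have H0 : 0 < H by rewrite divr_gt0.
have HT : n%:R * H = T by rewrite /H mulrC divfK// gt_eqF.
have HE : H = T / n%:R by [].
clearbody H; have -> : V i t = V i (t / H * H) - V i (0 * H).
  by rewrite mul0r V0 subr0 divfK// gt_eqF.
rewrite (@telescope_blk _ (fun z => V i (z * H)) n); last first.
  by rewrite divr_ge0 ?(ltW H0)//=; [rewrite ler_pdivrMr// HT|]; lra.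
rewrite /blkint -sumrB (le_trans (ler_norm_sum _ _ _))//.
have -> : C * (2 + Q%:R * CA) * T ^+ Q.+1 * n%:R^-1 ^+ Q =
    \sum_(b < n) C * (2 + Q%:R * CA) * H ^+ Q.+1.
  rewrite sumr_const card_ord -[RHS]mulr_natr -!mulrA; congr (_ * (_ * _)).
  rewrite HE exprMn -mulrA; congr (_ * _); rewrite [n%:R^-1 ^+ Q.+1]exprSr mulfVK//.
  by rewrite gt_eqF.
apply: ler_sum => b _; set y := blk b (t / H).
have y01 : 0 <= y <= 1 by exact: clip01_itv.
have bn : b%:R + 1 <= n%:R :> R by rewrite natr1 ler_nat.
have b0 : 0 <= b%:R :> R by [].
(* Expanding at the middle keeps [t0] inside the open interval and all points of the block within
   distance [H]. *)
pose t0 := (b%:R + 2^-1) * H.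
have inT z : 0 <= z <= 1 -> 0 <= (b%:R + z) * H <= T.
  move=> z01; rewrite mulr_ge0 ?(ltW H0)//=; last by lra.
  by rewrite -HT ler_pM2r//; lra.
have inT' z : 0 < z < 1 -> 0 < (b%:R + z) * H < T.
  move=> z01; rewrite mulr_gt0//=; last by lra.
  by rewrite -HT ltr_pM2r//; lra.
have t0T : 0 < t0 < T by apply: inT'; lra.
have [p sp hp] := hC i t0 t0T.
pose P := (V i t0)%:P + antideriv p.
have hP : forall t, 0 <= t <= T -> `|V i t - P.[t - t0]| <= C * `|t - t0| ^+ Q.+1.
  move=> s sT; apply: (taylor_step t0T (dV i) hp C0 sT).
  apply: continuous_subspaceW (cV i) => x /=; rewrite !in_itv/=.
  by case: (leP s t0) => ?; lra.
have PD : P^`() = p by rewrite /P derivD derivC add0r antiderivK.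
have s1 : (size P <= Q.+1)%N.
  rewrite (leq_trans (size_polyD _ _))// geq_max (leq_trans (size_polyC_leq1 _))//=.
  by rewrite (leq_trans (size_antideriv p)).
clearbody P.
have e z : (b%:R + z) * H - t0 = H * z + (b%:R * H - t0) by ring.
have near z : 0 <= z <= 1 -> `|(b%:R + z) * H - t0| <= H.
  move=> z01; rewrite /t0 -mulrBl normrM (gtr0_norm H0) ler_piMl ?(ltW H0)//.
  by rewrite ler_norml; lra.
have nearX z k : 0 <= z <= 1 -> `|(b%:R + z) * H - t0| ^+ k <= H ^+ k.
  by move=> z01; apply: lerXn2r; rewrite ?nnegrE ?(ltW H0)//; exact: near.
(* The Taylor polynomial in the local coordinate of the block, where the quadrature is exact; the
   chain rule yields the factor [H] of [blkint]. *)
pose q := P \Po (H *: 'X + (b%:R * H - t0)%:P).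
have hq z : q.[z] = P.[(b%:R + z) * H - t0] by rewrite e horner_comp hornerD hornerZ hornerX hornerC.
have hq' z : q^`().[z] = H * p.[(b%:R + z) * H - t0].
  rewrite deriv_comp PD derivD derivZ derivX derivC addr0 hornerM horner_comp.
  by rewrite hornerD !hornerZ hornerX !hornerC mulr1 mulrC e.
have sq : (size q <= Q.+1)%N.
  rewrite (leq_trans (size_comp_poly_leq _ _))// ltnS.
  have s2 : (size (H *: 'X + (b%:R * H - t0)%:P)%R <= 2)%N.
    rewrite (leq_trans (size_polyD _ _))// geq_max (leq_trans (size_scale_leq _ _))/= ?size_polyX//.
    by rewrite (leq_trans (size_polyC_leq1 _)).
  rewrite (@leq_trans ((size P).-1 * 1))//; last by rewrite muln1; case: (size P) s1.
  by rewrite leq_mul2l; apply/orP; right; case: (size _) s2 => [|[|[|]]].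
have := Aex q sq y.
set S1 := \sum_(l < Q) _ => hS1; set S2 := \sum_(l < Q) _.
have i0 : (0 : R) <= (0 : R) <= (1 : R) by rewrite lexx ler01.
have hy := hP _ (inT y y01); have h0 := hP _ (inT 0 i0).
rewrite -hq in hy; rewrite -hq addr0 in h0.
have -> : V i ((b%:R + y) * H) - V i (b%:R * H) - S2 =
    (V i ((b%:R + y) * H) - q.[y]) - (V i (b%:R * H) - q.[0]) + (S1 - S2).
  by rewrite -hS1; ring.
have S12 : `|S1 - S2| <= Q%:R * CA * (C * H ^+ Q.+1).
  rewrite /S1 /S2 -sumrB (le_trans (ler_norm_sum _ _ _))//.
  have -> : Q%:R * CA * (C * H ^+ Q.+1) = \sum_(l < Q) (C * H ^+ Q.+1) * CA.
    by rewrite sumr_const card_ord -[RHS]mulr_natr; ring.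
  apply: ler_sum => l _; rewrite hq' -mulrBl normrM ler_pM//; last exact: hCA.
  have /andP[x0 x1] := qnode_itv (ltn_ord l).
  rewrite -mulrBr normrM (gtr0_norm H0) distrC exprS mulrCA; apply: ler_wpM2l; first exact: ltW.
  apply: le_trans (hp _ (inT' _ _)) _; first by rewrite x0.
  by apply: ler_wpM2l => //; apply: nearX; rewrite !ltW.
have Hy := le_trans hy (ler_wpM2l C0 (nearX y Q.+1 y01)).
have := nearX 0 Q.+1 i0; rewrite addr0 => nX0.
have H1 := le_trans h0 (ler_wpM2l C0 nX0).
rewrite (le_trans (ler_normD _ _))//.
rewrite (le_trans (lerD (le_trans (ler_normB _ _) (lerD Hy H1)) S12))//.
by rewrite le_eqVlt; apply/orP; left; apply/eqP; ring.
Qed.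

(** [H] times the geometric sum of the weights up to block [k] is [(rho^(k+1) - 1) / lam], at most
    [2 * rho^k / lam] because [rho <= 2]; later blocks vanish with [A l 0]. The factor [1 / lam],
    uniform in [n], is the source of the contraction. *)
Lemma blkint_stable n Q H CA (A : 'I_Q -> R -> R) (g : 'I_n -> 'I_Q -> R)
    (lam M z : R) (k : nat) :
  0 < H -> 0 < lam -> lam * H <= 1 -> 0 <= M -> 0 <= CA ->
  (forall l, A l 0 = 0) -> (forall l x, 0 <= x <= 1 -> `|A l x| <= CA) ->
  (forall b l, `|g b l| <= M * (1 + lam * H) ^+ b) ->
  z <= k.+1%:R -> (k < n)%N ->
  `|blkint H A g z| <= 2 * Q%:R * CA / lam * (M * (1 + lam * H) ^+ k).
Proof.
move=> H0 l0 lH M0 CA0 A0 hA hg zk kn; set rho := 1 + lam * H in hg *.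
have rho1 : 0 <= rho by rewrite addr_ge0// mulr_ge0// ltW.
rewrite /blkint (le_trans (ler_norm_sum _ _ _))//.
apply: (@le_trans _ _ (\sum_(b < n | (b < k.+1)%N) Q%:R * CA * M * (H * rho ^+ b))).
  rewrite [leRHS]big_mkcond/=; apply: ler_sum => b _; case: ifPn => bk; last first.
    rewrite -leqNgt in bk; rewrite big1 ?normr0// => l _.
    rewrite /blk clip01_le0 ?A0 ?mulr0//.
    by rewrite subr_le0 (le_trans zk)// ler_nat.
  rewrite (le_trans (ler_norm_sum _ _ _))//.
  have -> : Q%:R * CA * M * (H * rho ^+ b) = \sum_(l < Q) H * (M * rho ^+ b) * CA.
    by rewrite sumr_const card_ord -[RHS]mulr_natr; ring.
  apply: ler_sum => l _; rewrite normrM normrM (gtr0_norm H0).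
  by rewrite ler_pM ?mulr_ge0 ?(ltW H0)// ?ler_wpM2l ?(ltW H0)// ?hA// clip01_itv.
rewrite -mulr_sumr -mulr_sumr -(big_ord_widen n (fun i => rho ^+ i))//.
have -> : H * \sum_(i < k.+1) rho ^+ i = (rho ^+ k.+1 - 1) / lam.
  have -> : rho ^+ k.+1 - 1 = lam * (H * \sum_(i < k.+1) rho ^+ i).
    by rewrite subrX1 mulrA; congr (_ * _); rewrite /rho; ring.
  by rewrite mulrAC divff ?mul1r// gt_eqF.
have rk : 0 <= rho ^+ k by rewrite exprn_ge0.
have r2 : rho ^+ k.+1 - 1 <= 2 * rho ^+ k.
  rewrite exprS; have : rho * rho ^+ k <= 2 * rho ^+ k by rewrite ler_wpM2r// /rho; lra.
  lra.
have -> : 2 * Q%:R * CA / lam * (M * rho ^+ k) = Q%:R * CA * M * (2 * rho ^+ k / lam).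
  by ring.
by rewrite ler_wpM2l ?mulr_ge0// ler_wpM2r// invr_ge0 ltW.
Qed.

Lemma blkint_perturb n Q H eps M (A B : 'I_Q -> R -> R) (g : 'I_n -> 'I_Q -> R) z :
  0 <= H -> (forall l x, 0 <= x <= 1 -> `|A l x - B l x| <= eps) ->
  (forall b l, `|g b l| <= M) ->
  `|blkint H A g z - blkint H B g z| <= n%:R * H * (Q%:R * M) * eps.
Proof.
move=> H0 hA hg; rewrite /blkint -sumrB (le_trans (ler_norm_sum _ _ _))//.
have -> : n%:R * H * (Q%:R * M) * eps = \sum_(b < n) \sum_(l < Q) H * M * eps.
  by rewrite !sumr_const !card_ord -[RHS]mulr_natr -mulr_natr; ring.
apply: ler_sum => b _; rewrite -sumrB (le_trans (ler_norm_sum _ _ _))//.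
apply: ler_sum => l _; rewrite -mulrBr normrM ler_pM//.
  by rewrite normrM ger0_norm// ler_wpM2l.
by apply: hA; exact: clip01_itv.
Qed.

End Blocks.

(** * Networks for the quadrature functions and for the sine *)

Section BlockNets.
Context (R : realType).
Implicit Types (n Q K w : nat).

Lemma Napprox_family Q (A : 'I_Q -> {poly R}) K : exists L C : nat,
  forall w, (0 < w)%N -> exists2 At : 'I_Q -> R -> R,
    reach (C * w) L (fun _ : unit => id) At &
    forall l x, 0 <= x <= 1 -> `|At l x - (A l).[x]| <= C%:R * w%:R ^- K.
Proof.
have /choice[LC hLC] : forall l, exists LC : nat * nat, forall w, (0 < w)%N ->
    exists2 h : R -> R, reach (LC.2 * w) LC.1 (fun _ : unit => id) (fun _ : unit => h) &
    forall x, 0 <= x <= 1 -> `|h x - (A l).[x]| <= LC.2%:R * w%:R ^- K.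
  by move=> l; have [L [C H]] := Napprox_poly (A l) K; exists (L, C).
pose L := (\sum_l (LC l).1)%N; pose C := (\sum_l (LC l).2)%N.
have hL l : ((LC l).1 <= L)%N by rewrite /L (bigD1 l)//= leq_addr.
have hC l : ((LC l).2 <= C)%N by rewrite /C (bigD1 l)//= leq_addr.
clearbody L C; exists L, (Q * (C + 2) + C)%N => w w0.
have /choice[At hAt] : forall l, exists h : R -> R,
    reach ((LC l).2 * w) (LC l).1 (fun _ : unit => id) (fun _ : unit => h) /\
    forall x, 0 <= x <= 1 -> `|h x - (A l).[x]| <= (LC l).2%:R * w%:R ^- K.
  by move=> l; have [h] := hLC l w w0; exists h.
exists At => [|l x x01]; last first.
  have [_ h] := hAt l; apply: (le_trans (h x x01)).
  apply: ler_wpM2r; first by rewrite invr_ge0 exprn_ge0.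
  by rewrite ler_nat (leq_trans (hC l))// leq_addl.
have r l : reach ((C + 2) * w) L (fun _ : unit => id) (fun _ : unit => At l).
  have [h _] := hAt l; apply: (reach_pad _ (hL l)).
    by rewrite card_unit mulnDl; lia.
  by apply: reach_mono h; rewrite leq_mul2r (leq_trans (hC l)) ?orbT// leq_addr.
have := reach_family r; rewrite card_ord => rf.
apply: (@reach_affr _ _ _ _ _ _ _ _ _ _ (reach_mono _ rf)).
  by rewrite mulnA leq_mul2r leq_addr orbT.
by move=> l; exact: (affspan_gen _ (l, tt)).
Qed.

(** One copy of [At] per block, run on the local coordinate of that block; the additional layer
    computes these coordinates. *)
Lemma trunk_net X (I : finType) (F : I -> X -> R) (y : X -> R) n Q W L
    (At : 'I_Q -> R -> R) : affspan F y ->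
  reach W L (fun _ : unit => id) At ->
  reach (n * W + (n + n)) L.+1 F
    (fun (j : 'I_n * 'I_Q) x => At j.2 (blk j.1 (y x))).
Proof.
move=> Fy rA.
have r1 := reach_mono (leq_addl (n * W) (n + n)) (reach_blk Fy (leqnn (n + n))).
apply: (reach_comp (L := 1) r1).
have r (b : 'I_n) : reach W L (fun (b : 'I_n) x => blk b (y x))
    (fun (l : 'I_Q) x => At l (blk b (y x))).
  apply: reach_affl (reach_pre (fun x => blk b (y x)) rA) => _.
  exact: (affspan_gen _ b).
have := reach_family r; rewrite card_ord; apply: reach_mono; exact: leq_addr.
Qed.

Lemma exact_quad_exists Q : (0 < Q)%N ->
  exists A : 'I_Q -> {poly R}, exact_quad A.
Proof.
by move=> Q0; have [A [A0 h]] := quadrature_exists Q0 (@qnode_inj R Q); exists A.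
Qed.

Lemma sin_lip (x y : R) : `|sin x - sin y| <= `|x - y|.
Proof.
wlog xy : x y / y <= x.
  move=> h; have [/h//|/ltW /h] := leP y x; by rewrite distrC [leRHS]distrC.
rewrite [leRHS]ger0_norm ?subr_ge0// -[leRHS]mul1r.
apply: (increment_bound (dh := cos)) => //.
- by apply: derivable_within_continuous => t _; exact: ex_derive.
- by move=> t _; rewrite ler_norml cos_geN1 cos_le1.
Qed.

(** The sine is the integral of the cosine, hence up to [n^-K] a blockwise quadrature with fixed
    weights whose only varying ingredients are polynomials. [n] blocks with nets of width [O(n)]
    give width [O(n^2)]. *)
Lemma sin_net (B : R) K : 0 < B -> exists L C : nat, forall n, (0 < n)%N ->
  exists2 phi : R -> R,
    reach (C * n ^ 2) L (fun _ : unit => id) (fun _ : unit => phi) &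
    forall x y, `|y| <= B -> `|phi x - sin y| <= C%:R * n%:R ^- K + `|x - y|.
Proof.
move=> B0; pose Q := K.+1; have [A eA] := exact_quad_exists (ltn0Sn K).
have B20 : 0 < 2 * B by rewrite mulr_gt0.
pose V (_ : unit) (t : R) := sin (t - B) - sin (- B).
pose V' (_ : unit) (t : R) := cos (t - B).
have dB (t : R) : is_derive t (1 : R) (fun t => t - B) 1.
  have := is_deriveB (is_derive_id t (1 : R)) (is_derive_cst B t (1 : R)).
  by rewrite subr0.
have dV (t : R) : is_derive t (1 : R) (V tt) (V' tt t).
  have d1 := @is_derive1_comp _ sin (fun t => t - B) t _ _ (is_derive_sin _) (dB t).
  have := is_deriveB d1 (is_derive_cst (sin (- B)) t (1 : R)).
  by rewrite subr0 mulr1.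
have sid k : smooth (2 * B) k (fun (_ : unit) t => t - B).
  have b : exists C, forall (i : unit) t, 0 < t < 2 * B -> `|t - B| <= C.
    by exists B => _ t tB; rewrite ler_norml; lra.
  case: k => [|k]; split => //; exists (fun _ _ => 1) => //.
  exact: smooth_cst.
have sV' : smooth (2 * B) Q V' by have [] := smooth_sincos (sid Q).
have cV i : {within `[0, 2 * B], continuous (V i)}.
  case: i; apply: derivable_within_continuous => t _.
  by have := dV t => ?; exact: ex_derive.
have [D D0 hD] := blkint_consistent B20 eA cV (fun=> ltac:(by rewrite /V sub0r subrr))
  (fun i t _ => ltac:(by case: i; exact: dV)) sV'.
have [L [C HC]] := Napprox_family A K.
pose M := (Num.truncn (D + 2 * B * Q%:R * C%:R)).+1.
have hM : D + 2 * B * Q%:R * C%:R <= M%:R by exact/ltW/truncnS_gt.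
clearbody M; exists L.+2, (C + 2 + M)%N => n n0.
have [At rA hA] := HC n n0; have n0' : 0 < n%:R :> R by rewrite ltr0n.
pose H := 2 * B / n%:R; have H0 : 0 < H by rewrite divr_gt0.
have HE : n%:R * H = 2 * B by rewrite /H mulrC divfK// gt_eqF.
pose g (b : 'I_n) (l : 'I_Q) := V' tt ((b%:R + qnode R Q l) * H).
(* [x + B] clamped to [[0, 2B]]: the clamp is 1-Lipschitz and fixes [y + B] when [|y| <= B], so the
   input error is not amplified. *)
pose c x := 2 * B * clip01 ((2 * B)^-1 * x + 2^-1).
exists (fun x => sin (- B) + blkint H At g (c x / H)).
  have r1 : reach ((C + 2 + M) * n ^ 2) 1 (fun _ : unit => id) (fun _ : unit => c).
    apply: reach_affr (reach_blk (y := fun x => (2 * B)^-1 * x + 2^-1) (n := 1) _ _) _.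
    - apply: affspanD; last exact: affspan_cst.
      exact: (affspanZ _ (affspan_gen _ tt)).
    - by rewrite -mulnn; nia.
    - move=> _; apply: affspan_ext (affspanZ (2 * B) (affspan_gen _ ord0)) _ => x.
      by rewrite /c /blk subr0.
  apply: (reach_comp (L := 1) r1).
  have r := trunk_net (y := fun x => H^-1 * c x) n _ rA.
  apply: (@reach_affr _ _ _ _ _ _ _ _ _ _ (reach_mono _ (r _ (fun _ : unit => c) _))).
  - by rewrite -mulnn; nia.
  - exact: affspanZ (affspan_gen _ tt).
  - move=> _; apply: affspanD; first exact: affspan_cst.
    apply: affspan_sum => b; apply: affspan_sum => l.
    apply: affspan_ext (affspanZ (H * g b l) (affspan_gen _ (b, l))) _ => x /=.
    by rewrite mulrC [c x / H]mulrC mulrC.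
move=> x y yB; pose y' := (2 * B)^-1 * y + 2^-1.
have i2B : 0 < (2 * B)^-1 by rewrite invr_gt0.
have y01 : 0 <= y' <= 1.
  have : `|(2 * B)^-1 * y| <= 2^-1.
    rewrite normrM gtr0_norm// ler_pdivrMl// (le_trans yB)//.
    by rewrite le_eqVlt; apply/orP; left; apply/eqP; field.
  by rewrite /y' ler_norml => ?; lra.
have cT : 0 <= c x <= 2 * B.
  by have := clip01_itv ((2 * B)^-1 * x + 2^-1); rewrite /c => ?; rewrite mulr_ge0 ?ler_piMr//; lra.
have cy : `|(c x - B) - y| <= `|x - y|.
  have := clip01_lip ((2 * B)^-1 * x + 2^-1) y'; rewrite (clip01_id y01).
  have -> : (2 * B)^-1 * x + 2^-1 - y' = (2 * B)^-1 * (x - y) by rewrite /y'; ring.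
  rewrite [leRHS]normrM gtr0_norm// -(ler_pM2l B20) mulrA mulfV ?gt_eqF// mul1r.
  rewrite -[X in X * `|_|](gtr0_norm B20) -normrM => hh; apply: le_trans hh.
  rewrite le_eqVlt; apply/orP; left; apply/eqP; congr `|_|.
  by rewrite /c /y'; field; rewrite gt_eqF.
have h1 := hD n n0 tt (c x) cT; rewrite -/H in h1.
have h2 := @blkint_perturb R n Q H (C%:R * n%:R ^- K) 1 At (fun l => horner (A l)) g
  (c x / H) (ltW H0) hA.
have {}h2 := h2 ltac:(by move=> b l; rewrite /g /V' ler_norml cos_geN1 cos_le1).
have h3 : `|sin (c x - B) - sin y| <= `|x - y|.
  exact: le_trans (sin_lip _ _) cy.
rewrite HE in h2.
set S := blkint _ _ _ _ in h2 *; set S' := blkint _ _ _ _ in h1 h2.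
have -> : sin (- B) + S - sin y = (S - S') - (V tt (c x) - S') + (sin (c x - B) - sin y).
  by rewrite /V; ring.
rewrite (le_trans (ler_normD _ _))// lerD// (le_trans (ler_normB _ _))//.
rewrite (le_trans (lerD h2 h1))// mulr1 mulrA.
have nK : 0 <= n%:R ^- K :> R by rewrite invr_ge0 exprn_ge0.
have nQ : n%:R^-1 ^+ Q <= n%:R ^- K :> R.
  rewrite /Q exprS exprVn ler_piMl//.
  by rewrite invf_le1// ler1n.
have := ler_wpM2l D0 nQ.
have : (D + 2 * B * Q%:R * C%:R) * n%:R ^- K <= (C + 2 + M)%:R * n%:R ^- K.
  apply: ler_wpM2r => //; apply: (le_trans hM); rewrite ler_nat; exact: leq_addl.
lra.
Qed.

End BlockNets.

(** * Picard iteration *)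

Section Picard.
Context (R : realType).
Implicit Types (n Q s : nat) (H gamma : R).

Definition bnode n Q H (j : 'I_n * 'I_Q) : R := (j.1%:R + qnode R Q j.2) * H.

Definition pic_force n Q gamma (phi : R -> R) (w x : 'I_n * 'I_Q -> R) j :=
  - gamma * phi (w j) + x j.

(** Linear in [g] with fixed coefficients: integration between nodes is absorbed in an affine map
    and costs no hidden layer. *)
Definition pic_int n Q H (A : 'I_Q -> R -> R) (g : 'I_n * 'I_Q -> R) (j : 'I_n * 'I_Q) : R :=
  blkint H A (fun b l => g (b, l)) (bnode H j / H).

(* Picard iterates for the first component, at the quadrature nodes. *)
Fixpoint pic n Q H A gamma phi s (x : 'I_n * 'I_Q -> R) : 'I_n * 'I_Q -> R :=
  if s is s'.+1 then
    pic_int H A (pic_int H A (pic_force gamma phi (pic H A gamma phi s' x) x))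
  else fun=> 0.

Lemma affspan_pic_int X (I : finType) (F : I -> X -> R) n Q H A
    (g : X -> 'I_n * 'I_Q -> R) j :
  (forall k, affspan F (fun x => g x k)) -> affspan F (fun x => pic_int H A (g x) j).
Proof.
move=> hg; apply: affspan_sum => b; apply: affspan_sum => l.
apply: affspan_ext (affspanZ (H * A l (blk b (bnode H j / H))) (hg (b, l))) _ => x.
by rewrite mulrAC.
Qed.

(** Only [phi] needs hidden layers: each stage runs [n * Q] copies of it and carries the inputs
    along in pairs of units. The outputs for [true] approximate [v2] at the nodes, the integrand of
    [v1]; those for [false] approximate the integrand of [v2]. *)
Lemma pic_reach n Q H (A : 'I_Q -> R -> R) gamma phi W L W' s :
  reach W L (fun _ : unit => id) (fun _ : unit => phi) ->
  (n * Q * W + (n * Q + n * Q) <= W')%N ->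
  let J := ('I_n * 'I_Q)%type in
  reach W' (s.+1 * L) (fun (j : J) (x : J -> R) => x j)
    (fun (bj : bool * J) (x : J -> R) =>
      let g := pic_force gamma phi (pic H A gamma phi s x) x in
      if bj.1 then pic_int H A g bj.2 else g bj.2).
Proof.
move=> rphi WW J.
have cJ : #|{: J}| = (n * Q)%N by rewrite card_prod !card_ord.
pose st k (j : J + J) (x : J -> R) :=
  match j with inl j => pic H A gamma phi k x j | inr j => x j end.
pose mid k (j : J + J) (x : J -> R) :=
  match j with inl j => phi (pic H A gamma phi k x j) | inr j => x j end.
have stmid k : reach W' L (st k) (mid k).
  have r1 (j : J) : reach W L (st k) (fun _ : unit => fun x => phi (pic H A gamma phi k x j)).
    apply: reach_affl (reach_pre (fun x => pic H A gamma phi k x j) rphi) => _.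
    exact: (affspan_gen (st k) (inl j)).
  have r2 : reach (n * Q + n * Q) L (st k) (fun (j : J) (x : J -> R) => x j).
    apply: (@reach_affl _ _ _ _ _ _ _ (fun (j : J) (x : J -> R) => x j)).
      by move=> j; exact: (affspan_gen (st k) (inr j)).
    by apply: reach_id; rewrite cJ.
  have := reach_par (reach_family r1) r2; rewrite cJ => /(reach_mono WW) r.
  apply: (reach_affr r); case=> j.
    exact: (affspan_gen _ (inl (j, tt))).
  exact: (affspan_gen _ (inr j)).
have force k (j : J) : affspan (mid k)
    (fun x => pic_force gamma phi (pic H A gamma phi k x) x j).
  apply: affspanD; last exact: (affspan_gen (mid k) (inr j)).
  exact: (affspanZ _ (affspan_gen (mid k) (inl j))).
have rst : reach W' (s * L) (fun (j : J) (x : J -> R) => x j) (st s).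
  elim: s => [|k IH] /=.
    case=> j; first exact: affspan_cst.
    exact: (affspan_gen (fun (j : J) (x : J -> R) => x j) j).
  rewrite mulSn addnC; apply: (reach_comp IH).
  apply: (reach_affr (stmid k)); case=> j /=; last exact: (affspan_gen (mid k) (inr j)).
  by apply: affspan_pic_int => i; apply: affspan_pic_int.
rewrite mulSn addnC; apply: (reach_comp rst); apply: (reach_affr (stmid s)).
case=> -[] j /=; last exact: force.
by apply: affspan_pic_int.
Qed.

Lemma pic_int_lip n Q H (A : 'I_Q -> R -> R) CA lam M (g h : 'I_n * 'I_Q -> R) j :
  0 < H -> 0 < lam -> lam * H <= 1 -> 0 <= M -> 0 <= CA ->
  (forall l, A l 0 = 0) -> (forall l x, 0 <= x <= 1 -> `|A l x| <= CA) ->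
  (forall i, `|g i - h i| <= M * (1 + lam * H) ^+ i.1) ->
  `|pic_int H A g j - pic_int H A h j| <=
    2 * Q%:R * CA / lam * (M * (1 + lam * H) ^+ j.1).
Proof.
move=> H0 l0 lH M0 CA0 A0 hA gh.
have -> : pic_int H A g j - pic_int H A h j =
    blkint H A (fun b l => g (b, l) - h (b, l)) (bnode H j / H).
  rewrite /pic_int /blkint -sumrB; apply: eq_bigr => b _.
  by rewrite -sumrB; apply: eq_bigr => l _; ring.
apply: blkint_stable => //.
rewrite mulfK ?gt_eqF// -natr1 lerD2l.
by have /andP[_ /ltW] := qnode_itv R (ltn_ord j.2).
Qed.

(** The hypothesis on [kappa] gives [kappa * gamma <= 1/2] and [kappa <= 1]: the first integration
    of a Picard step halves the error, the second does not enlarge it. [eps] is the error of [phi],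
    [delta] that of the quadrature. *)
Lemma pic_err n Q H (A : 'I_Q -> R -> R) gamma phi CA lam B eps delta
    (v1 v2 u : R -> R) (s : nat) :
  let kappa := 2 * Q%:R * CA / lam in
  let x (j : 'I_n * 'I_Q) := u (bnode H j) in
  let a (j : 'I_n * 'I_Q) := - gamma * sin (v1 (bnode H j)) + u (bnode H j) in
  0 < H -> 0 < lam -> lam * H <= 1 -> 0 <= CA -> 0 < gamma -> 0 <= B ->
  0 <= eps -> 0 <= delta ->
  (forall l, A l 0 = 0) -> (forall l x, 0 <= x <= 1 -> `|A l x| <= CA) ->
  kappa * (1 + 2 * gamma) <= 1 ->
  (forall x y, `|y| <= B -> `|phi x - sin y| <= eps + `|x - y|) ->
  (forall j : 'I_n * 'I_Q, `|v1 (bnode H j)| <= B) ->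
  (forall j, `|v1 (bnode H j) - pic_int H A (fun i : 'I_n * 'I_Q => v2 (bnode H i)) j| <= delta) ->
  (forall j, `|v2 (bnode H j) - pic_int H A a j| <= delta) ->
  let M := B * 2^-1 ^+ s + 2 * eps + 4 * delta in
  forall j : 'I_n * 'I_Q, let g := pic_force gamma phi (pic H A gamma phi s x) x in
    [/\ `|pic H A gamma phi s x j - v1 (bnode H j)| <= M * (1 + lam * H) ^+ j.1,
        `|g j - a j| <= gamma * M * (1 + lam * H) ^+ j.1 &
        `|pic_int H A g j - v2 (bnode H j)| <= (M + delta) * (1 + lam * H) ^+ j.1].
Proof.
move=> kappa x a H0 l0 lH CA0 g0 B0 e0 d0 A0 hA kg hphi v1B c1 c2 M j.
set rho := 1 + lam * H.
have rho1 : 1 <= rho by rewrite lerDl mulr_ge0// ltW.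
have rX (k : nat) : 1 <= rho ^+ k by rewrite exprn_ege1.
have k0 : 0 <= kappa by rewrite divr_ge0 ?(ltW l0)// !mulr_ge0.
have kE : 2 * Q%:R * CA / lam = kappa by [].
clearbody kappa; have kg0 : 0 <= kappa * gamma by rewrite mulr_ge0// ltW.
have kg2 : kappa * gamma <= 2^-1 by lra.
have k1 : kappa <= 1 by lra.
(* Solves [E (k+1) = (E k + eps) / 2 + 2 * delta]; the iteration starts from 0, at distance at most
   [B] from [v1]. *)
pose E (k : nat) := B * 2^-1 ^+ k + eps + 4 * delta.
have E0 k : 0 <= E k by rewrite !addr_ge0// mulr_ge0// exprn_ge0.
pose w k := pic H A gamma phi k x; pose g k := pic_force gamma phi (w k) x.
have gerr k (i : 'I_n * 'I_Q) : `|w k i - v1 (bnode H i)| <= E k * rho ^+ i.1 ->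
    `|g k i - a i| <= gamma * (E k + eps) * rho ^+ i.1.
  move=> h; have -> : g k i - a i = gamma * (sin (v1 (bnode H i)) - phi (w k i)).
    by rewrite /g /pic_force /a /x; ring.
  rewrite normrM (gtr0_norm g0) -mulrA; apply: ler_wpM2l; first exact: ltW.
  rewrite distrC (le_trans (hphi _ _ (v1B i)))// mulrDl addrC lerD//.
  by rewrite ler_peMr.
have herr k (i : 'I_n * 'I_Q) : (forall i : 'I_n * 'I_Q, `|w k i - v1 (bnode H i)| <= E k * rho ^+ i.1) ->
    `|pic_int H A (g k) i - v2 (bnode H i)| <= (2^-1 * (E k + eps) + delta) * rho ^+ i.1.
  move=> h; have -> : pic_int H A (g k) i - v2 (bnode H i) =
     (pic_int H A (g k) i - pic_int H A a i) - (v2 (bnode H i) - pic_int H A a i) by ring.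
  rewrite (le_trans (ler_normB _ _))// mulrDl lerD//.
    have := @pic_int_lip n Q H A CA lam (gamma * (E k + eps)) (g k) a i H0 l0 lH.
    move=> /(_ _ CA0 A0 hA (fun i => gerr k i (h i))) hh.
    apply: le_trans (hh _) _; first exact: mulr_ge0 (ltW g0) (addr_ge0 (E0 k) e0).
    rewrite kE -/rho !mulrA; apply: ler_wpM2r; first exact: le_trans (rX _).
    apply: ler_wpM2r; last exact: kg2.
    exact: addr_ge0 (E0 k) e0.
  by rewrite (le_trans (c2 i))// ler_peMr.
have werr k (i : 'I_n * 'I_Q) : `|w k i - v1 (bnode H i)| <= E k * rho ^+ i.1.
  elim: k i => [|k IH] i.
    have BE : B <= E 0 by rewrite /E expr0 mulr1 -addrA lerDl addr_ge0// mulr_ge0.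
    rewrite /w /= sub0r normrN (le_trans (v1B i))// (le_trans BE)//.
    by rewrite ler_peMr.
  have -> : w k.+1 i - v1 (bnode H i) =
    (pic_int H A (pic_int H A (g k)) i - pic_int H A (fun i : 'I_n * 'I_Q => v2 (bnode H i)) i)
     - (v1 (bnode H i) - pic_int H A (fun i : 'I_n * 'I_Q => v2 (bnode H i)) i) by rewrite /w /=; ring.
  have -> : E k.+1 = (2^-1 * (E k + eps) + delta) + delta by rewrite /E exprS; field.
  rewrite (le_trans (ler_normB _ _))// mulrDl lerD//; last first.
    by rewrite (le_trans (c1 i))// ler_peMr.
  have F0 : 0 <= 2^-1 * (E k + eps) + delta.
    by apply: addr_ge0 => //; apply: mulr_ge0 => //; exact: addr_ge0 (E0 k) e0.
  have := @pic_int_lip n Q H A CA lam _ (pic_int H A (g k))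
    (fun i : 'I_n * 'I_Q => v2 (bnode H i)) i H0 l0 lH F0 CA0 A0 hA (fun i => herr k i IH).
  move=> /le_trans; apply; rewrite kE ler_piMl//.
  by rewrite mulr_ge0// (le_trans _ (rX _)).
have ME : M = E s + eps by rewrite /M /E; ring.
split; rewrite ?ME.
- apply: le_trans (werr s j) _; apply: ler_wpM2r; first exact: le_trans (rX _).
  by rewrite lerDl.
- exact: gerr.
- apply: le_trans (herr s j (werr s)) _; apply: ler_wpM2r; first exact: le_trans (rX _).
  by rewrite lerD2r; have := E0 s; lra.
Qed.

End Picard.

(** * Joint error of branch and trunk approximations *)

Section PendulumNets.
Context (R : realType).
Implicit Types (n Q s K : nat).

(** Three contributions: the quadrature of exact data, the node errors with their weight bounded by
    [(1 + lam * H)^n <= e^(lam * T)], and the replacement of [A] by [At]. *)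
Lemma blkint_transfer n Q T CA lam m Ba eta D (A At : 'I_Q -> R -> R)
    (a g : 'I_n * 'I_Q -> R) (vt t : R) :
  let H := T / n%:R in
  (0 < n)%N -> 0 < T -> 0 < lam -> lam * H <= 1 -> 0 <= CA -> 0 <= m ->
  (forall l, A l 0 = 0) -> (forall l x, 0 <= x <= 1 -> `|A l x| <= CA) ->
  2 * Q%:R * CA / lam <= 1 ->
  (forall l x, 0 <= x <= 1 -> `|At l x - A l x| <= eta) ->
  (forall j, `|g j - a j| <= m * (1 + lam * H) ^+ j.1) ->
  (forall j, `|a j| <= Ba) -> t <= T ->
  `|vt - blkint H A (fun b l => a (b, l)) (t / H)| <= D ->
  `|vt - blkint H At (fun b l => g (b, l)) (t / H)| <=
     D + m * expR (lam * T) + T * (Q%:R * (Ba + m * expR (lam * T))) * eta.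
Proof.
move=> H n0 T0 l0 lH CA0 m0 A0 hA k1 hAt ga aB tT hv.
have nR : 0 < n%:R :> R by rewrite ltr0n.
have H0 : 0 < H by rewrite divr_gt0.
have HT : n%:R * H = T by rewrite /H mulrC divfK// gt_eqF.
clearbody H.
have rX k : (k <= n)%N -> (1 + lam * H) ^+ k <= expR (lam * T).
  move=> kn; apply: (@le_trans _ _ ((1 + lam * H) ^+ n)).
    by apply: ler_weXn2l => //; rewrite lerDl mulr_ge0// ltW.
  rewrite -HT mulrCA expRM_natl; apply: lerXn2r; rewrite ?nnegrE ?expR_ge0//.
    by rewrite addr_ge0// mulr_ge0// ltW.
  exact: expR_ge1Dx.
have n1n : (n.-1 < n)%N by rewrite prednK.
have h2 : `|blkint H A (fun b l => g (b, l) - a (b, l)) (t / H)| <= m * expR (lam * T).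
  apply: (le_trans (@blkint_stable _ n Q H CA A _ lam m (t / H) n.-1
    H0 l0 lH m0 CA0 A0 hA _ _ n1n)).
  - by move=> b l; exact: (ga (b, l)).
  - by rewrite prednK// ler_pdivrMr// HT.
  - apply: (@le_trans _ _ (m * (1 + lam * H) ^+ n.-1)).
      by rewrite ler_piMl// mulr_ge0// exprn_ge0// addr_ge0// mulr_ge0// ltW.
    by rewrite ler_wpM2l// rX// leq_pred.
have gB b l : `|g (b, l)| <= Ba + m * expR (lam * T).
  rewrite -(subrK (a (b, l)) (g (b, l))) addrC (le_trans (ler_normD _ _))// lerD//.
  by rewrite (le_trans (ga _))// ler_wpM2l// rX//= ltnW.
have h3 := @blkint_perturb R n Q H eta _ At A (fun b l => g (b, l)) (t / H) (ltW H0) hAt gB.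
rewrite HT in h3.
set S1 := blkint _ _ _ _ in hv; set S2 := blkint _ _ _ _ in h2; set S3 := blkint _ _ _ _ in h3 *.
set S4 := blkint _ _ _ _ in h3.
have e2 : S2 = S4 - S1.
  rewrite /S2 /S4 /S1 /blkint -sumrB; apply: eq_bigr => b _.
  by rewrite -sumrB; apply: eq_bigr => l _; ring.
have -> : vt - S3 = (vt - S1) - S2 - (S3 - S4) by rewrite e2; ring.
rewrite (le_trans (ler_normB _ _))// lerD// (le_trans (ler_normB _ _))// lerD//.
Qed.

Lemma pendulum_nets (I : Type) (T gamma : R) (v1 v2 u : I -> R -> R) K :
  0 < T -> 0 < gamma ->
  (forall i, {within `[0, T], continuous (v1 i)}) ->
  (forall i, {within `[0, T], continuous (v2 i)}) ->
  (forall i, v1 i 0 = 0) -> (forall i, v2 i 0 = 0) ->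
  (forall i t, 0 < t < T -> is_derive t 1 (v1 i) (v2 i t)) ->
  (forall i t, 0 < t < T -> is_derive t 1 (v2 i) (- gamma * sin (v1 i t) + u i t)) ->
  (forall k, smooth T k u) -> (forall k, smooth T k v1 /\ smooth T k v2) ->
  exists n0 Q L C : nat, forall n, (0 < n)%N -> (n0 <= n)%N ->
  exists s (psi : 'I_n * 'I_Q -> R -> R)
    (beta : bool * ('I_n * 'I_Q) -> ('I_n * 'I_Q -> R) -> R),
  let x i (j : 'I_n * 'I_Q) := u i (bnode (T / n%:R) j) in
  [/\ (s <= C * (trunc_log 2 n).+1)%N,
      reach (C * n ^ 2) L (fun _ : unit => id) psi,
      reach (C * n ^ 3) s (fun (j : 'I_n * 'I_Q) (x : 'I_n * 'I_Q -> R) => x j) beta,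
      forall i t, 0 <= t <= T ->
        `|v1 i t - \sum_j beta (true, j) (x i) * psi j t| <= C%:R * n%:R ^- K &
      forall i t, 0 <= t <= T ->
        `|v2 i t - \sum_j beta (false, j) (x i) * psi j t| <= C%:R * n%:R ^- K].
Proof.
move=> T0 g0 c1 c2 v10 v20 d1 d2 su sv.
pose Q := K.+1; have [A eA] := @exact_quad_exists R Q (ltn0Sn K).
have [CA CA0 hA] := poly_bounded A.
have sa k : smooth T k (fun i t => - gamma * sin (v1 i t) + u i t).
  apply: smoothD => //; apply: smoothM; first exact: smooth_cst.
  by have [] := smooth_sincos (proj1 (sv k)).
have [D1 D10 hD1] := blkint_consistent T0 eA c1 v10 d1 (proj2 (sv Q)).
have [D2 D20 hD2] := blkint_consistent T0 eA c2 v20 d2 (sa Q).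
have bd (f : I -> R -> R) : smooth T 0 f -> exists2 B, 0 < B & forall i t, 0 < t < T -> `|f i t| <= B.
  move=> /smooth_bounded[B hB]; exists (`|B| + 1); first by rewrite ltr_wpDl.
  by move=> i t /hB h; rewrite (le_trans (h i))// (le_trans (ler_norm _))// lerDl.
have [B B0 hB] := bd _ (proj1 (sv 0)).
have [B2 B20 hB2] := bd _ (proj2 (sv 0)).
have [B3 B30 hB3] := bd _ (sa 0).
have [Ls [Cs hs]] := sin_net K B0.
have [La [Ca ha]] := Napprox_family A K.
(* Large enough for [kappa * (1 + 2 * gamma) <= 1]; the summand 1 keeps it positive. *)
pose lam := 2 * Q%:R * CA * (1 + 2 * gamma) + 1.
have lam0 : 0 < lam by rewrite ltr_wpDl// !mulr_ge0// addr_ge0// mulr_ge0// ltW.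
pose kappa := 2 * Q%:R * CA / lam.
have kg : kappa * (1 + 2 * gamma) <= 1.
  by rewrite /kappa mulrAC ler_pdivrMr// mul1r /lam lerDl.
have kk0 : 0 <= kappa by rewrite divr_ge0 ?(ltW lam0)// !mulr_ge0.
have k1 : kappa <= 1.
  by have : 0 <= kappa * gamma by [rewrite mulr_ge0// ltW]; clearbody kappa; lra.
pose delta0 := D1 + D2; have dd0 : 0 <= delta0 by exact: addr_ge0.
pose m0 := B + 2 * Cs%:R + 5 * delta0.
have m00 : 0 <= m0 by rewrite !addr_ge0 ?(ltW B0)// mulr_ge0.
pose E := expR (lam * T).
pose F m Ba := delta0 + m * E + T * (Q%:R * (Ba + m * E)) * Ca%:R.
(* For [n >= n0] the step satisfies [lam * H <= 1]. *)
pose n0 := (Num.truncn (lam * T)).+1.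
pose C0 := (Num.truncn (F m0 B2 + F (gamma * m0) B3)).+1.
have hn0 : lam * T <= n0%:R by exact/ltW/truncnS_gt.
have hC0 : F m0 B2 + F (gamma * m0) B3 <= C0%:R by exact/ltW/truncnS_gt.
clearbody n0 C0.
exists n0, Q, La.+1, ((K + 1) * Ls + (Q * Cs + Q * 2) + (Ca + 2) + C0)%N => n n_gt0 n0n.
have nR : 0 < n%:R :> R by rewrite ltr0n.
pose H := T / n%:R; have H0 : 0 < H by rewrite divr_gt0.
have HT : n%:R * H = T by rewrite /H mulrC divfK// gt_eqF.
have lH : lam * H <= 1.
  by rewrite /H mulrA ler_pdivrMr// mul1r (le_trans hn0)// ler_nat.
have [At rA hAt] := ha n n_gt0; have [phi rphi hphi] := hs n n_gt0.
(* Gives [2^-s <= n^-K], since [n < 2^(trunc_log 2 n + 1)]. *)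
pose s := (K * (trunc_log 2 n).+1)%N.
pose psi (j : 'I_n * 'I_Q) t := H * At j.2 (blk j.1 (H^-1 * t)).
(* The branch uses the exact polynomials, whose values at the fixed nodes are mere weights; only the
   trunk, where [t] varies, needs the nets [At]. *)
pose Ah l := horner (A l).
pose beta (bj : bool * ('I_n * 'I_Q)) (x : 'I_n * 'I_Q -> R) :=
      let g := pic_force gamma phi (pic H Ah gamma phi s x) x in
      if bj.1 then pic_int H Ah g bj.2 else g bj.2.
exists (s.+1 * Ls)%N, psi, beta => x.
have nK0 : 0 <= n%:R ^- K :> R by rewrite invr_ge0 exprn_ge0.
have nK1 : n%:R ^- K <= 1 :> R by rewrite invf_le1 ?exprn_gt0// exprn_ege1// ler1n.
have nQ : n%:R^-1 ^+ Q <= n%:R ^- K :> R.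
  by rewrite /Q exprS exprVn ler_piMl// invf_le1// ler1n.
have sK : 2^-1 ^+ s <= n%:R ^- K :> R.
  rewrite exprVn lef_pV2 ?posrE ?exprn_gt0// /s mulnC exprM.
  apply: lerXn2r; rewrite ?nnegrE ?exprn_ge0//.
  by rewrite -natrX ler_nat ltnW// trunc_log_ltn.
have nodeT (j : 'I_n * 'I_Q) : 0 < bnode H j < T.
  have /andP[q0 q1] := qnode_itv R (ltn_ord j.2).
  rewrite /bnode mulr_gt0 ?ltr_wpDl//= -HT ltr_pM2r//.
  apply: (@lt_le_trans _ _ (j.1%:R + 1)); first by rewrite ltrD2l.
  by rewrite natr1 ler_nat.
pose M := B * 2^-1 ^+ s + 2 * (Cs%:R * n%:R ^- K) + 4 * (delta0 * n%:R ^- K).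
have M0 : 0 <= M.
  by rewrite !addr_ge0// !mulr_ge0 ?(ltW B0)// exprn_ge0.
have Mm : M + delta0 * n%:R ^- K <= m0 * n%:R ^- K.
  by have := ler_wpM2l (ltW B0) sK; rewrite /M /m0; lra.
have mM : M <= m0 * n%:R ^- K.
  by rewrite (le_trans _ Mm)// lerDl mulr_ge0.
have hphi' (y z : R) : `|z| <= B -> `|phi y - sin z| <= Cs%:R * n%:R ^- K + `|y - z|.
  by move=> zB; exact: hphi.
have cons1 i t : 0 <= t <= T ->
    `|v1 i t - blkint H Ah (fun (b : 'I_n) l => v2 i (bnode H (b, l))) (t / H)| <= delta0 * n%:R ^- K.
  move=> tT; have h := hD1 n n_gt0 i t tT; apply: (le_trans h).
  by rewrite ler_pM ?exprn_ge0 ?invr_ge0// /delta0 lerDl.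
pose a i (j : 'I_n * 'I_Q) := - gamma * sin (v1 i (bnode H j)) + u i (bnode H j).
have cons2 i t : 0 <= t <= T ->
    `|v2 i t - blkint H Ah (fun b l => a i (b, l)) (t / H)| <= delta0 * n%:R ^- K.
  move=> tT; have h := hD2 n n_gt0 i t tT; apply: (le_trans h).
  by rewrite ler_pM ?exprn_ge0 ?invr_ge0// /delta0 lerDr.
have nodeT' (j : 'I_n * 'I_Q) : 0 <= bnode H j <= T.
  by have /andP[h1 h2] := nodeT j; rewrite !ltW.
have err i j := @pic_err R n Q H Ah gamma phi CA lam B (Cs%:R * n%:R ^- K)
  (delta0 * n%:R ^- K) (v1 i) (v2 i) (u i) s H0 lam0 lH CA0 g0 (ltW B0)
  (mulr_ge0 (ler0n _ _) nK0) (mulr_ge0 dd0 nK0) (proj1 eA) hA kg hphi'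
  (fun j => hB i _ (nodeT j)) (fun j => cons1 i _ (nodeT' j))
  (fun j => cons2 i _ (nodeT' j)) j.
have rho0 k : 0 <= (1 + lam * H) ^+ k.
  by rewrite exprn_ge0// addr_ge0// mulr_ge0// ltW.
have fin m Ba (vt t : R) (a' g : 'I_n * 'I_Q -> R) : 0 <= m ->
    (forall j, `|g j - a' j| <= m * n%:R ^- K * (1 + lam * H) ^+ j.1) ->
    (forall j, `|a' j| <= Ba) -> 0 <= Ba -> 0 <= t <= T ->
    `|vt - blkint H Ah (fun b l => a' (b, l)) (t / H)| <= delta0 * n%:R ^- K ->
    `|vt - \sum_j g j * psi j t| <= F m Ba * n%:R ^- K.
  move=> m_ge0 ga aB Ba0 tT hv.
  have -> : \sum_j g j * psi j t = blkint H At (fun b l => g (b, l)) (t / H).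
    rewrite /blkint pair_bigA/=; apply: eq_bigr => -[b l] _ /=.
    by rewrite /psi /= [H^-1 * t]mulrC; ring.
  have mn0 : 0 <= m * n%:R ^- K by exact: mulr_ge0.
  have /andP[_ tT'] := tT.
  apply: (le_trans (@blkint_transfer n Q T CA lam _ Ba _ _ Ah At a' g vt t n_gt0 T0
    lam0 lH CA0 mn0 (proj1 eA) hA k1 hAt ga aB tT' hv)).
  rewrite -/E /F.
  have E0 : 0 <= E by exact: expR_ge0.
  have h1 : m * n%:R ^- K * E <= m * E.
    by rewrite -mulrA (mulrC _ E) mulrA ler_piMr// mulr_ge0.
  have : T * (Q%:R * (Ba + m * n%:R ^- K * E)) * (Ca%:R * n%:R ^- K) <=
      T * (Q%:R * (Ba + m * E)) * (Ca%:R * n%:R ^- K).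
    apply: ler_wpM2r; first by rewrite mulr_ge0.
    by apply: ler_wpM2l; [exact: ltW|]; apply: ler_wpM2l => //; rewrite lerD2l.
  move=> h2.
  have -> : (delta0 + m * E + T * (Q%:R * (Ba + m * E)) * Ca%:R) * n%:R ^- K =
      delta0 * n%:R ^- K + m * n%:R ^- K * E +
      T * (Q%:R * (Ba + m * E)) * (Ca%:R * n%:R ^- K) by ring.
  by rewrite lerD2l.
have FC m Ba : F m Ba * n%:R ^- K <= F m0 B2 * n%:R ^- K \/
    F m Ba * n%:R ^- K <= F (gamma * m0) B3 * n%:R ^- K ->
    F m Ba * n%:R ^- K <= ((K + 1) * Ls + (Q * Cs + Q * 2) + (Ca + 2) + C0)%:R * n%:R ^- K.
  have F0 m' Ba' : 0 <= m' -> 0 <= Ba' -> 0 <= F m' Ba'.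
    move=> h1 h2; have E0 : 0 <= E by exact: expR_ge0.
    by rewrite /F !addr_ge0// !mulr_ge0// ?(ltW T0)// addr_ge0// mulr_ge0.
  have := F0 m0 B2 m00 (ltW B20); have := F0 (gamma * m0) B3 (mulr_ge0 (ltW g0) m00) (ltW B30).
  have hC : C0%:R <= ((K + 1) * Ls + (Q * Cs + Q * 2) + (Ca + 2) + C0)%:R :> R.
    by rewrite ler_nat leq_addl.
  by move=> f1 f2 [/le_trans|/le_trans]; apply; apply: ler_wpM2r => //;
    apply: le_trans hC; apply: le_trans hC0; rewrite ?lerDl ?lerDr.
split.
- apply: (@leq_trans ((K + 1) * Ls * (trunc_log 2 n).+1)).
    rewrite mulnAC leq_mul2r /s; apply/orP; right.
    by rewrite mulnDl mul1n -addn1 leq_add2l.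
  by rewrite leq_mul2r -!addnA leq_addr orbT.
- apply: (@reach_mono _ _ ((Ca + 2) * n ^ 2)).
    by rewrite leq_mul2r (leq_trans (leq_addl _ _) (leq_addr _ _)) orbT.
  apply: (@reach_mono _ _ (n * (Ca * n) + (n + n))).
    rewrite -mulnn mulnDl mulnCA leq_add2l addnn -mul2n leq_mul2l.
    by rewrite leq_pmull.
  apply: reach_affr; first exact: (trunk_net (y := fun t => H^-1 * t) n
    (affspanZ H^-1 (affspan_gen _ tt)) rA).
  by move=> j; exact: (affspanZ H (affspan_gen _ j)).
- apply: (pic_reach H Ah gamma s rphi).
  apply: (@leq_trans ((Q * Cs + Q * 2) * n ^ 3)); last first.
    rewrite leq_mul2r (leq_trans (leq_addl _ _) (leq_trans (leq_addr _ _) (leq_addr _ _))).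
    by rewrite orbT.
  have n1 : (n <= n ^ 3)%N by rewrite -{1}(expn1 n) leq_pexp2l.
  rewrite addnn -muln2 mulnDl leq_add//.
    by rewrite (expnS n 2) (mulnC n Q) -!mulnA (mulnCA n Cs).
  by rewrite -[leqLHS]mulnA [leqLHS]mulnC leq_mul2l n1 orbT.
- move=> i t tT; apply: (le_trans (fin m0 B2 _ _ (fun j => v2 i (bnode H j)) _
    m00 _ _ (ltW B20) tT (cons1 i t tT))).
  + move=> j; have [_ _ h] := err i j; apply: (le_trans h).
    exact: ler_wpM2r.
  + by move=> j; exact: hB2.
  + by apply: FC; left.
- move=> i t tT; apply: (le_trans (fin (gamma * m0) B3 _ _ (a i) _ _ _ _ (ltW B30) tT (cons2 i t tT))).
  + by rewrite mulr_ge0// ltW.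
  + move=> j; have [_ h _] := err i j; apply: (le_trans h).
    by apply: ler_wpM2r => //; rewrite -mulrA ler_wpM2l// ltW.
  + by move=> j; exact: hB3.
  + by apply: FC; right.
Qed.

End PendulumNets.

(** * Absolutely continuous functions *)

Section AbsCont.
Context (R : realType).
Implicit Types (T a b c x y z e eta d r : R) (f : R -> R).

Lemma is_derive_eps f x d eta : is_derive x (1 : R) f d -> 0 < eta ->
  exists2 r, 0 < r & forall h, `|h| < r -> `|f (x + h) - f x - d * h| <= eta * `|h|.
Proof.
move=> [df dE] eta0.
have : h^-1 *: ((f \o shift x) (h *: (1 : R)) - f x) @[h --> 0^'] --> d by rewrite -dE.
move=> /cvgrPdist_le/(_ _ eta0)/nbhs_ballP[r /= r0 hr].
exists r => // h hr'; have [->|h0] := eqVneq h 0.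
  by rewrite addr0 mulr0 subrr subr0 normr0 mulr0.
have := hr h; rewrite -ball_normE /= sub0r normrN => /(_ hr' h0).
rewrite /= scaler1 [h + x]addrC => hh.
have -> : f (x + h) - f x - d * h = - (d - h^-1 * (f (x + h) - f x)) * h.
  by field.
by rewrite normrM normrN; apply: ler_wpM2r.
Qed.

Lemma eps_is_derive f x d : (forall eta, 0 < eta ->
    exists2 r, 0 < r & forall h, `|h| < r -> `|f (x + h) - f x - d * h| <= eta * `|h|) ->
  is_derive x (1 : R) f d.
Proof.
move=> hf.
have cv : h^-1 *: ((f \o shift x) (h *: (1 : R)) - f x) @[h --> 0^'] --> d.
  apply/cvgrPdist_le => eta eta0; have [r r0 hr] := hf eta eta0.
  apply/nbhs_ballP; exists r => //= h.
  rewrite -ball_normE /= sub0r normrN => hr' h0.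
  rewrite scaler1 [h + x]addrC.
  have hn : 0 < `|h| by rewrite normr_gt0.
  rewrite -(ler_pM2r hn) -normrM.
  have -> : (d - h^-1 *: (f (x + h) - f x)) * h = - (f (x + h) - f x - d * h).
    by rewrite /GRing.scale/=; field.
  by rewrite normrN; exact: hr.
by apply: DeriveDef; [apply/cvg_ex; exists d|apply/cvg_lim].
Qed.

Lemma ac_continuous T f : abs_continuous T f -> {within `[0, T], continuous f}.
Proof.
move=> acf; apply/subspace_continuousP => x /=; rewrite in_itv/= => xT.
apply/cvgrPdist_lt => e e0; have [delta d0 hd] := acf e e0.
have key y z : 0 <= y -> y <= z -> z <= T -> z - y < delta -> `|f z - f y| < e.
  move=> y0 yz zT zy; have := hd 1%N (fun=> y) (fun=> z).
  rewrite !big_ord1; apply => //.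
  by move=> i j _ _ _; rewrite !ord1.
apply/nbhs_ballP; exists delta => //= y; rewrite -ball_normE/= in_itv/= => yx yT.
have [xy|/ltW xy] := leP x y.
  by rewrite distrC; apply: key; [lra|lra|lra|move: yx; rewrite ltr_norml; lra].
by apply: key; [lra|lra|lra|move: yx; rewrite ltr_norml; lra].
Qed.

Lemma disjoint_length n (A B : 'I_n -> R) (U : set R) eta :
  (forall i, A i <= B i) -> trivIset [set: 'I_n] (fun i => `]A i, B i[%classic) ->
  (forall i, `]A i, B i[ `<=` U) -> measurable U ->
  (lebesgue_measure U < eta%:E)%E -> \sum_i (B i - A i) < eta.
Proof.
move=> AB tI sub mU Ueta.
rewrite -lte_fin; apply: le_lt_trans Ueta.
have -> : ((\sum_i (B i - A i))%:E =
    \sum_(i < n) lebesgue_measure (`]A i, B i[%classic : set R))%E.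
  rewrite -sumEFin; apply: eq_bigr => i _; rewrite lebesgue_measure_itv/= lte_fin.
  case: ltP => // BA; have -> : A i = B i by apply/eqP; rewrite eq_le AB.
  by rewrite subrr.
rewrite -measure_semi_additive_ord//=; last exact: bigsetU_measurable.
apply: le_measure; rewrite ?inE//; first exact: bigsetU_measurable.
apply: (big_ind (fun S => S `<=` U)).
- exact: sub0set.
- by move=> S1 S2 h1 h2 t [/h1|/h2].
- by move=> i _; exact: sub.
Qed.

(* Cousin-style covering argument: outside a null set increments over short
   intervals are controlled by the derivative, and the remaining short intervals
   lie in an open set of small measure, where absolute continuity applies. *)
Lemma ac_increment T f (c e a b : R) : 0 <= e -> abs_continuous T f -> 0 <= a -> a <= b -> b <= T ->
  {ae @lebesgue_measure R, forall t : R, a < t < b ->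
     exists2 d, is_derive t (1 : R) f d & `|d - c| <= e} ->
  `|f b - f a - c * (b - a)| <= e * (b - a).
Proof.
move=> e0 acf a0 ab bT [N [mN N0 hN]].
have [->|anb] := eqVneq a b; first by rewrite !subrr !mulr0 subrr normr0.
have {anb}ab' : a < b by rewrite lt_neqAle anb.
(* One slack for the slope, one for the exceptional intervals; both disappear as [eta] tends to
   0. *)
suff main eta : 0 < eta -> `|f b - f a - c * (b - a)| <= (e + eta) * (b - a) + eta.
  apply/ler_addgt0Pr => eps eps0.
  have p0 : 0 < b - a + 1 by lra.
  apply: (le_trans (main (eps / (b - a + 1)) _)); first exact: divr_gt0.
  rewrite mulrDl -addrA lerD2l -{2}[eps / _]mulr1 -mulrDr.
  by rewrite divfK// gt_eqF.
move=> eta0; have e20 : 0 < eta / 2 by exact: divr_gt0.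
have [delta d0 hd] := acf _ e20.
(* Disjoint intervals of total length below [del] change [f] and [c * t] by at most [eta / 2]
   each. *)
pose del := Num.min delta (eta / 2 / (`|c| + 1)).
have c10 : 0 < `|c| + 1 by rewrite ltr_wpDl.
have del0 : 0 < del by rewrite lt_min d0 !divr_gt0.
(* The hypothesis is silent at [a] and [b], so they join the exceptional set. *)
pose Z := N `|` [set a; b].
have mab : measurable [set a; b] by exact: measurableU.
have mZ : measurable Z by exact: measurableU.
have Z0 : lebesgue_measure Z = 0%E.
  apply/eqP; rewrite eq_le measure_ge0 andbT.
  rewrite (le_trans (measureU2 _ _ _))//= N0 add0e.
  by rewrite (le_trans (measureU2 _ _ _))//= !lebesgue_measure_set1 adde0.
have [U [oU ZU Udel]] : exists U : set R, [/\ open U, Z `<=` U & (lebesgue_measure U < del%:E)%E].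
  have Zfin : (lebesgue_measure Z < +oo)%E by rewrite Z0.
  have [U [oU ZU UZ]] := lebesgue_regularity_outer mZ Zfin del0. exists U; split => //; apply: le_lt_trans UZ.
  have mU := measurable_realfun.open_measurable oU.
  rewrite -{1}(setDUK ZU) (le_trans (measureU2 _ _ _))//=; first exact: measurableD.
  by rewrite Z0 add0e.
have mU := measurable_realfun.open_measurable oU.
(* The bound up to [x], with the excess carried by finitely many disjoint intervals inside [U]. By
   [local] and [extend], goodness passes beyond the supremum of the good points unless that is
   [b]. *)
pose Good x := exists n (A B : 'I_n -> R), [/\ forall i, [/\ a <= A i, A i <= B i & B i <= x],
  trivIset [set: 'I_n] (fun i => `]A i, B i[%classic), forall i, `]A i, B i[ `<=` U &
  `|f x - f a - c * (x - a)| <= (e + eta) * (x - a) +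
     \sum_i (`|f (B i) - f (A i)| + `|c| * (B i - A i))].
have local x : a <= x <= b -> exists2 r, 0 < r & forall y z, a <= y -> y <= x -> x <= z ->
    z <= b -> x - r < y -> z < x + r ->
    `]y, z[ `<=` U \/ `|f z - f y - c * (z - y)| <= (e + eta) * (z - y).
  move=> xab; have [Zx|nZx] := pselect (Z x).
    have /(open_subball oU) := ZU _ Zx; move=> /nbhs_ballP[r /= r0 hr].
    have r20 : 0 < r / 2 by exact: divr_gt0.
    have br : ball 0 r (r / 2) by rewrite -ball_normE/= sub0r normrN gtr0_norm//; lra.
    exists (r / 2) => // y z ay yx xz zb xry zxr; left => t /=; rewrite in_itv/= => ytz.
    apply: (hr _ br r20); rewrite -ball_normE/= ltr_norml; lra.
  have axb : a < x < b.
    rewrite !lt_neqAle; move: xab => /andP[-> ->]; rewrite !andbT.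
    by apply/andP; split; apply/eqP => xe; apply: nZx; right; rewrite /= ?xe; [left|right].
  have [d' dd dc] : exists2 d', is_derive x (1 : R) f d' & `|d' - c| <= e.
    have [//|h] := pselect (exists2 d', is_derive x (1 : R) f d' & `|d' - c| <= e).
    by exfalso; apply: nZx; left; apply: hN => /= /(_ axb).
  have [r r0 hr] := is_derive_eps dd eta0; exists r => // y z ay yx xz zb xry zxr; right.
  have hy : `|f y - f x - d' * (y - x)| <= eta * (x - y).
    have := hr (y - x); rewrite [x + _]addrC subrK [`|y - x|]distrC (ger0_norm (_ : 0 <= x - y)) ?subr_ge0//.
    by apply; lra.
  have hz : `|f z - f x - d' * (z - x)| <= eta * (z - x).
    have := hr (z - x); rewrite [x + _]addrC subrK (ger0_norm (_ : 0 <= z - x)) ?subr_ge0//.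
    by apply; lra.
  have hc : `|(d' - c) * (z - y)| <= e * (z - y).
    by rewrite normrM (ger0_norm (_ : 0 <= z - y)) ?ler_wpM2r ?subr_ge0//; lra.
  by move: hy hz hc; rewrite !ler_norml; lra.
have extend y z : a <= y -> y <= z -> z <= b -> Good y ->
    `]y, z[ `<=` U \/ `|f z - f y - c * (z - y)| <= (e + eta) * (z - y) -> Good z.
  move=> ay yz zb [n [A [B [AB tI AU hy]]]] [yzU|hyz]; last first.
    exists n, A, B; split => //; first by move=> i; have [? ? ?] := AB i; split => //; lra.
    have -> : f z - f a - c * (z - a) =
       (f z - f y - c * (z - y)) + (f y - f a - c * (y - a)) by ring.
    by rewrite (le_trans (ler_normD _ _))//; lra.
  pose A' (i : 'I_n.+1) := oapp A y (unlift ord0 i).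
  pose B' (i : 'I_n.+1) := oapp B z (unlift ord0 i).
  exists n.+1, A', B'; split.
  - move=> i; rewrite /A' /B'; case: unliftP => [j _|_] /=; last by split; lra.
    by have [? ? ?] := AB j; split => //; lra.
  - move=> i j _ _; rewrite /A' /B'.
    case: unliftP => [i' ->|->]; case: unliftP => [j' ->|->] //=.
    + by move=> h; congr lift; exact: (tI i' j').
    + move=> [t [/=]]; rewrite !in_itv/= => h1 h2.
      by have [_ _ ?] := AB i'; exfalso; lra.
    + move=> [t [/=]]; rewrite !in_itv/= => h1 h2.
      by have [_ _ ?] := AB j'; exfalso; lra.
  - by move=> i; rewrite /A' /B'; case: unliftP => [j _|_] /=.
  - rewrite big_ord_recl /A' /B' unlift_none/=.
    under eq_bigr do rewrite liftK/=.
    have -> : f z - f a - c * (z - a) =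
       (f z - f y) + (f y - f a - c * (y - a)) - c * (z - y) by ring.
    rewrite (le_trans (ler_normB _ _))// (normrM c) (ger0_norm (_ : 0 <= z - y)) ?subr_ge0//.
    have : (e + eta) * (y - a) <= (e + eta) * (z - a).
      by apply: ler_wpM2l; lra.
    have := ler_normD (f z - f y) (f y - f a - c * (y - a)); lra.
pose S := [set x | a <= x <= b /\ Good x].
have Sa : S a.
  split; first by rewrite lexx ltW.
  exists 0%N, (fun=> 0), (fun=> 0); split => //; try by case.
  by rewrite big_ord0 !subrr !mulr0 subr0 normr0 addr0.
have ubS : has_ubound S by exists b => x [/andP[]].
have supS : has_sup S by split => //; exists a.
pose s := sup S.
have sab : a <= s <= b.
  rewrite ub_le_sup//= ge_sup//; first by exists a.
  by move=> x [/andP[]].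
have [r r0 hr] := local s sab.
have [y [yab Gy] yr] := sup_adherent r0 supS.
have ys : y <= s by apply: ub_le_sup.
pose z := Num.min b (s + r / 2).
have r20 : 0 < r / 2 by exact: divr_gt0.
have rr : r / 2 + r / 2 = r by rewrite -splitr.
have sz : s <= z by rewrite le_min; apply/andP; split; lra.
have zb : z <= b by rewrite ge_min lexx.
have zr : z < s + r by apply: (@le_lt_trans _ _ (s + r / 2)); [rewrite ge_min lexx orbT|lra].
have Gz : Good z.
  apply: (extend y) => //; [lra|lra|].
  by apply: hr => //; lra.
have zs : z <= s by apply: ub_le_sup => //; split => //; lra.
have zE : z = b.
  move: zs; rewrite /z; case: (leP b (s + r / 2)) => // _; lra.
move: Gz; rewrite zE => -[n [A [B [AB tI AU hb]]]].
apply: (le_trans hb); rewrite lerD2l big_split/= -mulr_sumr.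
have AB' i : A i <= B i by have [] := AB i.
have len := disjoint_length AB' tI AU mU Udel.
have h1 : \sum_i `|f (B i) - f (A i)| < eta / 2.
  apply: hd => //.
    by move=> i; have [? ? ?] := AB i; split; lra.
  by apply: (lt_le_trans len); rewrite ge_min lexx.
have h2 : `|c| * \sum_i (B i - A i) <= eta / 2.
  have l0 : 0 <= \sum_i (B i - A i) by apply: sumr_ge0 => i _; rewrite subr_ge0.
  apply: (@le_trans _ _ ((`|c| + 1) * del)).
    by rewrite ler_pM ?lerDl// ltW.
  rewrite -ler_pdivlMl// mulrC.
  by rewrite ge_min lexx orbT.
by rewrite (le_trans (lerD (ltW h1) h2))// -splitr.
Qed.

(** Near [t] the derivative is almost everywhere close to [g t], and [ac_increment] turns this into
    a bound on all increments. This makes the almost everywhere equations classical. *)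
Lemma ac_is_derive T f g : abs_continuous T f ->
  {ae @lebesgue_measure R, forall t : R, t \in `]0, T[ -> is_derive t (1 : R) f (g t)} ->
  (forall t, 0 < t < T -> {for t, continuous g}) ->
  forall t, 0 < t < T -> is_derive t (1 : R) f (g t).
Proof.
move=> acf df cg t tT; apply: eps_is_derive => eta eta0.
have /cvgrPdist_le/(_ _ eta0)/nbhs_ballP[r /= r0 hr] := cg t tT.
pose rr := Num.min r (Num.min t (T - t)).
exists rr; first by rewrite !lt_min r0 subr_gt0.
have key a b : `|a - t| < rr -> `|b - t| < rr -> a <= b ->
    `|f b - f a - g t * (b - a)| <= eta * (b - a).
  rewrite /rr !lt_min !ltr_norml => /and3P[a1 a2 a3] /and3P[b1 b2 b3] ab.
  apply: (ac_increment (ltW eta0) acf) => //; [lra|lra|].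
  move: df; apply: negligibleS => x /= nQ hx; apply: nQ => axb; exists (g x); first by apply: hx; rewrite in_itv/=; lra.
  rewrite distrC; apply: hr; rewrite -ball_normE/= distrC ltr_norml; lra.
have rr0 : 0 < rr by rewrite !lt_min r0 subr_gt0.
move=> h hr'; have [h0|/ltW h0] := leP 0 h.
  have e1 : t + h - t = h by ring.
  have := key t (t + h); rewrite e1 subrr normr0 lerDl (ger0_norm h0).
  by move: hr'; rewrite ger0_norm// => hr' /(_ rr0 hr' h0).
have e1 : t + h - t = h by ring.
have e2 : t - (t + h) = - h by ring.
have := key (t + h) t; rewrite e1 e2 subrr normr0 gerDl (ler0_norm h0).
move: hr'; rewrite ler0_norm// => hr' /(_ hr' rr0 h0) hh.
rewrite -normrN; apply: le_trans hh; rewrite le_eqVlt; apply/orP; left; apply/eqP.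
by congr `|_|; ring.
Qed.

End AbsCont.

(** * The forcing *)

Section TrigSeries.
Context (R : realType).
Implicit Types (a b : nat -> R) (c M w t x d : R).

Lemma exp_series (u : nat -> R) M c : 0 < c ->
  (forall k, `|u k| <= M * expR (- (c * k%:R))) ->
  cvgn (series u) /\ forall n, `|series u n| <= M / (1 - expR (- c)).
Proof.
move=> c0 hu; set q := expR (- c).
have q0 : 0 < q by exact: expR_gt0.
have q1 : q < 1 by rewrite expR_lt1 oppr_lt0.
have hg k : `|u k| <= geometric M q k.
  by rewrite /= -expRM_natr mulNr.
have cg : cvgn (series (geometric M q)) by apply: is_cvg_geometric_series; rewrite gtr0_norm.
have M0 : 0 <= M.
  by have := hg 0%N; rewrite /= expr0 mulr1; apply: le_trans.
split.
  apply: normed_cvg; apply: series_le_cvg hg cg => // k.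
  by rewrite mulr_ge0// exprn_ge0// ltW.
move=> n; rewrite /series/= (le_trans (ler_norm_sum _ _ _))//.
apply: (@le_trans _ _ (series (geometric M q) n)).
  by rewrite /series/=; apply: ler_sum => k _; exact: hg.
rewrite geometric_seriesE ?lt_eqF//.
by apply: ler_wpM2r; [rewrite invr_ge0; lra|rewrite ler_piMr// gerBl exprn_ge0// ltW].
Qed.

(** Half of the decay pays for the factor [k]. A time derivative brings down one such factor, so
    each differentiation halves the rate. *)
Lemma natmul_expN c k : 0 < c ->
  k%:R * expR (- (c * k%:R)) <= 2 / c * expR (- (c / 2 * k%:R)).
Proof.
move=> c0.
have e : c * k%:R = c / 2 * k%:R + c / 2 * k%:R by field.
rewrite {1}e opprD expRD mulrA; apply: ler_wpM2r; first exact: expR_ge0.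
rewrite expRN ler_pdivrMr ?expR_gt0// -ler_pdivrMl ?divr_gt0//.
rewrite invf_div mulrC; apply: le_trans (expR_ge1Dx _).
by rewrite mulrC ltW// -subr_gt0 addrK.
Qed.

Lemma first_order (f f' : R -> R) x d :
  (forall y, is_derive y (1 : R) f (f' y)) ->
  (forall y z, `|f' y - f' z| <= `|y - z|) ->
  `|f (x + d) - f x - d * f' x| <= d ^+ 2.
Proof.
move=> df lf; pose g y := f y - f' x * y.
have dg y : is_derive y (1 : R) g (f' y - f' x).
  have := df y => ?.
  have h := is_deriveZ (f' x) (is_derive_id y (1 : R)).
  have := is_deriveB (df y) h.
  by rewrite /GRing.scale/= mulr1.
have cg (A : interval R) : {within [set` A], continuous g}.
  by apply: derivable_within_continuous => y _; have := dg y => ?; exact: ex_derive.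
have [d0|/ltW d0] := leP 0 d.
  have := @increment_bound R g (fun y => f' y - f' x) x (x + d) d.
  rewrite lerDl => /(_ d0 (cg _)) h.
  have -> : f (x + d) - f x - d * f' x = g (x + d) - g x by rewrite /g; ring.
  have -> : d ^+ 2 = d * (x + d - x) by ring.
  apply: h => // y xy; rewrite (le_trans (lf _ _))// ler_norml; lra.
have := @increment_bound R g (fun y => f' y - f' x) (x + d) x (- d).
rewrite gerDl => /(_ d0 (cg _)) h.
have -> : f (x + d) - f x - d * f' x = - (g x - g (x + d)) by rewrite /g; ring.
have -> : d ^+ 2 = - d * (x - (x + d)) by ring.
rewrite normrN; apply: h => // y xy; rewrite (le_trans (lf _ _))// ler_norml; lra.
Qed.

Lemma cos_lip (x y : R) : `|cos x - cos y| <= `|x - y|.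
Proof.
have := sin_lip (x + pi / 2) (y + pi / 2); rewrite !sinDpihalf.
by have -> : x + pi / 2 - (y + pi / 2) = x - y by ring.
Qed.

Definition tterm a b w t j :=
  a j * cos (j%:R * w * t) + b j * sin (j%:R * w * t).

Definition tsum a b w t : R := limn (series (tterm a b w t)).

Lemma tterm_bound a b w t j M : `|a j| <= M -> `|b j| <= M -> `|tterm a b w t j| <= 2 * M.
Proof.
move=> ha hb; rewrite /tterm (le_trans (ler_normD _ _))// !normrM mulr2n mulrDl !mul1r.
have c1 (z : R) : `|cos z| <= 1 by rewrite ler_norml cos_geN1 cos_le1.
have s1 (z : R) : `|sin z| <= 1 by rewrite ler_norml sin_geN1 sin_le1.
by rewrite lerD// (le_trans (ler_wpM2l _ (c1 _)), le_trans (ler_wpM2l _ (s1 _))) ?mulr1.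
Qed.

Lemma weighted_bound (v : nat -> R) w M c : 0 < c -> 0 <= M ->
  (forall j, `|v j| <= M * expR (- (c * j%:R))) ->
  forall j, `|j%:R * w * v j| <= `|w| * (M * (2 / c)) * expR (- (c / 2 * j%:R)).
Proof.
move=> c0 M0 hv j; rewrite !normrM normr_nat.
have h1 := ler_wpM2l (ler0n R j) (hv j).
have h2 := ler_wpM2l M0 (natmul_expN j c0).
have -> : j%:R * `|w| * `|v j| = `|w| * (j%:R * `|v j|) by ring.
rewrite -[leRHS]mulrA; apply: ler_wpM2l => //; rewrite -[leRHS]mulrA.
by apply: le_trans h2; rewrite mulrCA.
Qed.

(** Termwise differentiation by a direct estimate: the remainder of term [j] is of order [j^2 * h^2]
    times its coefficients, and the sum is at most [D * h^2]. Absorbing two factors [j] lowers the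
    rate to [c / 4]. *)
Lemma tsum_is_derive a b w t M c : 0 < c ->
  (forall j, `|a j| <= M * expR (- (c * j%:R))) ->
  (forall j, `|b j| <= M * expR (- (c * j%:R))) ->
  is_derive t (1 : R) (tsum a b w)
    (tsum (fun j => j%:R * w * b j) (fun j => - (j%:R * w * a j)) w t).
Proof.
move=> c0 ha hb.
have M0 : 0 <= M by have := ha 0%N; rewrite mulr0 oppr0 expR0 mulr1; apply: le_trans.
pose a' j := j%:R * w * b j; pose b' j := - (j%:R * w * a j).
pose M' := `|w| * (M * (2 / c)).
have c20 : 0 < c / 2 by exact: divr_gt0.
have hw (v : nat -> R) := weighted_bound w c0 M0 (v := v).
have ha' : forall j, `|a' j| <= M' * expR (- (c / 2 * j%:R)) by exact: hw.
have hb' j : `|b' j| <= M' * expR (- (c / 2 * j%:R)) by rewrite normrN; exact: hw.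
have cv s : cvgn (series (tterm a b w s)).
  apply: (proj1 (@exp_series _ (2 * M) c c0 _)) => j.
  by rewrite -[leRHS]mulrA; exact: tterm_bound.
have cv' s : cvgn (series (tterm a' b' w s)).
  apply: (proj1 (@exp_series _ (2 * M') (c / 2) c20 _)) => j.
  by rewrite -[leRHS]mulrA; exact: tterm_bound.
pose M2 := `|w| * (M' * (2 / (c / 2))).
have c40 : 0 < c / 2 / 2 by exact: divr_gt0.
pose D := 2 * M2 / (1 - expR (- (c / 2 / 2))).
have D0 : 0 <= D.
  apply: divr_ge0; first by rewrite !mulr_ge0 ?invr_ge0 ?(ltW c0)// ?divr_ge0 ?(ltW c0).
  by rewrite subr_ge0 expR_le1 oppr_le0 ltW.
have key h : `|tsum a b w (t + h) - tsum a b w t - h * tsum a' b' w t| <= D * h ^+ 2.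
  pose u n := series (tterm a b w (t + h)) n - series (tterm a b w t) n -
    h * series (tterm a' b' w t) n.
  have hu : u n @[n --> \oo] --> tsum a b w (t + h) - tsum a b w t - h * tsum a' b' w t.
    by apply: cvgB; [apply: cvgB; exact: cv|apply: cvgMr; exact: cv'].
  apply: (@cvgr_to_le _ _ _ R (fun n => `|u n|) _ _ (cvg_norm hu)).
  apply: nearW => n.
  pose r j := tterm a b w (t + h) j - tterm a b w t j - h * tterm a' b' w t j.
  have -> : u n = series r n.
    by rewrite /u /series/= mulr_sumr -!sumrB.
  have hr j : `|r j| <= h ^+ 2 * (2 * M2) * expR (- (c / 2 / 2 * j%:R)).
    have -> : r j = a j * (cos (j%:R * w * t + j%:R * w * h) - cos (j%:R * w * t)
          - (j%:R * w * h) * - sin (j%:R * w * t))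
        + b j * (sin (j%:R * w * t + j%:R * w * h) - sin (j%:R * w * t)
          - (j%:R * w * h) * cos (j%:R * w * t)).
      by rewrite /r /tterm /a' /b' [_ * w * (t + h)]mulrDr; ring.
    have sl (y z : R) : `|- sin y - - sin z| <= `|y - z|.
      by rewrite -opprD normrN; exact: sin_lip.
    have f1 := @first_order cos (fun y => - sin y) (j%:R * w * t) (j%:R * w * h)
      (@is_derive_cos R) sl.
    have f2 := @first_order sin cos (j%:R * w * t) (j%:R * w * h) (@is_derive_sin R) cos_lip.
    have hj (v : nat -> R) : `|v j| <= M * expR (- (c * j%:R)) ->
        `|v j| * (j%:R * w * h) ^+ 2 <= h ^+ 2 * M2 * expR (- (c / 2 / 2 * j%:R)).
      move=> hv.
      have h1 := ler_wpM2l (ler0n R j) hv.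
      have h2 := ler_wpM2l M0 (natmul_expN j c0).
      have p2 : 0 <= M * (2 / c) by rewrite mulr_ge0// divr_ge0// ltW.
      have h3 := ler_wpM2l p2 (natmul_expN j c20).
      have h4 : j%:R * `|v j| <= M * (2 / c) * expR (- (c / 2 * j%:R)).
        by rewrite -mulrA; apply: le_trans h2; rewrite mulrCA.
      have h5 := le_trans (ler_wpM2l (ler0n R j) h4) (le_trans _ h3).
      have {}h5 := h5 ltac:(by rewrite mulrCA).
      have -> : `|v j| * (j%:R * w * h) ^+ 2 = h ^+ 2 * w ^+ 2 * (j%:R * (j%:R * `|v j|)) by ring.
      have -> : h ^+ 2 * M2 * expR (- (c / 2 / 2 * j%:R)) = h ^+ 2 * `|w| ^+ 2 *
          (M * (2 / c) * (2 / (c / 2) * expR (- (c / 2 / 2 * j%:R)))).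
        by rewrite /M2 /M'; ring.
      rewrite real_normK ?num_real//; apply: ler_wpM2l => //.
      by rewrite mulr_ge0 ?sqr_ge0.
    rewrite (le_trans (ler_normD _ _))// !normrM.
    have := le_trans (ler_wpM2l (normr_ge0 (a j)) f1) (hj a (ha j)).
    have := le_trans (ler_wpM2l (normr_ge0 (b j)) f2) (hj b (hb j)).
    lra.
  have := proj2 (exp_series c40 hr) n; rewrite /D => /le_trans; apply.
  by rewrite le_eqVlt; apply/orP; left; apply/eqP; ring.
apply: eps_is_derive => eta eta0.
exists (eta / (D + 1)); first by rewrite divr_gt0// ltr_wpDl.
move=> h hh; rewrite [_ * h]mulrC (le_trans (key h))// -real_normK ?num_real// expr2 mulrA.
apply: ler_wpM2r => //; rewrite ltr_pdivlMr ?ltr_wpDl// in hh.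
by rewrite (le_trans _ (ltW hh))// mulrC ler_wpM2l// lerDl.
Qed.

Lemma tsum_smooth (I : Type) (a b : I -> nat -> R) w T n M c : 0 < c -> 0 <= M ->
  (forall i j, `|a i j| <= M * expR (- (c * j%:R))) ->
  (forall i j, `|b i j| <= M * expR (- (c * j%:R))) ->
  smooth T n (fun i t => tsum (a i) (b i) w t).
Proof.
elim: n a b M c => [|n IH] a b M c c0 M0 ha hb.
  split => //; exists (2 * M / (1 - expR (- c))) => i t _.
  have h j : `|tterm (a i) (b i) w t j| <= 2 * M * expR (- (c * j%:R)).
    by rewrite -[leRHS]mulrA; exact: tterm_bound.
  have [cv bd] := exp_series c0 h.
  apply: (@cvgr_to_le _ _ _ R (fun n => `|series (tterm (a i) (b i) w t) n|) _ _ (cvg_norm cv)).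
  exact: nearW.
have bd := smooth_bounded (IH a b M c c0 M0 ha hb).
split => //; exists (fun i t => tsum (fun j => j%:R * w * b i j)
    (fun j => - (j%:R * w * a i j)) w t).
  by move=> i t _; exact: (tsum_is_derive _ _ c0 (ha i) (hb i)).
have c20 : 0 < c / 2 by exact: divr_gt0.
apply: (IH _ _ (`|w| * (M * (2 / c))) (c / 2)) => // [|i j|i j].
- by rewrite mulr_ge0// mulr_ge0// divr_ge0// ltW.
- exact: weighted_bound.
- by rewrite normrN; exact: weighted_bound.
Qed.

End TrigSeries.

(** * The random Fourier series as a trigonometric series with geometric coefficients *)

Section Forcing.
Context (R : realType).
Implicit Types (T t x : R).

Lemma Rintegral_is_derive (f F : R -> R) (a b : R) : a < b ->
  (forall x, is_derive x (1 : R) F (f x)) -> continuous f ->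
  \int[@lebesgue_measure R]_(x in `[a, b]) f x = F b - F a.
Proof.
move=> ab dF cf.
have cF x : {for x, continuous F}.
  by apply/differentiable_continuous/derivable1_diffP; have := dF x => ?; exact: ex_derive.
rewrite /Rintegral (@continuous_FTC2 _ f F)//.
- exact: continuous_subspaceT.
- split.
  + by move=> x _; have := dF x => ?; exact: ex_derive.
  + by apply: cvg_at_right_filter; exact: cF.
  + by apply: cvg_at_left_filter; exact: cF.
- by move=> x _; have := dF x => ?; rewrite derive1E derive_val.
Qed.

Lemma sin_int_2pi (k : int) : sin (k%:~R * (2 * pi)) = 0 :> R.
Proof.
have h n : sin (n%:R * (2 * pi)) = 0 :> R.
  elim: n => [|n IH]; first by rewrite mul0r sin0.
  have e : 2 * pi = pi *+ 2 :> R by rewrite mulr_natl.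
  by rewrite -natr1 mulrDl mul1r {2}e sinD2pi.
case: k => n; first exact: h.
by rewrite NegzE mulrNz mulNr sinN h oppr0.
Qed.

(** The value is [2 * pi] for [k = 0] and [pi] otherwise; the lower bound bounds all normalising
    constants by [1 / sqrt pi]. *)
Lemma fourier_norm (k : int) :
  pi <= \int[@lebesgue_measure R]_(x in `[0%R, 2 * pi]) (fourier_wave k x ^+ 2) :> R.
Proof.
have pi0 := pi_gt0 R; have ab : 0 < 2 * pi :> R by rewrite mulr_gt0.
have ident (c : R) x : is_derive x (1 : R) (fun x => c * x) c.
  by have := is_deriveZ c (is_derive_id x (1 : R)); rewrite /GRing.scale/= mulr1.
pose K : R := k%:~R.
have dK (x : R) := ident K x.
have dsin x : is_derive x (1 : R) (fun x => sin (K * x)) (cos (K * x) * K).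
  exact: (@is_derive1_comp _ sin (fun x => K * x)).
have dcos x : is_derive x (1 : R) (fun x => cos (K * x)) (- sin (K * x) * K).
  exact: (@is_derive1_comp _ cos (fun x => K * x)).
have cont (f f' : R -> R) : (forall x, is_derive x (1 : R) f (f' x)) ->
    continuous (fun x => f x ^+ 2).
  move=> df x; apply: (@continuous_comp _ _ _ f (fun y => y ^+ 2)).
    by apply/differentiable_continuous/derivable1_diffP; have := df x => ?; exact: ex_derive.
  exact: exprn_continuous.
have dsc x : is_derive x (1 : R) (fun x => sin (K * x) * cos (K * x))
    (K * (cos (K * x) ^+ 2 - sin (K * x) ^+ 2)).
  have := is_deriveM (dsin x) (dcos x); rewrite /GRing.scale/=.
  by congr is_derive; ring.
have cos2E x : cos (K * x) ^+ 2 = 1 - sin (K * x) ^+ 2.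
  by rewrite -(cos2Dsin2 (K * x)) addrK.
have sin2E x : sin (K * x) ^+ 2 = 1 - cos (K * x) ^+ 2.
  by rewrite -(cos2Dsin2 (K * x)) addrC addKr.
rewrite /fourier_wave; have [k0|k0] := leP 0 k; last first.
  have Kn : K != 0 by rewrite intr_eq0 lt_eqF.
  have dF x : is_derive x (1 : R)
      (fun x => 2^-1 * x - (2 * K)^-1 * (sin (K * x) * cos (K * x))) (sin (K * x) ^+ 2).
    have := is_deriveB (ident 2^-1 x) (is_deriveZ (2 * K)^-1 (dsc x)).
    rewrite /GRing.scale/=; congr is_derive.
    by rewrite cos2E; field.
  rewrite (Rintegral_is_derive ab dF (cont _ _ dsin)).
  rewrite !mulr0 sin0 mul0r mulr0 !subr0 sin_int_2pi mul0r mulr0 subr0.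
  by rewrite mulrA mulVf// mul1r.
have [kz|kn] := eqVneq k 0.
  have dF x : is_derive x (1 : R) (fun x => 1 * x) (cos (K * x) ^+ 2).
    by have := ident 1 x; rewrite /K kz mul0r cos0 expr1n.
  rewrite (Rintegral_is_derive ab dF (cont _ _ dcos)).
  by rewrite !mul1r subr0 mulr2n mulrDl mul1r lerDl ltW.
have Kn : K != 0 by rewrite intr_eq0.
have dF x : is_derive x (1 : R)
    (fun x => 2^-1 * x + (2 * K)^-1 * (sin (K * x) * cos (K * x))) (cos (K * x) ^+ 2).
  have := is_deriveD (ident 2^-1 x) (is_deriveZ (2 * K)^-1 (dsc x)).
  rewrite /GRing.scale/=; congr is_derive.
  by rewrite sin2E; field.
rewrite (Rintegral_is_derive ab dF (cont _ _ dcos)).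
rewrite !mulr0 sin0 mul0r mulr0 addr0 subr0 sin_int_2pi mul0r mulr0 addr0.
by rewrite mulrA mulVf// mul1r.
Qed.

Lemma fourier_const_itv (k : int) : 0 <= fourier_const R k <= (Num.sqrt pi)^-1.
Proof.
have p0 : 0 < Num.sqrt pi :> R by rewrite sqrtr_gt0 pi_gt0.
have h : Num.sqrt pi <= Num.sqrt (\int[@lebesgue_measure R]_(x in `[0%R, 2 * pi])
               (fourier_wave k x ^+ 2)) by apply: ler_wsqrtr; exact: fourier_norm.
rewrite /fourier_const invr_ge0 sqrtr_ge0/= lef_pV2// posrE//.
exact: lt_le_trans h.
Qed.

Definition fcos (alpha y : int -> R) (j : nat) : R := y j * alpha j * fourier_const R j.
(** The coefficient of frequency [j] comes from the index [-j], which is [Negz j'] for [j = j' + 1];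
    the sign is that of [sin (- x) = - sin x]. *)
Definition fsin (alpha y : int -> R) (j : nat) : R :=
  if j is j'.+1 then - (y (Negz j') * alpha (Negz j') * fourier_const R (Negz j')) else 0.

Lemma sum_int_sym (G : int -> R) n :
  \sum_(i < n.*2.+1) G (i%:Z - n%:Z) =
  \sum_(0 <= j < n.+1) (G j + if j is j'.+1 then G (Negz j') else 0).
Proof.
elim: n => [|n IH].
  by rewrite big_ord_recl big_ord0 big_nat1 subr0.
rewrite big_nat_recr//= -IH doubleS big_ord_recl big_ord_recr/=.
have -> : \sum_(i < n.*2.+1) G ((nat_of_ord (lift ord0 (widen_ord (leqnSn n.*2.+1) i)))%:Z - n.+1%:Z) =
    \sum_(i < n.*2.+1) G (i%:Z - n%:Z).
  by apply: eq_bigr => i _; congr G; rewrite /= /bump /=; lia.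
rewrite addrCA [G n.+1%:Z + _]addrC; congr (_ + (G _ + G _)); rewrite /= ?/bump /=; lia.
Qed.

Lemma forcing_tsum T (alpha y : int -> R) t :
  cvgn (series (tterm (fcos alpha y) (fsin alpha y) (2 * pi / T) t)) ->
  forcing T alpha y t = tsum (fcos alpha y) (fsin alpha y) (2 * pi / T) t.
Proof.
set s := series _ => cs; rewrite /tsum /forcing; apply/cvg_lim => //.
(* Indices [-n <= k <= n] give the [n + 1] frequencies [0, ..., n], hence the shift by one. *)
have -> : (fun n : nat => \sum_(i < n.*2.+1)
    (let k := i%:Z - n%:Z in
     y k * alpha k * fourier_basis k (2 * pi * t / T))) = [sequence s n.+1]_n.
  apply/funext => n.
  rewrite (sum_int_sym (fun k => y k * alpha k * fourier_basis k (2 * pi * t / T))).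
  rewrite /s /series/=; apply: eq_bigr => -[|j] _.
    rewrite /tterm /fsin mul0r /fcos /fourier_basis /fourier_wave lexx.
    by rewrite !mul0r -!mulrA.
  rewrite /tterm /fcos /fsin /fourier_basis /fourier_wave/=.
  have -> : Negz j = - j.+1%:Z by [].
  have e : j.+1%:R * (2 * pi / T) * t = j.+1%:R * (2 * pi * t / T) by ring.
  rewrite e mulrNz mulNr sinN -pmulrn; ring.
by rewrite cvg_shiftS.
Qed.

Lemma forcing_bounds (I : Type) (alpha : int -> R) (y : I -> int -> R) (Calpha ell : R) :
  0 < Calpha -> (forall i k, -1 <= y i k <= 1) ->
  (forall k, 0 <= alpha k <= Calpha * expR (- (`|k|%N%:R * ell))) ->
  (forall i j, `|fcos alpha (y i) j| <= Calpha * (Num.sqrt pi)^-1 * expR (- (ell * j%:R))) /\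
  (forall i j, `|fsin alpha (y i) j| <= Calpha * (Num.sqrt pi)^-1 * expR (- (ell * j%:R))).
Proof.
move=> C0 hy ha.
have key i k j : `|k|%N = j ->
    `|y i k * alpha k * fourier_const R k| <= Calpha * (Num.sqrt pi)^-1 * expR (- (ell * j%:R)).
  move=> kj; have /andP[f0 f1] := fourier_const_itv k; have /andP[a0 a1] := ha k.
  rewrite !normrM (ger0_norm f0) (ger0_norm a0) -[leRHS]mulrA [_^-1 * _]mulrC mulrA.
  have y1 : `|y i k| <= 1 by rewrite ler_norml.
  apply: ler_pM => //; first by rewrite mulr_ge0.
  rewrite -[leRHS]mul1r; apply: ler_pM => //.
  by rewrite -kj [ell * _]mulrC.
split => i j; first exact: key.
case: j => [|j] /=; last by rewrite normrN; apply: key.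
by rewrite normr0 !mulr_ge0 ?expR_ge0 ?invr_ge0 ?sqrtr_ge0// ltW.
Qed.

Lemma forcing_smooth (I : Type) T S n (alpha : int -> R) (y : I -> int -> R) (Calpha ell : R) :
  0 < Calpha -> 0 < ell -> (forall i k, -1 <= y i k <= 1) ->
  (forall k, 0 <= alpha k <= Calpha * expR (- (`|k|%N%:R * ell))) ->
  smooth S n (fun i t => forcing T alpha (y i) t) /\
  forall i, continuous (forcing T alpha (y i)).
Proof.
move=> C0 l0 hy ha; have [hc hs] := forcing_bounds C0 hy ha.
have M0 : 0 <= Calpha * (Num.sqrt pi)^-1 by rewrite mulr_ge0 ?invr_ge0 ?sqrtr_ge0// ltW.
have E : (fun i t => forcing T alpha (y i) t) =
    (fun i t => tsum (fcos alpha (y i)) (fsin alpha (y i)) (2 * pi / T) t).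
  apply/funext => i; apply/funext => t; apply: forcing_tsum.
  apply: (proj1 (@exp_series _ _ (2 * (Calpha * (Num.sqrt pi)^-1)) ell l0 _)) => j.
  by rewrite -[leRHS]mulrA; exact: tterm_bound.
split; first by rewrite E; exact: tsum_smooth l0 M0 hc hs.
move=> i t; have -> : forcing T alpha (y i) =
    tsum (fcos alpha (y i)) (fsin alpha (y i)) (2 * pi / T) by exact: (congr1 (@^~ i) E).
apply/differentiable_continuous/derivable1_diffP.
by have := tsum_is_derive (2 * pi / T) t l0 (hc i) (hs i) => ?; exact: ex_derive.
Qed.

End Forcing.

(** * Integrals and point values *)

Section IntegralBounds.
Local Open Scope ereal_scope.
Import HBNNSimple measurable_realfun.
Context (R : realType).

(* No measurability of the integrand: the integral of a nonnegative function is
   a supremum over the simple functions below it. *)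
Lemma integral_le_cst (d : measure_display) (T : measurableType d)
    (mu : {measure set T -> \bar R}) (D : set T) (f : T -> \bar R) (c : R) :
  measurable D -> (0 <= c)%R -> (forall x, 0 <= f x) ->
  (forall x, D x -> f x <= c%:E) -> \int[mu]_(x in D) f x <= c%:E * mu D.
Proof.
move=> mD c0 f0 fc; rewrite ge0_integralE//.
apply: ge_ereal_sup => _ [h hf <-].
rewrite -integralT_nnsfun -(integral_cst mu mD) [leRHS]integral_mkcond.
have mh : measurable_fun [set: T] (EFin \o h : T -> \bar R).
  by apply/measurable_EFinP; exact: measurable_funTS.
have mc : measurable_fun [set: T] ((cst c%:E : T -> \bar R) \_ D).
  by apply/(measurable_restrictT _ mD).1; exact: measurable_cst.
apply: (@ge0_le_integral _ _ _ mu setT measurableT (EFin \o h) _ _ mh mc) => [x _|x _].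
  by rewrite /= lee_fin fun_ge0.
have := hf x; rewrite !patchE /=; case: ifPn => // xD hx.
  by rewrite (le_trans hx)// fc//; exact: set_mem.
Qed.

(** [f] is controlled only on the image of [X], which may fail to be measurable; the simple
    functions below [f] are measurable, so the pushforward formula applies to them. *)
Lemma integral_distribution_le (d d' : measure_display) (Omega : measurableType d)
    (S : measurableType d') (P : probability Omega R) (X : {mfun Omega >-> S})
    (f : S -> \bar R) (c : R) : (forall x, 0 <= f x) -> (0 <= c)%R ->
  (forall w, f (X w) <= c%:E) -> \int[distribution P X]_x f x <= c%:E.
Proof.
move=> f0 c0 fc; rewrite ge0_integralTE//.
apply: ge_ereal_sup => _ [h hf <-].
rewrite -integralT_nnsfun ge0_integral_pushforward//=; last 2 first.
- by apply/measurable_EFinP; exact: measurable_funTS.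
- by move=> y _; rewrite lee_fin fun_ge0.
have : \int[P]_(w in X @^-1` setT) (EFin \o h \o X) w <= c%:E * P setT.
  rewrite preimage_setT; apply: integral_le_cst => //.
    by move=> w; rewrite lee_fin fun_ge0.
  by move=> w _; apply: le_trans (fc w); exact: hf.
by rewrite probability_setT mule1.
Qed.

End IntegralBounds.

(** * Point values of classes in L^2 *)

Section L2Eval.
Context (R : realType) (T : R).

Lemma leb0T_ae (Q : R -> Prop) : {ae leb0T T, forall t, Q t} ->
  {ae @lebesgue_measure R, forall t, t \in `]0, T[ -> Q t}.
Proof.
move=> [N [mN N0 hN]]; exists (N `&` `[0%R, T]); split.
- exact: measurableI.
- exact: N0.
- move=> t /= h; have [tT|tT] := boolP (t \in `]0, T[); last by exfalso; apply: h => /(negP tT).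
  split; first by apply: hN => /= Qt; apply: h.
  by move: tT; rewrite /= !in_itv/= => /andP[/ltW -> /ltW ->].
Qed.

(** [xget] picks some function continuous on [0,T] and almost everywhere equal to [f]; a difference
    at an interior point would persist on an interval, which has positive measure. *)
Lemma L2_eval_continuous (u : L2 T) (f : R -> R) t : continuous f ->
  {ae leb0T T, forall s, u s = f s} -> 0 < t < T -> L2_eval u t = f t.
Proof.
move=> cf uf tT; rewrite /L2_eval.
set S := [set f : R -> R | _]; have [cg ug] : S (xget (u : R -> R) S).
  by apply: xgetPex; exists f; split => //; exact: continuous_subspaceT.
move: (xget _ _) cg ug => {}g cg ug.
apply/eqP; apply: contrapT => /negP gf.
have e0 : 0 < `|g t - f t| / 2 by rewrite divr_gt0// normr_gt0 subr_eq0.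
have tT' : `[0, T]%classic t by rewrite /= in_itv/=; lra.
have /subspace_continuousP/(_ _ tT')/cvgrPdist_lt/(_ _ e0)/nbhs_ballP[r1 /= r10 h1] := cg.
have /cvgrPdist_lt/(_ _ e0)/nbhs_ballP[r2 /= r20 h2] := cf t.
pose r := Num.min (Num.min r1 r2) (Num.min t (T - t)).
have r0 : 0 < r by rewrite !lt_min r10 r20 subr_gt0.
have neq s : `|s - t| < r -> (0 < s < T) /\ g s <> f s.
  rewrite !lt_min => /andP[/andP[s1 s2] /andP[]]; rewrite !ltr_norml => s3 s4.
  have sT : 0 < s < T by lra.
  split => // gs.
  have b1 : ball t r1 s by rewrite -ball_normE/= distrC.
  have b2 : ball t r2 s by rewrite -ball_normE/= distrC.
  have := h1 s b1; rewrite /= in_itv/= => /(_ ltac:(lra)) k1.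
  have k2 := h2 s b2; rewrite /from_subspace /= gs in k1.
  have := ler_normB (g t - f s) (f t - f s).
  by rewrite opprB addrA subrK; lra.
have [N [mN N0 hN]] : {ae @lebesgue_measure R, forall s, s \in `]0, T[ -> g s = f s}.
  have [N1 [m1 z1 s1]] := leb0T_ae uf; have [N2 [m2 z2 s2]] := leb0T_ae ug.
  exists (N1 `|` N2); split; first exact: measurableU.
    apply/eqP; rewrite eq_le measure_ge0 andbT.
    by rewrite (le_trans (measureU2 _ _ _))//= z1 z2 adde0.
  move=> s /= h; apply: contrapT => /not_orP[n1 n2]; apply: h => sT.
  have a1 : u s = f s by apply: contrapT => a; apply: n1; apply: s1 => /= /(_ sT).
  have a2 : u s = g s by apply: contrapT => a; apply: n2; apply: s2 => /= /(_ sT).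
  by rewrite -a1 -a2.
pose J : set R := `]t - r, t + r[%classic.
have sub : J `<=` N.
  move=> s; rewrite /J /= in_itv/= => st; apply: hN => /= h.
  have [sT ng] := neq s ltac:(by rewrite ltr_norml; lra).
  by apply: ng; apply: h; rewrite in_itv.
have : (lebesgue_measure J <= lebesgue_measure N)%E.
  by apply: le_measure; rewrite ?inE//; exact: measurable_itv.
have tr : t - r < t + r by lra.
by rewrite N0 /J lebesgue_measure_itv/= lte_fin tr -EFinD lee_fin; lra.
Qed.

End L2Eval.

(** * The DeepONet *)

Section PendulumSmooth.
Context (R : realType).

Lemma within_itv_continuous (T : R) (f : R -> R) t :
  {within `[0, T], continuous f} -> 0 < t < T -> {for t, continuous f}.
Proof.
move=> cf tT; have T0 : 0 < T by lra.
by have /(continuous_within_itvP _ T0)[h _ _] := cf; apply: h; rewrite in_itv.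
Qed.

(** Since the sine is bounded, the equations bound [v2] and then [v1] directly, without a Gronwall
    argument. Smoothness is a bootstrap: each order of [v1], [v2] and [u] yields the next one of
    [v1] and [v2]. *)
Lemma pendulum_smooth (I : Type) (T gamma : R) (v1 v2 u : I -> R -> R) :
  0 < T ->
  (forall i, {within `[0, T], continuous (v1 i)}) ->
  (forall i, {within `[0, T], continuous (v2 i)}) ->
  (forall i, v1 i 0 = 0) -> (forall i, v2 i 0 = 0) ->
  (forall i t, 0 < t < T -> is_derive t 1 (v1 i) (v2 i t)) ->
  (forall i t, 0 < t < T -> is_derive t 1 (v2 i) (- gamma * sin (v1 i t) + u i t)) ->
  (forall k, smooth T k u) ->
  (exists2 B, 0 <= B & forall i t, 0 <= t <= T -> `|v1 i t| <= B /\ `|v2 i t| <= B) /\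
  forall k, smooth T k v1 /\ smooth T k v2.
Proof.
move=> T0 c1 c2 v10 v20 d1 d2 su.
have bound (f g : I -> R -> R) M : 0 <= M -> (forall i, {within `[0, T], continuous (f i)}) ->
    (forall i, f i 0 = 0) -> (forall i t, 0 < t < T -> is_derive t (1 : R) (f i) (g i t)) ->
    (forall i t, 0 < t < T -> `|g i t| <= M) ->
    forall i t, 0 <= t <= T -> `|f i t| <= M * T.
  move=> M0 cf f0 df gM i t tT.
  have := @increment_bound R (f i) (g i) 0 t M; rewrite f0 !subr0.
  have /andP[t0 tT'] := tT => h.
  apply: (@le_trans _ _ (M * t)); last exact: ler_wpM2l.
  apply: h => //.
  - apply: continuous_subspaceW (cf i) => x /=; rewrite !in_itv/= => /andP[-> xt] /=.
    exact: le_trans tT'.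
  - by move=> x /andP[x0 xt]; apply: df; rewrite x0 (lt_le_trans xt).
  - by move=> x /andP[x0 xt]; apply: gM; rewrite x0 (lt_le_trans xt).
have [M hM] := smooth_bounded (su 0%N).
pose M1 := `|gamma| + `|M|; have M10 : 0 <= M1 by exact: addr_ge0.
have h2 : forall i t, 0 <= t <= T -> `|v2 i t| <= M1 * T.
  apply: (bound _ _ _ M10 c2 v20 d2) => i t tT.
  rewrite (le_trans (ler_normD _ _))// /M1 lerD//; last by rewrite (le_trans (hM i t tT)) ?ler_norm.
  by rewrite normrM normrN ler_piMr// ler_norml sin_geN1 sin_le1.
have M20 : 0 <= M1 * T by rewrite mulr_ge0// ltW.
have h1 : forall i t, 0 <= t <= T -> `|v1 i t| <= M1 * T * T.
  apply: (bound _ _ _ M20 c1 v10 d1) => i t /andP[t0 tT].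
  by apply: h2; rewrite !ltW.
split.
  exists (M1 * T * T + M1 * T); first by rewrite addr_ge0// mulr_ge0// ltW.
  move=> i t tT; split.
    by rewrite (le_trans (h1 i t tT))// lerDl.
  by rewrite (le_trans (h2 i t tT))// lerDr mulr_ge0// ltW.
have b1 : exists C, forall i t, 0 < t < T -> `|v1 i t| <= C.
  by exists (M1 * T * T) => i t /andP[t0 tT]; apply: h1; rewrite !ltW.
have b2 : exists C, forall i t, 0 < t < T -> `|v2 i t| <= C.
  by exists (M1 * T) => i t /andP[t0 tT]; apply: h2; rewrite !ltW.
elim=> [|k [IH1 IH2]]; first by split; split.
split; split => //; first by exists v2.
exists (fun i t => - gamma * sin (v1 i t) + u i t) => //.
apply: smoothD => //; apply: smoothM; first exact: smooth_cst.
by have [] := smooth_sincos IH1.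
Qed.

End PendulumSmooth.

(** * Assembly of branch and trunk into a DeepONet *)

Section Padding.
Context (R : realType).

(** Extends a family by zero functions to exactly [p] members, as the numbers of sensors and of
    outputs are prescribed. *)
Definition padf (X : Type) (J : finType) (G : J -> X -> R) (p : nat) (q : 'I_p) : X -> R :=
  if insub (q : nat) is Some i then G (@enum_val J J i) else fun=> 0.

Lemma affspan_padf X (I J : finType) (F : I -> X -> R) (G : J -> X -> R) p (q : 'I_p) :
  (forall j, affspan F (G j)) -> affspan F (padf G q).
Proof.
by move=> h; rewrite /padf; case: insubP => [i _ _|_]; [exact: h|exact: affspan_cst].
Qed.

Lemma sum_padf X Z (J : finType) (G : J -> X -> R) (H : J -> Z -> R) p x z :
  (#|J| <= p)%N -> \sum_(q < p) padf G q x * padf H q z = \sum_j G j x * H j z.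
Proof.
move=> Jp; rewrite [RHS](reindex (@enum_val J J))/=; last exact/onW_bij/enum_val_bij.
rewrite (bigID (fun q : 'I_p => (q < #|J|)%N))/= [X in _ + X]big1 ?addr0; last first.
  by move=> q qJ; rewrite /padf insubF ?mul0r//; exact/negbTE.
rewrite (big_ord_narrow Jp)/=.
apply: eq_bigr => i _; rewrite /padf.
by have -> : insub (nat_of_ord (widen_ord Jp i)) = Some i by exact: valK.
Qed.

End Padding.

Section Assembly.
Context (R : realType).

Lemma dense_size_le m n W L :
  (dense_size m n W L <= m * W + W + L * (W * W + W) + (W * n + n) + m * n)%N.
Proof.
case: L => [|L]; first by rewrite /= mul0n; lia.
have h : (L * (W * W + W) <= L.+1 * (W * W + W))%N by rewrite leq_mul2r leqnSn orbT.
by rewrite dense_sizeS; lia.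
Qed.

Lemma build_deeponet (T : R) m p (J : finType) (node : J -> R)
    (beta : bool * J -> (J -> R) -> R) (psi : J -> R -> R) W1 L1 W2 L2 :
  0 < T -> (forall j, 0 <= node j <= T) -> (#|J| <= m)%N -> (2 * #|J| <= p)%N ->
  reach W1 L1 (fun _ : unit => id) psi ->
  reach W2 L2 (fun (j : J) (x : J -> R) => x j) beta ->
  exists N : deeponet T m p,
    [/\ (net_size (trunk N) <= dense_size 1 (p.+1 * 2) W1 L1)%N,
        net_depth (trunk N) = L1,
        (net_size (branch N) <= dense_size m p W2 L2)%N,
        net_depth (branch N) = L2 &
        forall u t c, deeponet_eval N u t 0 c =
          \sum_j beta (c == 0, j) (fun j => L2_eval u (node j)) * psi j t].
Proof.
move=> T0 nT Jm Jp rpsi rbeta.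
(* Sensors beyond [#|J|] sit at the default time 0, and their values are ignored by [bra]. *)
pose s (i : 'I_m) := padf (fun j (_ : unit) => node j) i tt.
have sT i : 0 <= s i <= T.
  rewrite /s /padf; case: insubP => [j _ _|_]; [exact: nT|].
  by rewrite lexx ltW.
pose e (j : J) : 'I_m := widen_ord Jm (enum_rank j).
have se j : s (e j) = node j.
  rewrite /s /padf.
  have -> : insub (nat_of_ord (e j)) = Some (enum_rank j) by exact: valK.
  by rewrite enum_rankK.
pose bra (q : 'I_p) (z : 'I_m -> R) := padf beta q (fun j => z (e j)).
have rbra : reach W2 L2 (fun (i : 'I_m) (z : 'I_m -> R) => z i) bra.
  have r := reach_pre (fun (z : 'I_m -> R) j => z (e j)) rbeta.
  apply: (@reach_affl _ _ _ _ _ _ _ (fun (j : J) (z : 'I_m -> R) => z (e j))).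
    by move=> j; exact: (affspan_gen (fun (i : 'I_m) (z : 'I_m -> R) => z i) (e j)).
  apply: (reach_affr r) => q.
  exact: (affspan_pre (fun (z : 'I_m -> R) j => z (e j)) (affspan_padf q (affspan_gen beta))).
have [B [Be Bd Bs]] := reach_net rbra.
(* Each output drives one component: [(true, j)] goes with [(psi j, 0)] and [(false, j)] with
   [(0, psi j)], whence [2 * #|J| <= p]. *)
pose comp (c : 'I_2) (bj : bool * J) t := if bj.1 == (c == 0) then psi bj.2 t else 0.
pose tau (k : 'I_p.+1) (c : 'I_2) t :=
  if unlift ord0 k is Some q then padf (comp c) q t else 0.
pose tr (i : 'I_(p.+1 * 2)) t := mxvec (\matrix_(k, c) tau k c t) 0 i.
have rtr : reach W1 L1 (fun _ : 'I_1 => id) tr.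
  apply: (@reach_affl _ _ _ _ _ _ _ (fun _ : unit => id)).
    by move=> _; exact: (affspan_gen _ ord0).
  apply: (reach_affr rpsi) => i; case/mxvec_indexP: i => k c.
  have h : affspan psi (tau k c).
    rewrite /tau; case: unliftP => [q _|_]; last exact: affspan_cst.
    apply: affspan_padf => -[b j]; rewrite /comp /=.
    by case: (b == _); [exact: affspan_gen|exact: affspan_cst].
  by apply: affspan_ext h _ => t; rewrite /tr mxvecE mxE.
have [N [Ne Nd Ns]] := reach_net rtr.
exists (DeepONet sT B N); split => //= u t c.
have Nt k : trunk_eval (DeepONet sT B N) k t = row k (\matrix_(k, c) tau k c t).
  rewrite /trunk_eval /=; congr row; rewrite -[RHS]mxvecK; congr vec_mx.
  have -> : const_mx t = \row_(i < 1) t by apply/rowP => i; rewrite !mxE.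
  by rewrite Ne; apply/rowP => i; rewrite mxE.
rewrite /deeponet_eval mxE Nt !mxE /tau unlift_none add0r summxE.
transitivity (\sum_(q < p) padf beta q (fun j => L2_eval u (node j)) * padf (comp c) q t).
  apply: eq_bigr => q _; rewrite mxE Nt !mxE /tau liftK; congr (_ * _).
  rewrite /branch_eval /= Be mxE /bra; congr (padf beta q).
  by apply/funext => j; rewrite se.
rewrite sum_padf; last by rewrite card_prod card_bool.
transitivity (\sum_(b : bool) \sum_j
    beta (b, j) (fun j => L2_eval u (node j)) * comp c (b, j) t).
  by rewrite pair_bigA; apply: eq_bigr => -[b j].
rewrite (bigD1 (c == 0))//= [X in _ + X]big1 ?addr0.
  by apply: eq_bigr => j _; rewrite /comp eqxx.
by move=> b /negbTE bc; apply: big1 => j _; rewrite /comp /= bc mulr0.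
Qed.

(** Errors up to [eps] in both components give at most [sqrt (2 * T) * eps] in L^2; the factor
    [1 + 2 * T] dominates this without a root. *)
Lemma deeponet_error_le (T : R) m p (d : measure_display) (Omega : measurableType d)
    (P : probability Omega R) (U : {mfun Omega >-> L2_borel T})
    (G : L2 T -> R -> 'rV[R]_2) (N : deeponet T m p) (eps : R) :
  0 < T -> 0 <= eps ->
  (forall w t c, 0 <= t <= T -> `|G (U w) t 0 c - deeponet_eval N (U w) t 0 c| <= eps) ->
  (deeponet_error (distribution P U) G N <= ((1 + 2 * T) * eps)%:E)%E.
Proof.
move=> T0 e0 h; rewrite /deeponet_error; set I := (\int[_]_u _)%E.
have f0 : (forall u : L2_borel T, 0 <= \int[@lebesgue_measure R]_(t in `[0%R, T])
      (\sum_(i < 2) (G u t 0 i - deeponet_eval N u t 0 i) ^+ 2)%:E)%E.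
  by move=> u; apply: integral_ge0 => t _; rewrite lee_fin; apply: sumr_ge0 => i _; exact: sqr_ge0.
have I0 : (0 <= I)%E by apply: integral_ge0 => u _; exact: f0.
have I1 : (I <= (((1 + 2 * T) * eps) ^+ 2)%:E)%E.
  apply: integral_distribution_le => //; first exact: sqr_ge0.
  move=> w.
  have c0 : 0 <= 2 * eps ^+ 2 by rewrite mulr_ge0// sqr_ge0.
  apply: (@le_trans _ _ ((2 * eps ^+ 2)%:E * lebesgue_measure (`[0%R, T]%classic : set R))%E).
    apply: integral_le_cst => //.
    - by move=> t; rewrite lee_fin; apply: sumr_ge0 => i _; exact: sqr_ge0.
    - move=> t; rewrite /= in_itv/= => tT; rewrite lee_fin.
      have -> : 2 * eps ^+ 2 = \sum_(i < 2) eps ^+ 2 by rewrite sumr_const card_ord mulr_natl.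
      apply: ler_sum => i _; rewrite -real_normK ?num_real//.
      by apply: lerXn2r; rewrite ?nnegrE//; exact: h.
  rewrite lebesgue_measure_itv/= lte_fin T0 -EFinD -EFinM lee_fin subr0.
  rewrite exprMn mulrAC; apply: ler_wpM2r; first exact: sqr_ge0.
  nra.
have b0 : 0 <= (1 + 2 * T) * eps by rewrite mulr_ge0// addr_ge0// mulr_ge0// ltW.
apply: (@le_trans _ _ ((((1 + 2 * T) * eps) ^+ 2)%:E `^ 2^-1)%E).
  by apply: gt0_ler_poweR; rewrite ?in_itv/= ?leey ?andbT// ?lee_fin ?sqr_ge0.
by rewrite poweR_EFin powR12_sqrt ?sqr_ge0// sqrtr_sqr ger0_norm.
Qed.

End Assembly.

(** * Choice of the number of blocks and size counts *)

Lemma floor_root a M : (0 < M)%N -> (0 < a)%N ->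
  exists2 n, (0 < n)%N & (n ^ a <= M < n.+1 ^ a)%N.
Proof.
move=> M0 a0.
have ex : exists n, (n ^ a <= M)%N by exists 0%N; rewrite exp0n.
have ub n : (n ^ a <= M)%N -> (n <= M)%N.
  by apply: leq_trans; rewrite -{1}(expn1 n); case: n => // n; rewrite leq_pexp2l.
case: (ex_maxnP ex ub) => n nM max; exists n.
  by rewrite lt0n; apply/eqP => n0; have := max 1%N; rewrite exp1n n0 => /(_ M0).
by rewrite nM ltnNge; apply/negP => /max; rewrite ltnn.
Qed.

Lemma leq_sum5 a b c d e : let S := (a + b + c + d + e)%N in
  [/\ (a <= S)%N, (b <= S)%N, (c <= S)%N, (d <= S)%N & (e <= S)%N].
Proof. by split; lia. Qed.

Lemma affine_trunk_size p : (0 < p)%N -> (dense_size 1 (p.+1 * 2) 0 0 <= 8 * p ^ 3)%N.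
Proof.
move=> p0; have p3 : (p <= p ^ 3)%N by rewrite -{1}(expn1 p) leq_pexp2l.
by rewrite /=; lia.
Qed.

(** At bounded depth and width [O(p)] even the dense count is [O(p^2)]. *)
Lemma trunk_size_bound C L n p W : (0 < p)%N -> (n ^ 2 <= p)%N -> (W <= C * n ^ 2)%N ->
  (dense_size 1 (p.+1 * 2) W L <= (10 * C + L * (C * C + C) + 8) * p ^ 3)%N.
Proof.
move=> p0 np Wn; have WC : (W <= C * p)%N by rewrite (leq_trans Wn)// leq_mul2l np orbT.
have WW : (W * W <= C * C * (p * p))%N by rewrite mulnACA leq_mul.
have pp : (p <= p * p)%N by rewrite leq_pmull.
have p3 : (p * p <= p ^ 3)%N by rewrite !expnS expn0 muln1 leq_mul2l leq_pmull ?orbT.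
have L1 : (L * (W * W + W) <= L * (C * C + C) * (p * p))%N.
  rewrite -mulnA leq_mul2l; apply/orP; right; rewrite mulnDl leq_add//.
  by rewrite (leq_trans WC)// leq_mul2l pp orbT.
have W1 : (W <= C * (p * p))%N by rewrite (leq_trans WC)// leq_mul2l pp orbT.
have Wo : (W * (p.+1 * 2) <= 4 * C * (p * p))%N.
  apply: (@leq_trans (C * p * (4 * p))); last by rewrite -!mulnA; lia.
  by rewrite leq_mul//; lia.
apply: leq_trans (dense_size_le _ _ _ _) _.
apply: (@leq_trans ((10 * C + L * (C * C + C) + 8) * (p * p))); last by rewrite leq_mul2l p3 orbT.
rewrite !mulnDl mul1n; lia.
Qed.

(** The hidden layers contribute depth times squared width, at most of order [n * n^6 <= m] with the
    logarithm estimated by [n]. The outer layers give [m * n^3] and [p * n^3], both at most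
    [p * m]. *)
Lemma branch_size_bound C n m p W s : (0 < m)%N -> (0 < p)%N -> (0 < n)%N ->
  (n ^ 8 <= m)%N -> (n ^ 8 <= p)%N -> (W <= C * n ^ 3)%N -> (s <= C * (trunc_log 2 n).+1)%N ->
  (dense_size m p W s <= (3 * C + 2 * C * (C * C + C) + 2) * (p * m))%N.
Proof.
move=> m0 p0 n0 nm np WC sC.
have pw k : (k <= 8)%N -> (n ^ k <= m)%N /\ (n ^ k <= p)%N.
  by move=> k8; split; apply: leq_trans nm || apply: leq_trans np; rewrite leq_pexp2l.
have [m3 p3] := pw 3%N isT; have [m7 p7] := pw 7%N isT.
have mp : (m <= p * m)%N by rewrite leq_pmull.
have pm : (p <= p * m)%N by rewrite leq_pmulr.
have s2 : (s <= 2 * C * n)%N.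
  apply: leq_trans sC _; rewrite [leqRHS]mulnAC [leqRHS]mulnC leq_mul2l.
  have : (trunc_log 2 n < n)%N by rewrite (leq_trans (ltn_expl _ (ltnSn 1)))// trunc_logP.
  lia.
have W1 : (W <= C * (p * m))%N by rewrite (leq_trans WC)// leq_mul2l (leq_trans m3)// orbT.
have mW : (m * W <= C * (p * m))%N.
  by rewrite mulnC mulnA leq_mul2r (leq_trans WC) ?orbT// leq_mul2l p3 orbT.
have Wp : (W * p <= C * (p * m))%N.
  by rewrite [(p * m)%N]mulnC mulnA leq_mul2r (leq_trans WC) ?orbT// leq_mul2l m3 orbT.
have n36 : (n ^ 3 <= n ^ 6)%N by rewrite leq_pexp2l.
have WW : (W * W + W <= (C * C + C) * n ^ 6)%N.
  rewrite mulnDl leq_add//; last by rewrite (leq_trans WC)// leq_mul2l n36 orbT.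
  by rewrite (expnD n 3 3) mulnACA leq_mul.
have sW : (s * (W * W + W) <= 2 * C * (C * C + C) * (p * m))%N.
  apply: leq_trans (leq_mul s2 WW) _.
  rewrite mulnACA leq_mul2l; apply/orP; right.
  by rewrite -expnS (leq_trans m7).
apply: leq_trans (dense_size_le _ _ _ _) _.
rewrite !mulnDl mul2n -addnn; lia.
Qed.

Lemma deeponet_rate (R : realType) (T gamma : R) (hT : 0 < T) (hgamma : 0 < gamma)
  (G : L2 T -> R -> 'rV[R]_2)
  (hG : forall u : L2 T, pendulum_solution gamma T u (G u))
  (d : measure_display) (Omega : measurableType d) (P : probability Omega R)
  (Y : int -> {RV P >-> R})
  (hY : forall k omega, -1 <= Y k omega <= 1)
  (alpha : int -> R) (Calpha ell : R) (hCalpha : 0 < Calpha) (hell : 0 < ell)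
  (halpha : forall k, 0 <= alpha k <= Calpha * expR (- (`|k|%N%:R * ell)))
  (U : {mfun Omega >-> L2_borel T})
  (hU : forall omega, {ae leb0T T, forall t,
     (U omega : L2 T) t = forcing T alpha (fun k => Y k omega) t}) (k r : nat) :
  exists D : nat, forall m p : nat, (0 < m)%N -> (0 < p)%N ->
    exists N : deeponet T m p,
      [/\ (net_size (trunk N) <= D * p ^ 3)%N, (net_depth (trunk N) <= D)%N,
          (net_size (branch N) <= D * (p * m))%N,
          (net_depth (branch N) <= D * (trunc_log 2 m).+1)%N &
          (deeponet_error (distribution P U) G N <=
            (D%:R * (m%:R ^- k + p%:R ^- r))%:E)%E].
Proof.
pose u w := forcing T alpha (fun k => Y k w).
pose v1 w t := G (U w) t 0 0; pose v2 w t := G (U w) t 0 1.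
have hy w j : -1 <= Y j w <= 1 by exact: hY.
have su n : smooth T n u by have [] := forcing_smooth T T n hCalpha hell hy halpha.
have cu w : continuous (u w) by have [_] := forcing_smooth T T 0 hCalpha hell hy halpha; apply.
have c1 w : {within `[0, T], continuous (v1 w)} by have [/ac_continuous] := hG (U w).
have c2 w : {within `[0, T], continuous (v2 w)} by have [_ /ac_continuous] := hG (U w).
have v10 w : v1 w 0 = 0 by have [_ _ _ _] := hG (U w); rewrite /v1 => ->; rewrite mxE.
have v20 w : v2 w 0 = 0 by have [_ _ _ _] := hG (U w); rewrite /v2 => ->; rewrite mxE.
have d1 w t : 0 < t < T -> is_derive t (1 : R) (v1 w) (v2 w t).
  have [ac _ d1 _ _] := hG (U w); apply: (ac_is_derive ac d1) => s sT.
  exact: within_itv_continuous (c2 w) sT.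
have d2 w t : 0 < t < T -> is_derive t (1 : R) (v2 w) (- gamma * sin (v1 w t) + u w t).
  have [_ ac _ d2 _] := hG (U w).
  apply: (@ac_is_derive R T (v2 w) (fun t => - gamma * sin (v1 w t) + u w t) ac).
    have [N1 [m1 z1 s1]] := leb0T_ae (hU w); have [N2 [m2 z2 s2]] := d2.
    exists (N1 `|` N2); split; first exact: measurableU.
      apply/eqP; rewrite eq_le measure_ge0 andbT.
      by rewrite (le_trans (measureU2 _ _ _))//= z1 z2 adde0.
    move=> s /= h; apply: contrapT => /not_orP[n1 n2]; apply: h => sT.
    have a1 : U w s = u w s by apply: contrapT => a; apply: n1; apply: s1 => /= /(_ sT).
    have a2 : is_derive s (1 : R) (v2 w) (- gamma * sin (v1 w s) + U w s).
      by apply: contrapT => a; apply: n2; apply: s2 => /= /(_ sT).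
    by rewrite -a1.
  move=> s sT; apply: cvgD; last exact: cu.
  apply: cvgMr; apply: continuous_comp; first exact: within_itv_continuous (c1 w) sT.
  exact: continuous_sin.
have [[B B0 hB] sv] := pendulum_smooth hT c1 c2 v10 v20 d1 d2 su.
(* As [min(m, p) < (n + 1)^8 <= (2 n)^8], the error [n^-K] is at most [2^K * min(m, p)^-(k + r)],
   hence at most [2^K * (m^-k + p^-r)]. *)
pose K := (8 * (k + r))%N.
have [n0 [Q [L [C hnets]]]] := pendulum_nets K hT hgamma c1 c2 v10 v20 d1 d2 su sv.
(* From [N1] on, the nets exist and [2 * n * Q <= n^2], so the outputs fit into [p]. *)
pose N1 := (n0 + 2 * Q + 1)%N.
pose E1 := (1 + 2 * T) * C%:R * 2 ^+ K.
pose E2 := (1 + 2 * T) * B * (N1 ^ 8)%:R ^+ (k + r).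
have T2 : 0 <= 1 + 2 * T by rewrite addr_ge0// mulr_ge0// ltW.
pose De := (Num.truncn (E1 + E2)).+1.
have hDe : E1 + E2 <= De%:R by exact/ltW/truncnS_gt.
have E10 : 0 <= E1 by rewrite !mulr_ge0// exprn_ge0.
have E20 : 0 <= E2 by rewrite !mulr_ge0// exprn_ge0.
clearbody De.
pose D1 := (10 * C + L * (C * C + C) + 8)%N.
pose D2 := (3 * C + 2 * C * (C * C + C) + 2)%N.
have [DD1 DD2 DDL DDC DDe] := leq_sum5 D1 D2 L C De.
exists (D1 + D2 + L + C + De)%N => m p m0 p0.
have M0 : (0 < minn m p)%N by rewrite leq_min m0.
have [n n_gt0 /andP[nM Mn]] := floor_root M0 (ltn0Sn 7).
have nm : (n ^ 8 <= m)%N by rewrite (leq_trans nM)// geq_minl.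
have np : (n ^ 8 <= p)%N by rewrite (leq_trans nM)// geq_minr.
have rk0 : 0 <= m%:R ^- k :> R by rewrite invr_ge0 exprn_ge0.
have rr0 : 0 <= p%:R ^- r :> R by rewrite invr_ge0 exprn_ge0.
have rate (X : R) : 1 <= X -> (minn m p)%:R <= X ->
    1 <= X ^+ (k + r) * (m%:R ^- k + p%:R ^- r).
  move=> X1; have X0 : 0 <= X by exact: le_trans X1.
  have Xk q j i : (0 < q)%N -> q%:R <= X -> (j <= i)%N -> 1 <= X ^+ i * q%:R ^- j :> R.
    move=> q0 qX ji; rewrite ler_pdivlMr ?exprn_gt0 ?ltr0n// mul1r.
    apply: (@le_trans _ _ (X ^+ j)); last exact: ler_weXn2l.
    by apply: lerXn2r; rewrite ?nnegrE.
  have [_|_] := leqP m p => MX; rewrite mulrDr.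
    by rewrite (le_trans (Xk _ _ _ m0 MX (leq_addr r k)))// lerDl mulr_ge0// exprn_ge0.
  by rewrite (le_trans (Xk _ _ _ p0 MX (leq_addl k r)))// lerDr mulr_ge0// exprn_ge0.
have S0 : 0 <= m%:R ^- k + p%:R ^- r :> R by exact: addr_ge0.
have fin E eps (N : deeponet T m p) : 0 <= eps -> (1 + 2 * T) * eps <= E * (m%:R ^- k + p%:R ^- r) ->
    E <= De%:R ->
    (forall w t c, 0 <= t <= T -> `|G (U w) t 0 c - deeponet_eval N (U w) t 0 c| <= eps) ->
    (deeponet_error (distribution P U) G N <=
      ((D1 + D2 + L + C + De)%:R * (m%:R ^- k + p%:R ^- r))%:E)%E.
  move=> e0 eE ED h; apply: (le_trans (deeponet_error_le P hT e0 h)); rewrite lee_fin.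
  apply: (le_trans eE); apply: ler_wpM2r => //; apply: (le_trans ED).
  by rewrite ler_nat.
have GE w t c : G (U w) t 0 c = if c == 0 then v1 w t else v2 w t.
  rewrite /v1 /v2; case: eqP => [->//|]; case: c => -[|[|//]] i c0.
    by case: c0; exact: val_inj.
  by congr (G _ _ _ _); exact: val_inj.
have mp : (m <= p * m)%N by rewrite leq_pmull.
have pm : (p <= p * m)%N by rewrite leq_pmulr.
have p3 : (p <= p ^ 3)%N by rewrite -{1}(expn1 p) leq_pexp2l.
(* For small [n] the zero network serves: then [min(m, p) < N1^8], and the bound [B] on the
   solutions is absorbed in [E2]. *)
have [nN|nN] := leqP N1 n; last first.
  have J0 : #|'I_0| = 0%N by rewrite card_ord.
  have h0 (j : 'I_0) : 0 <= (0 : R) <= T by rewrite lexx ltW.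
  have hm : (#|'I_0| <= m)%N by rewrite J0.
  have hp : (2 * #|'I_0| <= p)%N by rewrite J0.
  have rp : reach 0 0 (fun _ : unit => id) (fun (_ : 'I_0) (_ : R) => 0).
    by move=> j; exact: affspan_cst.
  have rb : reach 0 0 (fun (j : 'I_0) (x : 'I_0 -> R) => x j)
      (fun (_ : bool * 'I_0) _ => 0) by move=> j; exact: affspan_cst.
  have [N [Nt Ntd Nb Nbd Ne]] := build_deeponet hT h0 hm hp rp rb.
  exists N; split.
  - apply: (leq_trans Nt); apply: (@leq_trans (8 * p ^ 3)); first exact: affine_trunk_size.
    by rewrite leq_mul2r (leq_trans _ DD1) ?orbT// leq_addl.
  - by rewrite Ntd.
  - apply: (leq_trans Nb); apply: (@leq_trans (2 * (p * m))).
      by rewrite /= mulnC mul2n -addnn leq_add2l.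
    by rewrite leq_mul2r (leq_trans _ DD2) ?orbT// leq_addl.
  - by rewrite Nbd.
  - apply: (fin E2 B) => //; last 2 first.
    + by rewrite (le_trans _ hDe)// lerDr.
    + move=> w t c tT; rewrite Ne big_ord0 subr0 GE.
      by have [b1 b2] := hB w t tT; case: ifP.
    have X1 : 1 <= (N1 ^ 8)%:R :> R by rewrite ler1n expn_gt0 /N1 addn1.
    have XM : (minn m p)%:R <= (N1 ^ 8)%:R :> R.
      by rewrite ler_nat (leq_trans (ltnW Mn))// leq_exp2r.
    have := rate _ X1 XM => h.
    rewrite /E2 -[leRHS]mulrA -[leLHS]mulr1; apply: ler_wpM2l => //.
    by rewrite mulr_ge0.
have nn0 : (n0 <= n)%N by rewrite (leq_trans _ nN)// /N1 -addnA leq_addr.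
have nQ : (2 * Q <= n)%N by rewrite (leq_trans _ nN)// /N1 -addnA addnCA leq_addr.
have n8 : (n * n <= n ^ 8)%N by rewrite mulnn leq_pexp2l.
have [s [psi [beta [sC rpsi rbeta e1 e2]]]] := hnets n n_gt0 nn0.
have nR : 0 < n%:R :> R by rewrite ltr0n.
have nodeT (j : 'I_n * 'I_Q) : 0 < bnode (T / n%:R) j < T.
  have /andP[q0 q1] := qnode_itv R (ltn_ord j.2).
  have HT : n%:R * (T / n%:R) = T by rewrite mulrC divfK// gt_eqF.
  have H0 : 0 < T / n%:R by rewrite divr_gt0.
  rewrite /bnode mulr_gt0 ?ltr_wpDl//= -[ltRHS]HT ltr_pM2r//.
  apply: (@lt_le_trans _ _ (j.1%:R + 1)); first by rewrite ltrD2l.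
  by rewrite natr1 ler_nat.
have nodeT' (j : 'I_n * 'I_Q) : 0 <= bnode (T / n%:R) j <= T.
  by have /andP[h1 h2] := nodeT j; rewrite !ltW.
have cJ : #|{: 'I_n * 'I_Q}| = (n * Q)%N by rewrite card_prod !card_ord.
have J1 : (2 * #|{: 'I_n * 'I_Q}| <= n * n)%N by rewrite cJ mulnCA leq_mul2l nQ orbT.
have J2 : (#|{: 'I_n * 'I_Q}| <= m)%N.
  by rewrite (leq_trans _ (leq_trans n8 nm))// (leq_trans _ J1)// leq_pmull.
have [N [Nt Ntd Nb Nbd Ne]] := build_deeponet hT nodeT' J2
  (leq_trans J1 (leq_trans n8 np)) rpsi rbeta.
exists N; split.
- apply: (leq_trans Nt); apply: leq_trans (trunk_size_bound L p0 _ (leqnn (C * n ^ 2))) _.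
    by rewrite (leq_trans _ np)// leq_pexp2l.
  by rewrite leq_mul2r DD1 orbT.
- by rewrite Ntd.
- apply: (leq_trans Nb); apply: (leq_trans (branch_size_bound m0 p0 n_gt0 nm np (leqnn (C * n ^ 3)) sC)).
  by rewrite leq_mul2r DD2 orbT.
- rewrite Nbd (leq_trans sC)//; apply: leq_mul => //.
  by rewrite ltnS leq_trunc_log// (leq_trans _ nm)// -{1}(expn1 n) leq_pexp2l.
- have nK0 : 0 <= n%:R ^- K :> R by rewrite invr_ge0 exprn_ge0.
  apply: (fin E1 (C%:R * n%:R ^- K)).
  + exact: mulr_ge0.
  + have n1 : 1 <= n%:R :> R by rewrite ler1n.
    have X1 : 1 <= (2 * n%:R) ^+ 8 :> R by apply: exprn_ege1; lra.
    have XM : (minn m p)%:R <= (2 * n%:R) ^+ 8 :> R.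
      rewrite -natrM -natrX ler_nat (leq_trans (ltnW Mn))// leq_exp2r//.
      by rewrite mul2n -addnn -addn1 leq_add2l.
    have := rate _ X1 XM; rewrite -exprM -/K exprMn => h.
    rewrite /E1 mulrA -[leRHS]mulrA; apply: ler_wpM2l; first exact: mulr_ge0.
    by rewrite -(ler_pM2r (exprn_gt0 K nR)) mulVf ?expf_neq0 ?gt_eqF// mulrAC.
  + by rewrite (le_trans _ hDe)// lerDl.
  + move=> w t c tT; rewrite Ne GE.
    (* The nodes are interior, where the point values of the class are those of the series. *)
    have -> : (fun j : 'I_n * 'I_Q => L2_eval (U w) (bnode (T / n%:R) j)) =
        (fun j => u w (bnode (T / n%:R) j)).
      by apply/funext => j; exact: (L2_eval_continuous (cu w) (hU w) (nodeT j)).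
    by case: ifP => _; [exact: e1|exact: e2].
Qed.

(** * Comparison of the logarithmic factors *)

Section LogBounds.
Context (R : realType).

(** [e < 3], from [5/6 <= e^(-1/6)] and [(5/6)^6 > 1/3]. *)
Lemma ln3_gt1 : 1 < ln 3 :> R.
Proof.
have e : expR (-1) = expR (- 6^-1) ^+ 6 :> R.
  by rewrite -expRM_natl; congr expR; field.
have h : (5 / 6) ^+ 6 <= expR (-1) :> R.
  rewrite e; apply: lerXn2r; rewrite ?nnegrE ?expR_ge0//.
  by apply: le_trans (expR_ge1Dx _); lra.
have e3 : expR 1 < 3 :> R.
  rewrite -[1]opprK expRN invf_plt ?posrE ?expR_gt0//.
  by apply: lt_le_trans h; lra.
by rewrite -ltr_expR lnK// posrE; lra.
Qed.

(** For [m >= 3] the factor [ln (ln m)] is at least [ln (ln 3)], positive though small, whose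
    inverse enters [kappa]. *)
Lemma log_loglog_bounds : exists2 kappa : R, 0 < kappa & forall m, (0 < m)%N ->
  1 <= kappa * log_loglog R m /\
  (trunc_log 2 m).+1%:R <= kappa * (1 + log_loglog R m).
Proof.
have l3 := ln3_gt1; have q0 : 0 < ln (ln 3) :> R by exact: ln_gt0.
have l2 : 0 < ln 2 :> R by apply: ln_gt0; lra.
set q := ln (ln 3) in q0; pose A := q^-1 + (q * ln 2)^-1.
have i0 : 0 < q^-1 by rewrite invr_gt0.
have i1 : 0 < (q * ln 2)^-1 by rewrite invr_gt0 mulr_gt0.
exists (2 + A); first by rewrite addr_gt0// addr_gt0.
move=> m m0; rewrite /log_loglog; case: leqP => m2.
  rewrite mulr1; split; first by rewrite /A; lra.
  have : ((trunc_log 2 m).+1%:R : R) <= 2.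
    by rewrite ler_nat ltnS; apply: leq_trans (leq_trunc_log 2 m2) _.
  by rewrite /A; lra.
have m3 : 3 <= m%:R :> R by rewrite ler_nat.
have lm : ln 3 <= ln m%:R :> R by rewrite ler_ln ?posrE// ?ltr0n.
have lm0 : 0 < ln m%:R :> R by lra.
have l30 : 0 < ln 3 :> R by lra.
have qm : q <= ln (ln m%:R) by rewrite /q ler_ln ?posrE.
set X := ln m%:R in lm lm0 qm *.
have h1 : q * X <= X * ln X by rewrite mulrC; apply: ler_wpM2l => //; lra.
have XL : X <= q^-1 * (X * ln X) by rewrite ler_pdivlMl// .
have LL0 : 0 <= X * ln X by apply: le_trans h1; rewrite mulr_ge0 ?(ltW q0)//; lra.
have tl : (trunc_log 2 m)%:R * ln 2 <= X.
  rewrite mulr_natl -lnXn; last by lra.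
  rewrite /X ler_ln ?posrE ?exprn_gt0 ?ltr0n//.
  by rewrite -natrX ler_nat trunc_logP.
have tl' : (trunc_log 2 m)%:R <= (q * ln 2)^-1 * (X * ln X).
  rewrite invfM mulrAC ler_pdivlMr//; exact: le_trans tl XL.
have p1 : 0 <= q^-1 * (X * ln X) by rewrite mulr_ge0// ltW.
have p2 : 0 <= (q * ln 2)^-1 * (X * ln X) by rewrite mulr_ge0// ltW.
split; first by rewrite /A !mulrDl; lra.
by rewrite -natr1 /A !mulrDl !mulrDr; lra.
Qed.

End LogBounds.

Theorem theorem4p10 (R : realType) (T gamma : R) (hT : 0 < T) (hgamma : 0 < gamma)
  (G : L2 T -> R -> 'rV[R]_2)
  (hG : forall u : L2 T, pendulum_solution gamma T u (G u))
  (d : measure_display) (Omega : measurableType d) (P : probability Omega R)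
  (Y : int -> {RV P >-> R})
  (hYiid : iid Y)
  (hY : forall k omega, -1 <= Y k omega <= 1)
  (alpha : int -> R) (Calpha ell : R) (hCalpha : 0 < Calpha) (hell : 0 < ell)
  (halpha : forall k, 0 <= alpha k <= Calpha * expR (- (`|k|%N%:R * ell)))
  (U : {mfun Omega >-> L2_borel T})
  (hU : forall omega, {ae leb0T T, forall t,
     (U omega : L2 T) t = forcing T alpha (fun k => Y k omega) t}) :
  forall k r : nat, exists C c : R, [/\ 0 < C, 0 < c &
    forall m p : nat, (0 < m)%N -> (0 < p)%N ->
    exists N : deeponet T m p,
      [/\ (net_size (trunk N))%:R <= C * (1 + p%:R ^+ 3),
          (net_depth (trunk N))%:R <= C * (1 + p%:R * ln p%:R),
          (net_size (branch N))%:R <= C * (1 + p%:R * m%:R * log_loglog R m),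
          (net_depth (branch N))%:R <= C * (1 + log_loglog R m) &
          (deeponet_error (distribution P U) G N <=
           (C * expR (- c * ell * m%:R) + C * m%:R ^- k + C * p%:R ^- r)%:E)%E]].
Proof.
move=> k r; have [D hD] := deeponet_rate hT hgamma hG hY hCalpha hell halpha hU k r.
have [kappa kappa0 hk] := log_loglog_bounds R.
(* Dominates both [D] and [D * kappa]; the last summand makes it positive. *)
pose C := D%:R * (1 + kappa) + 1.
have D0 : 0 <= D%:R :> R by [].
have Dk0 : 0 <= D%:R * kappa by rewrite mulr_ge0// ltW.
exists C, 1; split => //; first by rewrite ltr_wpDl// mulr_ge0// addr_ge0// ltW.
have DC : D%:R <= C by rewrite /C mulrDr mulr1; lra.
have DkC : D%:R * kappa <= C by rewrite /C mulrDr mulr1; lra.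
have C0 : 0 <= C by exact: le_trans DC.
move=> m p m0 p0; have [N [Nt Ntd Nb Nbd Ne]] := hD m p m0 p0; exists N.
have [LL1 LL2] := hk m m0.
have pm0 : 0 <= p%:R * m%:R :> R by rewrite mulr_ge0.
split.
- apply: (@le_trans _ _ (D%:R * p%:R ^+ 3)); first by rewrite -natrX -natrM ler_nat.
  by rewrite ler_pM ?exprn_ge0// lerDr.
- apply: (@le_trans _ _ D%:R); first by rewrite ler_nat.
  rewrite (le_trans DC)// ler_peMr// lerDl mulr_ge0// ln_ge0//.
  by rewrite ler1n.
- apply: (@le_trans _ _ (D%:R * (p%:R * m%:R))); first by rewrite -!natrM ler_nat.
  apply: (@le_trans _ _ (D%:R * kappa * (p%:R * m%:R * log_loglog R m))).
    rewrite -mulrA; apply: ler_wpM2l => //.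
    by rewrite mulrCA ler_peMr.
  have LL0 : 0 <= log_loglog R m.
    by rewrite -(pmulr_rge0 _ kappa0) (le_trans _ LL1).
  by apply: ler_pM => //; [exact: mulr_ge0|rewrite lerDr].
- apply: (@le_trans _ _ (D%:R * (trunc_log 2 m).+1%:R)); first by rewrite -natrM ler_nat.
  apply: (@le_trans _ _ (D%:R * kappa * (1 + log_loglog R m))).
    by rewrite -mulrA; exact: ler_wpM2l.
  apply: ler_wpM2r => //.
  by rewrite -(pmulr_rge0 _ kappa0) (le_trans _ LL2).
- apply: (le_trans Ne); rewrite lee_fin -addrA -mulrDr.
  have S0 : 0 <= m%:R ^- k + p%:R ^- r :> R by rewrite addr_ge0// invr_ge0 exprn_ge0.
  by rewrite (le_trans (ler_wpM2r S0 DC))// lerDr mulr_ge0// expR_ge0.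
Qed.
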